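(* There exist smooth, compactly supported solutions $\sigma_\pm$ of the system $$\partial_t\sigma_+-\mathbb U(\sigma_-)\cdot\nabla\sigma_+=0,\qquad \partial_t\sigma_-+\mathbb U(\sigma_+)\cdot\nabla\sigma_-=0$$ on $\mathbb R^2$ such that $\operatorname{supp}(\sigma_+(\cdot,0))\cap\operatorname{supp}(\sigma_-(\cdot,0))=\emptyset$, and $\operatorname{Int}(\operatorname{supp}(\sigma_+(\cdot,T)))\cap\operatorname{Int}(\operatorname{supp}(\sigma_-(\cdot,T)))\neq\emptyset$ for some $T>0$.
   Context: $\mathbb U(\omega)=\nabla^\perp\Delta^{-1}\omega$ with $\nabla^\perp=(-\partial_2,\partial_1)$, i.e. convolution with $\frac1{2\pi}\frac{(-x_2,x_1)}{|x|^2}$. $\operatorname{Int}$ denotes topological interior and $\operatorname{supp}$ the (closed) support. *)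

(* Defs.v *)
From HB Require Import structures.
From mathcomp Require Import all_boot all_order all_algebra.
From mathcomp Require Import all_classical all_reals all_analysis.
Set Implicit Arguments.
Unset Strict Implicit.
Unset Printing Implicit Defensive.
Import Order.TTheory GRing.Theory Num.Theory.
Import numFieldNormedType.Exports.
Local Open Scope classical_set_scope.
Local Open Scope ring_scope.

(* The plane is [R * R].  Its canonical norm is the max norm, so the Euclidean
   [|x|^2] is written out in coordinates. *)

Fixpoint of_class_C (R : realType) (V : normedModType R) (k : nat)
    (f : V -> R) : Prop :=
  if k is k'.+1 then
    (forall x : V, differentiable f x) /\
    (forall v : V, of_class_C k' (fun x => 'D_v f x))
  else continuous f.

(* C^infinity; meant for finite-dimensional [V], where continuity of all the
   iterated directional derivatives is the usual notion. *)
Definition smooth (R : realType) (V : normedModType R) (f : V -> R) : Prop :=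
  forall k : nat, of_class_C k f.

Definition supp (R : realType) (T : topologicalType) (f : T -> R) : set T :=
  closure [set x | f x != 0].

Definition dot (R : realType) (u v : R * R) : R := u.1 * v.1 + u.2 * v.2.

Definition grad (R : realType) (f : R * R -> R) (x : R * R) : R * R :=
  ('D_((1, 0) : R * R) f x, 'D_((0, 1) : R * R) f x).

(* The kernel of grad^perp Delta^-1.  Its value at the origin is the junk value
   0, which does not affect integrals. *)
Definition biot_savart_kernel (R : realType) (x : R * R) : R * R :=
  let r2 := x.1 ^+ 2 + x.2 ^+ 2 in
  ((2 * pi)^-1 * (- x.2 / r2), (2 * pi)^-1 * (x.1 / r2)).

Definition lebesgue2 (R : realType) :=
  (@lebesgue_measure R \x @lebesgue_measure R)%E.

(* The convolution of the kernel with [omega]; the integrand is integrable when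
   [omega] is continuous with compact support. *)
Definition biot_savart (R : realType) (omega : R * R -> R) (x : R * R) : R * R :=
  (Rintegral (@lebesgue2 R) setT
     (fun y => (biot_savart_kernel (x - y : R * R)).1 * omega y),
   Rintegral (@lebesgue2 R) setT
     (fun y => (biot_savart_kernel (x - y : R * R)).2 * omega y)).

(* A time-dependent function on the plane is [sigma : R -> R * R -> R], time
   first.  Only times [t >= 0] are meaningful: smoothness up to [t = 0] on the
   closed half-space [0, +oo[ x R^2 is expressed as smoothness of [sigma] on all
   of R x R^2, and nothing else is required for [t < 0]. *)
Definition smooth_in_spacetime (R : realType) (sigma : R -> R * R -> R) : Prop :=
  smooth (fun z : R * (R * R) => sigma z.1 z.2).

(* Compact support in space, locally uniformly in time: a nonzero solution
   cannot vanish for large times, so compactness is asked of the support in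
   [0, T] x R^2 for each finite T. *)
Definition compactly_supported_in_space (R : realType)
    (sigma : R -> R * R -> R) : Prop :=
  forall T : R, 0 <= T ->
    compact (closure [set z : R * (R * R) |
                        0 <= z.1 <= T /\ sigma z.1 z.2 != 0]).

Definition solves_system (R : realType)
    (sigmap sigmam : R -> R * R -> R) : Prop :=
  forall (t : R) (x : R * R), 0 <= t ->
    derive1 (fun s : R => sigmap s x) t
      - dot (biot_savart (sigmam t) x) (grad (sigmap t) x) = 0 /\
    derive1 (fun s : R => sigmam s x) t
      + dot (biot_savart (sigmap t) x) (grad (sigmam t) x) = 0.

(* Main.v *)
(* The solution is the limit of an explicit Lagrangian Euler scheme: one step
   replaces [(f, g)] by [(f (x + h U g), g (x - h U f))], with [U] the Biot-Savart
   operator.  Composition does not increase sup norms, and [U] costs only a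
   logarithm: if [|g| <= P] and [|dg| <= Y] then [|dU g| <= C (1 + P) (1 + ln (1 + Y))].
   A discrete Osgood argument therefore bounds all derivatives on bounded time
   intervals; halving the step changes the result by [O(h)] in every [C^k], so the
   dyadic schemes converge, for all times.  Exchanging the roles of the two
   components solves the system backward in time.
   The initial data are nonnegative and their supports, cones with vertex at the
   origin, meet only there.  The values of both velocities at the origin are
   integrals of an explicitly signed kernel, which shows that the supports are
   pushed into each other: they overlap at small positive times, and were disjoint
   at small negative times.  A translation in time gives the theorem. *)
From HB Require Import structures.
Require Import Defs.
From mathcomp Require Import all_boot all_order all_algebra.
From mathcomp Require Import all_classical all_reals all_analysis.
From mathcomp Require Import measurable_realfun ring lra.
Import Order.TTheory GRing.Theory Num.Theory.
Import numFieldNormedType.Exports.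
Local Open Scope classical_set_scope.
Local Open Scope ring_scope.

(** Existence for all times is essential: smoothness is asked on all of space-time, and time must
    also run backward from the contact. The obstacle is that the plain bound on [U] is linear in the
    derivatives of its argument: a step would multiply a derivative bound [Y] by [1 + O(h (1 + Y))],
    which allows blow-up in finite time. With the logarithm, writing [Y] as [expR z] leaves linear
    growth of [z], hence a doubly exponential bound. Putting the contact at time 0 makes the
    crossing a first-order question. There one component moves with velocity [- U gm] and the other
    with [U gp], so only the sum [w] of [U gp] and [U gm] at the origin matters. Differences between
    points of the two open cones satisfy [0 < x] and [y < x], and overlap requires just [0 < w.1]
    and [w.2 < w.1]. Both follow from integrals of [(y + c x) / (x^2 + y^2)] with [c = 0] and
    [c = 1], whose numerators are positive on both cones. No flow map of the limit is constructed:
    characteristics of the scheme, known up to [O(t^2)] and an arbitrarily small error, locate both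
    supports. *)

Section scalar.
Context {R : realType}.

Lemma quad_cvg (phi : R -> R) (l C : R) :
  (forall h, `|phi h - phi 0 - h * l| <= C * h ^+ 2) ->
  h^-1 * (phi h - phi 0) @[h --> 0^'] --> l.
Proof.
move=> H; apply/cvgrPdist_le => e e0.
have C0 : 0 <= C by have := H 1; rewrite expr1n mulr1; apply: le_trans; rewrite normr_ge0.
near=> h.
have hn0 : h != 0 by near: h; exact: nbhs_dnbhs_neq.
have hle : `|h| <= e / (C + 1).
  near: h; apply: dnbhs0_le; rewrite divr_gt0//; lra.
rewrite distrC (_ : _ - l = h^-1 * (phi h - phi 0 - h * l)); last by field.
rewrite normrM normfV ler_pdivrMl ?normr_gt0//.
apply: (le_trans (H h)); rewrite -[h ^+ 2]real_normK ?num_real// expr2 mulrCA.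
apply: ler_wpM2l => //.
rewrite -(ler_pM2l (_ : 0 < (C+1)^-1)) ?invr_gt0; last by lra.
apply: le_trans (_ : `|h| <= _); last by rewrite mulrC.
rewrite mulrA ler_piMl ?normr_ge0// mulrC ler_pdivrMr; lra.
Unshelve. all: by end_near. Qed.

Lemma quad_is_derive (phi : R -> R) (x l C : R) :
  (forall h, `|phi (x + h) - phi x - h * l| <= C * h ^+ 2) ->
  is_derive x (1:R) phi l.
Proof.
move=> H.
have K : h^-1 *: ((phi \o shift x) (h *: (1:R)) - phi x) @[h --> 0^'] --> l.
  have := @quad_cvg (fun h => phi (x + h)) l C.
  rewrite addr0 => /(_ H).
  rewrite (_ : (fun h => h^-1 * (phi (x + h) - phi x)) =
    (fun h => h^-1 *: ((phi \o shift x) (h *: (1:R)) - phi x)))//.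
  by apply/funext => h; rewrite /= [_%:A]mulr1 (addrC h).
apply: DeriveDef; first by apply/cvg_ex; exists l.
by rewrite /derive; apply/cvg_lim.
Qed.

(** The intermediate point is a fraction [th] of the increment, so that later estimates treat both
    signs of [h], and [h = 0], alike. *)
Lemma mvt_shift (phi dphi : R -> R) (x h : R) :
  (forall y, is_derive y (1:R) phi (dphi y)) ->
  exists2 th, 0 <= th <= 1 & phi (x + h) - phi x = h * dphi (x + th * h).
Proof.
move=> H.
have cphi y : {for y, continuous phi}.
  by apply: differentiable_continuous; apply/derivable1_diffP; have [] := H y.
have [h0|h0|->] := ltgtP h 0; last first.
- by exists 0; rewrite ?lexx ?ler01// addr0 subrr mul0r.
- have ab : x <= x + h by lra.
  have [|c /[!in_itv]/= /andP[c1 c2] E] := MVT_segment ab (fun z _ => H z).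
    by apply: continuous_subspaceT => z; exact: cphi.
  exists ((c - x) / h).
    rewrite ler_pdivlMr// mul0r ler_pdivrMr// mul1r; lra.
  by rewrite divfK ?gt_eqF// addrCA subrr addr0 E (addrC x) addrK mulrC.
- have ab : x + h <= x by lra.
  have [|c /[!in_itv]/= /andP[c1 c2] E] := MVT_segment ab (fun z _ => H z).
    by apply: continuous_subspaceT => z; exact: cphi.
  exists ((c - x) / h).
    rewrite ler_ndivlMr// mul0r ler_ndivrMr// mul1r; lra.
  rewrite divfK ?lt_eqF// addrCA subrr addr0.
  by rewrite -opprB E opprD addNKr mulrN opprK mulrC.
Qed.

End scalar.

(** * Calculus on the plane *)

Section plane_calculus.
Context {R : realType}.
Implicit Types (f g a b : R -> R -> R) (i j : bool) (k : nat).

Definition sh i (s : R) f : R -> R -> R :=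
  fun x y => if i then f x (y + s) else f (x + s) y.

Lemma d_subproof : {D : bool -> (R -> R -> R) -> R -> R -> R |
  forall i f x y, D i f x y = derive1 (fun s => sh i s f x y) 0}.
Proof. by exists (fun i f x y => derive1 (fun s => sh i s f x y) 0). Qed.

(* Kept opaque: conversion must not unfold the limit behind [derive1]. *)
Definition d := sval d_subproof.

Lemma dE i f x y : d i f x y = derive1 (fun s => sh i s f x y) 0.
Proof. exact: (svalP d_subproof). Qed.

(* The uniform quadratic remainder passes to limits and compositions, so that limits
   and derivatives never have to be exchanged. *)
Definition pd i f g := exists C, forall s x y,
  `|sh i s f x y - f x y - s * g x y| <= C * s ^+ 2.

Lemma sh0 i f x y : sh i 0 f x y = f x y.
Proof. by rewrite /sh; case: i; rewrite addr0. Qed.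

Lemma pd_is_derive i f g x y s : pd i f g ->
  is_derive s (1 : R) (fun t => sh i t f x y) (sh i s g x y).
Proof.
move=> [C HC]; apply: (@quad_is_derive R _ _ _ C) => h.
by have := HC h (if i then x else x + s) (if i then y + s else y);
  rewrite /sh; case: i {HC}; rewrite addrA.
Qed.

Lemma pd_d i f g : pd i f g -> d i f = g.
Proof.
move=> H; apply/funext => x; apply/funext => y.
have := pd_is_derive _ _ _ x y 0 H; rewrite sh0 => E.
by rewrite dE derive1E; exact: derive_val.
Qed.

Lemma pd_mvt i f g s x y : pd i f g ->
  exists2 th, 0 <= th <= 1 & sh i s f x y - f x y = s * sh i (th * s) g x y.
Proof.
move=> H.
have [th th01 E] := @mvt_shift R (fun t => sh i t f x y) (fun t => sh i t g x y)
   0 s (fun z => pd_is_derive _ _ _ x y z H).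
by exists th => //; move: E; rewrite sh0 !add0r.
Qed.

Lemma quad_ge0 (C : R) (P : R -> R -> R -> R) :
  (forall s x y, `|P s x y| <= C * s ^+ 2) -> 0 <= C.
Proof. by move=> /(_ 1 0 0); rewrite expr1n mulr1; apply: le_trans. Qed.

Lemma pd_cst i (c : R) : pd i (fun _ _ => c) (fun _ _ => 0).
Proof. by exists 0 => s x y; rewrite /sh; case: i; rewrite subrr mulr0 subr0 mul0r normr0. Qed.

Lemma pd_lin i f f' g g' (c e : R) : pd i f f' -> pd i g g' ->
  pd i (fun x y => c * f x y + e * g x y) (fun x y => c * f' x y + e * g' x y).
Proof.
move=> [C HC] [D HD]; exists (`|c| * C + `|e| * D) => s x y.
have -> : sh i s (fun x y => c * f x y + e * g x y) x y =
  c * sh i s f x y + e * sh i s g x y by rewrite /sh; case: i {HC HD}.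
have -> : forall F f f' G g g' : R, c * F + e * G - (c * f + e * g) - s * (c * f' + e * g')
   = c * (F - f - s * f') + e * (G - g - s * g') by move=> *; ring.
rewrite (le_trans (ler_normD _ _))// !normrM mulrDl -!mulrA lerD//; exact: ler_wpM2l.
Qed.

Lemma pd_sub i f f' g g' : pd i f f' -> pd i g g' ->
  pd i (fun x y => f x y - g x y) (fun x y => f' x y - g' x y).
Proof.
have E (u v : R -> R -> R) : (fun x y => u x y - v x y) =
    (fun x y => 1 * u x y + (-1) * v x y).
  by apply/funext => x; apply/funext => y; rewrite mul1r mulN1r.
by rewrite !E; exact: pd_lin.
Qed.

(** Of the three terms of the product remainder only [s * f' * (G - g)] is not visibly quadratic;
    the mean value theorem gives [G - g] its factor [s]. The bound [A] makes the constant uniform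
    over the plane. *)
Lemma pd_mul i f f' g g' (A : R) : pd i f f' -> pd i g g' ->
  (forall x y, `|f x y| <= A) -> (forall x y, `|f' x y| <= A) ->
  (forall x y, `|g x y| <= A) -> (forall x y, `|g' x y| <= A) ->
  pd i (fun x y => f x y * g x y) (fun x y => f' x y * g x y + f x y * g' x y).
Proof.
move=> Hf Hg Af Af' Ag Ag'.
have [C HC] := Hf; have [D HD] := Hg.
have A0 : 0 <= A := le_trans (normr_ge0 _) (Af 0 0).
exists (C * A + A * A + A * D) => s x y.
have -> : sh i s (fun x y => f x y * g x y) x y =
  sh i s f x y * sh i s g x y by rewrite /sh; case: i {HC HD Hf Hg}.
have -> : forall F f f' G g g' : R, F * G - f * g - s * (f' * g + f * g')
   = (F - f - s * f') * G + s * f' * (G - g) + f * (G - g - s * g') by move=> *; ring.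
have [th _ E] := pd_mvt i g g' s x y Hg.
have SG : `|sh i s g x y| <= A by rewrite /sh; case: (i).
have SG' : `|sh i (th * s) g' x y| <= A by rewrite /sh; case: (i).
rewrite (mulrDl (C * A + A * A)) (mulrDl (C * A)).
apply: le_trans (ler_normD _ _) (lerD _ _); last by rewrite normrM -mulrA ler_pM.
apply: le_trans (ler_normD _ _) (lerD _ _); first by rewrite normrM mulrAC ler_pM.
rewrite E mulrACA !normrM -[s ^+ 2]real_normK ?num_real// expr2 mulrC.
by rewrite ler_wpM2r ?mulr_ge0// ler_pM.
Qed.

(** The ball of radius [M] in C^k, one bound serving all orders. The constants inside [pd] are not
    controlled by [M]; a remainder with constant [M] costs two orders, see [bd_taylor]. *)
Fixpoint bd k (M : R) f : Prop :=
  (forall x y, `|f x y| <= M) /\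
  if k is k'.+1 then forall i, pd i f (d i f) /\ bd k' M (d i f) else True.

Definition sm f := forall k, exists M, bd k M f.

Lemma bd_le0 k M f : bd k M f -> forall x y, `|f x y| <= M.
Proof. by case: k => [|k] []. Qed.

Lemma bd_ge0 k M f : bd k M f -> 0 <= M.
Proof. by move=> /bd_le0 /(_ 0 0); exact: le_trans. Qed.

Lemma bd_pd k M f i : bd k.+1 M f -> pd i f (d i f).
Proof. by case=> _ /(_ i) []. Qed.

Lemma bd_d k M f i : bd k.+1 M f -> bd k M (d i f).
Proof. by case=> _ /(_ i) []. Qed.

Lemma bdS k M f : (forall x y, `|f x y| <= M) ->
  (forall i, exists2 g, pd i f g & bd k M g) -> bd k.+1 M f.
Proof.
move=> H0 H1; split => // i; have [g pg bg] := H1 i.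
by rewrite (pd_d _ _ _ pg).
Qed.

Lemma bd_mono k k' M M' f : (k' <= k)%N -> M <= M' -> bd k M f -> bd k' M' f.
Proof.
move=> kk MM; elim: k' k kk f => [|k' IH] [|k] //= kk f [H0 H1].
- by split => // x y; exact: le_trans MM.
- by split => // x y; exact: le_trans MM.
split; first by move=> x y; exact: le_trans MM.
by move=> i; have [p b] := H1 i; split => //; exact: IH b.
Qed.

Lemma bd_cst k (c : R) : bd k `|c| (fun _ _ => c).
Proof.
elim: k c => [|k IH] c; first by split.
apply: bdS => // i; exists (fun _ _ => 0); first exact: pd_cst.
by apply: bd_mono (IH 0) => //; rewrite normr0.
Qed.

Lemma bd_lin k M N f g (c e : R) : bd k M f -> bd k N g ->
  bd k (`|c| * M + `|e| * N) (fun x y => c * f x y + e * g x y).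
Proof.
have B0 M' N' f' g' : (forall x y : R, `|f' x y| <= M') -> (forall x y : R, `|g' x y| <= N') ->
    forall x y : R, `|c * f' x y + e * g' x y| <= `|c| * M' + `|e| * N'.
  move=> H1 H2 x y; rewrite (le_trans (ler_normD _ _))// !normrM.
  by rewrite lerD// ler_wpM2l.
elim: k f g => [|k IH] f g bf bg.
  by split => //; apply: B0; [case: bf | case: bg].
apply: bdS; first by apply: B0; [case: bf | case: bg].
move=> i; exists (fun x y => c * d i f x y + e * d i g x y).
  by apply: pd_lin; apply: bd_pd; eassumption.
by apply: IH; apply: bd_d.
Qed.

Lemma bd_add k M N f g : bd k M f -> bd k N g -> bd k (M + N) (fun x y => f x y + g x y).
Proof.
move=> bf bg; have := bd_lin k M N f g 1 1 bf bg; rewrite normr1 !mul1r.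
by congr (bd _ _ _); apply/funext => x; apply/funext => y; rewrite !mul1r.
Qed.

Lemma bd_sub k M N f g : bd k M f -> bd k N g -> bd k (M + N) (fun x y => f x y - g x y).
Proof.
move=> bf bg; have := bd_lin k M N f g 1 (-1) bf bg; rewrite normrN1 normr1 !mul1r.
by congr (bd _ _ _); apply/funext => x; apply/funext => y; rewrite !mul1r mulN1r.
Qed.

Lemma bd_scale k M f (c : R) : bd k M f -> bd k (`|c| * M) (fun x y => c * f x y).
Proof.
move=> bf; have := bd_lin k M M f f c 0 bf bf; rewrite normr0 mul0r addr0.
by congr (bd _ _ _); apply/funext => x; apply/funext => y; rewrite mul0r addr0.
Qed.

Lemma bd_mul k M N f g : bd k M f -> bd k N g ->
  bd k (2 ^+ k * (M * N)) (fun x y => f x y * g x y).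
Proof.
have B0 M' N' f' g' : (forall x y : R, `|f' x y| <= M') -> (forall x y : R, `|g' x y| <= N') ->
    forall x y : R, `|f' x y * g' x y| <= M' * N'.
  by move=> H1 H2 x y; rewrite normrM ler_pM.
elim: k f g => [|k IH] f g bf bg.
  by split => //; rewrite expr0 mul1r; apply: B0; [case: bf | case: bg].
have M0 := bd_ge0 _ _ _ bf; have N0 := bd_ge0 _ _ _ bg.
apply: bdS.
  move=> x y; rewrite (le_trans (B0 _ _ _ _ (bd_le0 _ _ _ bf) (bd_le0 _ _ _ bg) x y))//.
  by rewrite ler_peMl ?mulr_ge0// exprn_ege1// ler1n.
move=> i; exists (fun x y => d i f x y * g x y + f x y * d i g x y).
  apply: (pd_mul _ _ _ _ _ (M + N)); try by apply: bd_pd; eassumption.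
  - by move=> x y; apply: le_trans (bd_le0 _ _ _ bf x y) _; rewrite lerDl.
  - by move=> x y; apply: le_trans (bd_le0 _ _ _ (bd_d _ _ _ i bf) x y) _; rewrite lerDl.
  - by move=> x y; apply: le_trans (bd_le0 _ _ _ bg x y) _; rewrite lerDr.
  - by move=> x y; apply: le_trans (bd_le0 _ _ _ (bd_d _ _ _ i bg) x y) _; rewrite lerDr.
rewrite exprS -mulrA mulrDl !mul1r.
apply: bd_add; apply: IH => //; try exact: bd_d.
- exact: bd_mono bg.
- exact: bd_mono bf.
Qed.

Lemma bd_lim k M f : (forall e, 0 < e -> bd k (M + e) f) -> bd k M f.
Proof.
elim: k f => [|k IH] f H.
  split=> // x y; apply/ler_addgt0Pr => e e0.
  by have [] := H e e0.
apply: bdS.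
  by move=> x y; apply/ler_addgt0Pr => e e0; have [] := H e e0.
move=> i; exists (d i f); first exact: bd_pd (H 1 ltr01).
by apply: IH => e /H; exact: bd_d.
Qed.

Lemma bd_sh_lip k M f i s x y : bd k.+1 M f -> `|sh i s f x y - f x y| <= M * `|s|.
Proof.
move=> bf; have [th _ ->] := pd_mvt _ _ _ s x y (bd_pd _ _ _ i bf).
rewrite normrM mulrC ler_wpM2r// /sh; case: i; exact: bd_le0 (bd_d _ _ _ _ bf) _ _.
Qed.

Lemma bd_lip k M f x y p q : bd k.+1 M f ->
  `|f (x + p) (y + q) - f x y| <= M * (`|p| + `|q|).
Proof.
move=> bf; rewrite -(subrKA (f x (y + q))) (le_trans (ler_normD _ _))// mulrDr lerD//.
  exact: (bd_sh_lip _ _ _ false p x (y + q) bf).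
exact: (bd_sh_lip _ _ _ true q x y bf).
Qed.

(** The increment is split along two sides of a rectangle, each giving a mean value; [bd_lip] brings
    both derivatives back to [(x, y)]. The constant depends on [M] alone, so it survives limits and
    compositions. *)
Lemma bd_taylor k M f x y p q : bd k.+2 M f ->
  `|f (x + p) (y + q) - f x y - p * d false f x y - q * d true f x y| <= M * (`|p| + `|q|) ^+ 2.
Proof.
move=> bf.
have [th /andP[th0 th1]] := pd_mvt _ _ _ p x (y + q) (bd_pd _ _ _ false bf); rewrite /sh => E1.
have [ph /andP[ph0 ph1]] := pd_mvt _ _ _ q x y (bd_pd _ _ _ true bf); rewrite /sh => E2.
have -> : forall A C D : R, A - f x y - p * C - q * D =
    (A - f x (y + q)) + (f x (y + q) - f x y) - p * C - q * D by move=> *; ring.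
rewrite E1 E2.
have -> : forall A B C D : R, p * A + q * B - p * C - q * D = p * (A - C) + q * (B - D)
  by move=> *; ring.
have M0 := bd_ge0 _ _ _ bf.
have L1 := bd_lip _ _ _ x y (th * p) q (bd_d _ _ _ false bf).
have L2 := bd_lip _ _ _ x y 0 (ph * q) (bd_d _ _ _ true bf).
rewrite addr0 normr0 add0r in L2.
rewrite (le_trans (ler_normD _ _))// !normrM.
have T1 : `|th * p| <= `|p| by rewrite normrM ger0_norm// ler_piMl.
have T2 : `|ph * q| <= `|q| by rewrite normrM ger0_norm// ler_piMl.
have {}L1 := le_trans L1 (ler_wpM2l M0 (lerD T1 (lexx `|q|))).
have {}L2 := le_trans L2 (ler_wpM2l M0 T2).
have := lerD (ler_wpM2l (normr_ge0 p) L1) (ler_wpM2l (normr_ge0 q) L2).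
move/le_trans; apply.
rewrite -subr_ge0.
have -> : forall P Q : R, M * (P + Q) ^+ 2 - (P * (M * (P + Q)) + Q * (M * Q)) = M * (P * Q)
  by move=> *; ring.
by rewrite !mulr_ge0.
Qed.

Lemma sm_bd f k : sm f -> exists2 M, 0 <= M & bd k M f.
Proof. by move=> /(_ k) [M bM]; exists M => //; exact: bd_ge0 bM. Qed.

Lemma sm_pd f i : sm f -> pd i f (d i f).
Proof. by move=> /(_ 1%N) [M]; exact: bd_pd. Qed.

Lemma sm_d f i : sm f -> sm (d i f).
Proof. by move=> H k; have [M bM] := H k.+1; exists M; exact: bd_d bM. Qed.

Lemma sm_lin f g (c e : R) : sm f -> sm g -> sm (fun x y => c * f x y + e * g x y).
Proof.
by move=> H1 H2 k; have [M bM] := H1 k; have [N bN] := H2 k; eexists; exact: bd_lin bM bN.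
Qed.

Lemma sm_add f g : sm f -> sm g -> sm (fun x y => f x y + g x y).
Proof.
by move=> H1 H2 k; have [M bM] := H1 k; have [N bN] := H2 k; eexists; exact: bd_add bM bN.
Qed.

Lemma sm_sub f g : sm f -> sm g -> sm (fun x y => f x y - g x y).
Proof.
by move=> H1 H2 k; have [M bM] := H1 k; have [N bN] := H2 k; eexists; exact: bd_sub bM bN.
Qed.

Lemma sm_mul f g : sm f -> sm g -> sm (fun x y => f x y * g x y).
Proof.
by move=> H1 H2 k; have [M bM] := H1 k; have [N bN] := H2 k; eexists; exact: bd_mul bM bN.
Qed.

Lemma sm_cst (c : R) : sm (fun _ _ => c).
Proof. by move=> k; eexists; exact: bd_cst. Qed.

Lemma d_lin i f g (c e : R) : sm f -> sm g ->
  d i (fun x y => c * f x y + e * g x y) = fun x y => c * d i f x y + e * d i g x y.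
Proof. by move=> sf sg; apply: pd_d; apply: pd_lin; exact: sm_pd. Qed.

Lemma d_add i f g : sm f -> sm g ->
  d i (fun x y => f x y + g x y) = fun x y => d i f x y + d i g x y.
Proof.
move=> sf sg; have := d_lin i _ _ 1 1 sf sg; under eq_fun do under eq_fun do rewrite !mul1r.
by move=> ->; under eq_fun do under eq_fun do rewrite !mul1r.
Qed.

Lemma d_sub i f g : sm f -> sm g ->
  d i (fun x y => f x y - g x y) = fun x y => d i f x y - d i g x y.
Proof.
move=> sf sg; have := d_lin i _ _ 1 (-1) sf sg; under eq_fun do under eq_fun do rewrite mul1r mulN1r.
by move=> ->; under eq_fun do under eq_fun do rewrite mul1r mulN1r.
Qed.

Lemma d_scale i f (c : R) : sm f -> d i (fun x y => c * f x y) = fun x y => c * d i f x y.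
Proof.
move=> sf; have := d_lin i _ _ c 0 sf sf; under eq_fun do under eq_fun do rewrite mul0r addr0.
by move=> ->; under eq_fun do under eq_fun do rewrite mul0r addr0.
Qed.

Lemma d_mul i f g : sm f -> sm g ->
  d i (fun x y => f x y * g x y) = fun x y => d i f x y * g x y + f x y * d i g x y.
Proof.
move=> sf sg; apply: pd_d.
have [M M0 bf] := sm_bd _ 1 sf; have [N N0 bg] := sm_bd _ 1 sg.
apply: (pd_mul _ _ _ _ _ (M + N)); try exact: sm_pd.
- by move=> x y; apply: le_trans (bd_le0 _ _ _ bf x y) _; rewrite lerDl.
- by move=> x y; apply: le_trans (bd_le0 _ _ _ (bd_d _ _ _ i bf) x y) _; rewrite lerDl.
- by move=> x y; apply: le_trans (bd_le0 _ _ _ bg x y) _; rewrite lerDr.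
- by move=> x y; apply: le_trans (bd_le0 _ _ _ (bd_d _ _ _ i bg) x y) _; rewrite lerDr.
Qed.

End plane_calculus.

(** * Composition with a small displacement *)

Section composition.
Context {R : realType}.
Implicit Types (f g a b : R -> R -> R) (i j : bool) (k : nat).

Lemma pd_sh i j (s : R) f g : pd i f g -> pd i (sh j s f) (sh j s g).
Proof.
move=> [C H]; exists C => t x y.
have := H t (if j then x else x + s) (if j then y + s else y).
by rewrite /sh; case: i {H}; case: j; rewrite 1?(addrAC _ _ t).
Qed.

Lemma sm_sh j (s : R) f : sm f -> sm (sh j s f).
Proof.
move=> H k; elim: k f H => [|k IH] f H.
  have [M [bM _]] := H 0%N; exists M; split => // x y.
  by rewrite /sh; case: j.
have [M [bM _]] := H 0%N.
have [M0 b0] := IH _ (sm_d _ false H); have [M1 b1] := IH _ (sm_d _ true H).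
exists (`|M| + `|M0| + `|M1|); apply: bdS.
  move=> x y; apply: (@le_trans _ _ M); first by rewrite /sh; case: (j).
  by rewrite (le_trans (ler_norm M))// -addrA lerDl addr_ge0.
move=> i; exists (sh j s (d i f)); first by apply: pd_sh; exact: sm_pd.
case: i; [apply: bd_mono b1 | apply: bd_mono b0] => //.
  by rewrite (le_trans (ler_norm M1))// lerDr addr_ge0.
by rewrite (le_trans (ler_norm M0))// addrAC lerDr addr_ge0.
Qed.

Lemma clairaut f : sm f -> d true (d false f) = d false (d true f).
Proof.
move=> sf; apply/funext => x; apply/funext => y.
have [M M0 bM] := sm_bd _ 3 sf.
apply/eqP; rewrite -subr_eq0 -normr_le0; apply/ler_addgt0Pr => e e0; rewrite add0r.
(* Each mixed derivative varies by at most [2 * M * s] over a square of half-side [s], so the two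
   together by at most [4 * M * s <= e]. *)
pose s : R := e / (4 * M + 1).
have s0 : 0 < s by rewrite divr_gt0//; lra.
(* second difference computed in both orders by the mean value theorem *)
have key i j : i = ~~ j -> exists2 q : R * R, `|q.1| <= s /\ `|q.2| <= s &
    sh true s (sh false s f) x y - sh i s f x y - (sh j s f x y - f x y) =
    s ^+ 2 * d j (d i f) (x + q.1) (y + q.2).
  move=> ij.
  have P : pd i (fun x y => sh j s f x y - f x y)
     (fun x y => sh j s (d i f) x y - d i f x y).
    by apply: pd_sub; [apply: pd_sh|]; apply: sm_pd.
  have [t /andP[t0 t1] E1] := pd_mvt _ _ _ s x y P.
  have [r /andP[r0 r1] E2] := pd_mvt _ _ _ s (if i then x else x + t * s)
     (if i then y + t * s else y) (sm_pd _ j (sm_d _ i sf)).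
  have Q z : 0 <= z -> z <= 1 -> `|z * s| <= s.
    move=> z0 z1; rewrite normrM !ger0_norm//; last exact: ltW.
    by rewrite ler_piMl// ltW.
  exists (if i then r * s else t * s, if i then t * s else r * s).
    by case: (i) => /=; split; exact: Q.
  move: E1 E2; rewrite ij /sh /=; case: (j) => /= E1 E2.
    by rewrite E1 E2 mulrA -expr2.
  by move: E1; rewrite E2 mulrA -expr2 => <-.
have [[q1 q2] /= [q1s q2s] E1] := key false true erefl.
have [[r1 r2] /= [r1s r2s] E2] := key true false erefl.
have s2 : s ^+ 2 != 0 by rewrite expf_eq0/= gt_eqF.
have E : d true (d false f) (x + q1) (y + q2) = d false (d true f) (x + r1) (y + r2).
  apply: (mulfI s2); apply: etrans (esym E1) (etrans _ E2).
  by move: (sh true s (sh false s f) x y) (sh true s f x y) (sh false s f x y) => A B C; ring.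
have L1 := bd_lip _ _ _ x y q1 q2 (bd_d _ _ _ true (bd_d _ _ _ false bM)).
have L2 := bd_lip _ _ _ x y r1 r2 (bd_d _ _ _ false (bd_d _ _ _ true bM)).
have -> : d true (d false f) x y - d false (d true f) x y =
  (d false (d true f) (x + r1) (y + r2) - d false (d true f) x y) -
  (d true (d false f) (x + q1) (y + q2) - d true (d false f) x y) by rewrite E; ring.
rewrite (le_trans (ler_normB _ _))// (le_trans (lerD L2 L1))//.
apply: (@le_trans _ _ (4 * M * s)).
  rewrite -mulrDr mulrC [4 * M]mulrC -mulrA mulrC ler_wpM2l// mulrC; lra.
by rewrite /s mulrA ler_pdivrMr ?[_ * e]mulrC ?ler_wpM2l ?ltW//; lra.
Qed.

Lemma d_comm i j f : sm f -> d i (d j f) = d j (d i f).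
Proof. by case: i; case: j => //= sf; rewrite clairaut. Qed.

(** The inner map is recorded by its displacement: unlike the map itself, [a] and [b] are bounded,
    and of size [O(h)] in a step of the scheme. *)
Definition cmp a b f : R -> R -> R := fun x y => f (x + a x y) (y + b x y).

Lemma pd_cmp i f a b : sm f -> sm a -> sm b ->
  pd i (cmp a b f) (fun x y => cmp a b (d i f) x y +
    (d i a x y * cmp a b (d false f) x y + d i b x y * cmp a b (d true f) x y)).
Proof.
move=> sf sa sb.
have [M M0 bM] := sm_bd _ 2 sf.
have [A A0 bA] := sm_bd _ 1 sa; have [B B0 bB] := sm_bd _ 1 sb.
have [Ca HCa] := sm_pd _ i sa; have [Cb HCb] := sm_pd _ i sb.
have Ca0 := quad_ge0 _ _ HCa; have Cb0 := quad_ge0 _ _ HCb.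
exists (M * Ca + M * Cb + M * (2 + A + B) ^+ 2) => s x y.
(* [p] and [q] are the increments of the inner map in its two coordinates; the boolean coefficients
   are the increments of the identity. *)
pose p := (~~ i)%:R * s + (sh i s a x y - a x y).
pose q := i%:R * s + (sh i s b x y - b x y).
have -> : sh i s (cmp a b f) x y = f (x + a x y + p) (y + b x y + q).
  by rewrite /p /q /sh /cmp; case: (i) => /=; congr (f _ _); ring.
pose X := x + a x y; pose Y := y + b x y.
have T := bd_taylor _ _ _ X Y p q bM.
set F := f _ _; rewrite -/X -/Y in F *.
have -> : F - cmp a b f x y - s * (cmp a b (d i f) x y +
    (d i a x y * cmp a b (d false f) x y + d i b x y * cmp a b (d true f) x y)) =
  (sh i s a x y - a x y - s * d i a x y) * d false f X Y +
  (sh i s b x y - b x y - s * d i b x y) * d true f X Y +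
  (F - f X Y - p * d false f X Y - q * d true f X Y).
  by rewrite /cmp -/X -/Y /p /q; case: (i) => /=; ring.
rewrite (mulrDl (M * Ca + M * Cb)) (mulrDl (M * Ca)).
apply: le_trans (ler_normD _ _) (lerD _ _).
  apply: le_trans (ler_normD _ _) (lerD _ _); rewrite normrM mulrC -[M * _ * _]mulrA ler_pM//.
    exact: bd_le0 (bd_d _ _ _ false bM) _ _.
  exact: bd_le0 (bd_d _ _ _ true bM) _ _.
apply: le_trans T _; rewrite -mulrA ler_wpM2l// -[s ^+ 2]real_normK ?num_real// -exprMn.
rewrite ler_pXn2r ?nnegrE ?addr_ge0 ?mulr_ge0//; last by rewrite !addr_ge0.
have L1 := bd_sh_lip _ _ _ i s x y bA; have L2 := bd_sh_lip _ _ _ i s x y bB.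
have P1 : `|p| <= `|s| + A * `|s|.
  apply: le_trans (ler_normD _ _) (lerD _ L1).
  by case: (i); rewrite /= ?mul0r ?normr0 ?mul1r.
have P2 : `|q| <= `|s| + B * `|s|.
  apply: le_trans (ler_normD _ _) (lerD _ L2).
  by case: (i); rewrite /= ?mul0r ?normr0 ?mul1r.
by apply: le_trans (lerD P1 P2) _; rewrite le_eqVlt; apply/orP; left; apply/eqP; ring.
Qed.

Lemma d_cmp i f a b : sm f -> sm a -> sm b -> d i (cmp a b f) =
  fun x y => cmp a b (d i f) x y +
    (d i a x y * cmp a b (d false f) x y + d i b x y * cmp a b (d true f) x y).
Proof. by move=> sf sa sb; apply: pd_d; exact: pd_cmp. Qed.

(* [G] bounds the growth factor of the derivatives up to order [k]; the next one
   is linear in the bound [A] on the derivatives of order [k + 1] of the shift. *)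
Lemma bd_cmpS k (A G : R) a b : sm a -> sm b -> 0 <= G ->
  bd k.+1 A a -> bd k.+1 A b ->
  (forall f M, sm f -> bd k M f -> bd k (G * M) (cmp a b f)) ->
  forall f M, sm f -> bd k.+1 M f -> 1 <= G ->
    bd k.+1 (G * (1 + 2 ^+ k.+1 * A) * M) (cmp a b f).
Proof.
move=> sa sb G0 ba bb H f M sf bf G1.
have M0 := bd_ge0 _ _ _ bf; have A0 := bd_ge0 _ _ _ ba.
have H0 : forall x y, `|f x y| <= M := bd_le0 _ _ _ bf.
apply: bdS => [x y|i].
  apply: le_trans (H0 _ _) _; rewrite ler_peMl// mulr_ege1// lerDl.
  by rewrite mulr_ge0// exprn_ge0.
eexists; first exact: pd_cmp.
have C1 := H _ _ (sm_d _ false sf) (bd_d _ _ _ false bf).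
have C2 := H _ _ (sm_d _ true sf) (bd_d _ _ _ true bf).
have C3 := H _ _ (sm_d _ i sf) (bd_d _ _ _ i bf).
have E1 := bd_mul _ _ _ _ _ (bd_d _ _ _ i ba) C1.
have E2 := bd_mul _ _ _ _ _ (bd_d _ _ _ i bb) C2.
have := bd_add _ _ _ _ _ C3 (bd_add _ _ _ _ _ E1 E2).
apply: bd_mono => //; rewrite exprS le_eqVlt; apply/orP; left; apply/eqP; ring.
Qed.

(** Displacements of size [h] change C^k bounds by a factor [1 + O(h)], which is what remains
    bounded over [O(1 / h)] steps. The second half isolates the top order: [A] enters linearly, so
    the logarithmic bound can be inserted for it. The second half with [A = P] is the first half at
    the next order, which drives the induction. *)
Lemma bd_cmp k (P : R) : 0 <= P -> exists2 c, 0 <= c & forall h A a b, 0 <= h <= 1 ->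
  sm a -> sm b -> bd k (h * P) a -> bd k (h * P) b ->
  bd k.+1 (h * A) a -> bd k.+1 (h * A) b ->
  (forall f M, sm f -> bd k M f -> bd k ((1 + h * c) * M) (cmp a b f)) /\
  (forall f M, sm f -> bd k.+1 M f -> bd k.+1 ((1 + h * (c * (1 + A))) * M) (cmp a b f)).
Proof.
move=> P0; elim: k => [|k [c c0 IH]].
  exists 2 => // h A a b /andP[h0 h1] sa sb _ _ bA bB.
  have B0 f M : sm f -> bd 0 M f -> bd 0 (1 * M) (cmp a b f).
    by move=> _ [H _]; rewrite mul1r; split=> // x y; rewrite /cmp.
  split.
    move=> f M sf bf; apply: bd_mono (B0 _ _ sf bf) => //.
    by rewrite ler_wpM2r ?(bd_ge0 _ _ _ bf)// lerDl mulr_ge0.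
  move=> f M sf bf; have := bd_cmpS _ _ _ _ _ sa sb ler01 bA bB B0 _ _ sf bf (lexx _).
  apply: bd_mono => //; rewrite ler_wpM2r ?(bd_ge0 _ _ _ bf)// expr1 mul1r.
  rewrite lerD2l; lra.
pose c' := c * (1 + P) + 2 ^+ k.+2 * (1 + c * (1 + P)).
have cP : 0 <= c * (1 + P) by rewrite mulr_ge0// addr_ge0.
have e0 : 0 <= 2 ^+ k.+2 :> R by rewrite exprn_ge0.
have c'0 : 0 <= c' by rewrite addr_ge0// mulr_ge0// addr_ge0.
exists c' => // h A a b /andP[h0 h1] sa sb ba bb bA bB.
have [//|||_ H2] := IH h P a b _ sa sb _ _ ba bb.
- by apply/andP.
- exact: bd_mono ba.
- exact: bd_mono bb.
split.
  move=> f M sf bf; apply: bd_mono (H2 _ _ sf bf) => //.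
  rewrite ler_wpM2r ?(bd_ge0 _ _ _ bf)// lerD2l ler_wpM2l// lerDl.
  by rewrite mulr_ge0// addr_ge0.
move=> f M sf bf.
have G1 : 1 <= 1 + h * (c * (1 + P)) by rewrite lerDl mulr_ge0.
have hA0 := bd_ge0 _ _ _ bA.
have := bd_cmpS _ _ _ _ _ sa sb (le_trans ler01 G1) bA bB H2 _ _ sf bf G1.
apply: bd_mono => //; rewrite ler_wpM2r ?(bd_ge0 _ _ _ bf)//.
rewrite /c'; set e := 2 ^+ _ in e0 *; set t := c * _ in cP *.
have -> : (1 + h * t) * (1 + e * (h * A)) = 1 + h * t + (h * A) * e + (h * A) * (h * t) * e by ring.
have -> : 1 + h * ((t + e * (1 + t)) * (1 + A)) =
  1 + h * t + (h * A) * e + (h * A) * t * e + (h * A) * t + h * (e * (1 + t)) by ring.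
(* The product of the two growth factors contains a term quadratic in [h]; [h <= 1] brings it back
   to first order. *)
have : (h * A) * (h * t) * e <= (h * A) * t * e.
  by rewrite ler_wpM2r// ler_wpM2l// ler_piMl.
have : 0 <= h * A * t by rewrite mulr_ge0.
have : 0 <= h * (e * (1 + t)) by apply: mulr_ge0 => //; apply: mulr_ge0 => //; exact: addr_ge0.
lra.
Qed.

Lemma sm_cmp f a b : sm f -> sm a -> sm b -> sm (cmp a b f).
Proof.
move=> sf sa sb k.
have [A A0 bA] := sm_bd _ k.+1 sa; have [B B0 bB] := sm_bd _ k.+1 sb.
have [M M0 bf] := sm_bd _ k sf.
have P0 : 0 <= A + B by rewrite addr_ge0.
have [c _ H] := bd_cmp k _ P0.
have [|||||+ _] := H 1 (A + B) a b _ sa sb.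
- by rewrite ler01 lexx.
- by apply: bd_mono bA => //; rewrite mul1r lerDl.
- by apply: bd_mono bB => //; rewrite mul1r lerDr.
- by apply: bd_mono bA => //; rewrite mul1r lerDl.
- by apply: bd_mono bB => //; rewrite mul1r lerDr.
by move=> /(_ _ _ sf bf) ?; eexists; eassumption.
Qed.

(** Lipschitz dependence on the displacement. One derivative of [f] is lost, through the Lipschitz
    bound at order 0; the chain rule reproduces the same kind of difference at each further
    order. *)
Lemma bd_cmp_sub k (P : R) : 0 <= P -> exists2 c, 0 <= c & forall e f a b a' b',
  sm f -> sm a -> sm b -> sm a' -> sm b' -> bd k.+1 P f ->
  bd k P a -> bd k P b -> bd k P a' -> bd k P b' ->
  bd k e (fun x y => a x y - a' x y) -> bd k e (fun x y => b x y - b' x y) ->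
  bd k (c * e) (fun x y => cmp a b f x y - cmp a' b' f x y).
Proof.
move=> P0; elim: k => [|k [c c0 IH]].
  exists (2 * P); first by rewrite mulr_ge0.
  move=> e f a b a' b' sf sa sb sa' sb' bf _ _ _ _ [ha _] [hb _].
  split=> // x y; rewrite /cmp.
  have := bd_lip _ _ _ (x + a' x y) (y + b' x y) (a x y - a' x y) (b x y - b' x y) bf.
  rewrite !addrA ![_ + _ + a _ _]addrAC ![_ + _ + b _ _]addrAC !addrK => /le_trans; apply.
  rewrite [2 * P]mulrC -mulrA ler_wpM2l//; have := ha x y; have := hb x y; lra.
have [q q0 Hq] := bd_cmp k _ P0.
pose D := 2 ^+ k * ((1 + 1 * q) * P).
have D0 : 0 <= D by rewrite mulr_ge0 ?exprn_ge0// mulr_ge0// mul1r addr_ge0.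
pose E := 2 ^+ k * (P * c).
have E0 : 0 <= E by rewrite mulr_ge0 ?exprn_ge0// mulr_ge0.
pose c' := 2 * P + c + 2 * D + 2 * E.
have c'0 : 0 <= c' by rewrite /c'; lra.
exists c' => // e f a b a' b' sf sa sb sa' sb' bf ba bb ba' bb' ha hb.
have e0 := bd_ge0 _ _ _ ha.
apply: bdS => [x y|i].
  have := bd_lip _ _ _ (x + a' x y) (y + b' x y) (a x y - a' x y) (b x y - b' x y) bf.
  rewrite !addrA ![_ + _ + a _ _]addrAC ![_ + _ + b _ _]addrAC !addrK => /le_trans; apply.
  apply: (@le_trans _ _ (2 * P * e)).
    rewrite [2 * P]mulrC -mulrA ler_wpM2l//.
    have := bd_le0 _ _ _ ha x y; have := bd_le0 _ _ _ hb x y; lra.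
  rewrite ler_wpM2r// /c'; lra.
exists (d i (fun x y => cmp a b f x y - cmp a' b' f x y)).
  by apply: sm_pd; apply: sm_sub; exact: sm_cmp.
rewrite d_sub; try exact: sm_cmp; rewrite !d_cmp//.
have mo g (Hg : bd k.+1 P g) : bd k P g by exact: bd_mono Hg.
have me g (Hg : bd k.+1 e g) : bd k e g by exact: bd_mono Hg.
have K g : sm g -> bd k.+1 P g -> bd k (c * e) (fun x y => cmp a b g x y - cmp a' b' g x y).
  by move=> sg bg; apply: IH => //; solve [exact: mo | exact: me].
have sd j : sm (d j f) by exact: sm_d.
have bdd j : bd k.+1 P (d j f) by exact: bd_d.
have Q g : sm g -> bd k P g -> bd k ((1 + 1 * q) * P) (cmp a b g).
  move=> sg bg; have [|||||+ _] := Hq 1 P a b _ sa sb; rewrite ?mul1r//.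
  - by rewrite ler01 lexx.
  - exact: mo.
  - exact: mo.
  - by apply.
(* A difference of products is split by inserting [d i u'] times the first composition: one factor
   differs in the displacement, the other in the composed function. *)
have T u u' j : sm u -> sm u' -> bd k.+1 P u' -> bd k.+1 e (fun x y => u x y - u' x y) ->
   bd k (D * e + E * e) (fun x y => d i u x y * cmp a b (d j f) x y -
     d i u' x y * cmp a' b' (d j f) x y).
  move=> su su' bu' bu.
  have F1 := bd_d _ _ _ i bu; rewrite d_sub// in F1.
  have F2 := bd_mul _ _ _ _ _ F1 (Q _ (sd j) (mo _ (bdd j))).
  have F3 := bd_mul _ _ _ _ _ (bd_d _ _ _ i bu') (K _ (sd j) (bdd j)).
  have -> : D * e + E * e = 2 ^+ k * (e * ((1 + 1 * q) * P)) + 2 ^+ k * (P * (c * e)).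
    by rewrite /D /E; ring.
  have := bd_add _ _ _ _ _ F2 F3.
  by congr (bd _ _ _); apply/funext => x; apply/funext => y => /=; ring.
have := bd_add _ _ _ _ _ (K _ (sd i) (bdd i)) (bd_add _ _ _ _ _
  (T a a' false sa sa' ba' ha) (T b b' true sb sb' bb' hb)).
match goal with |- bd _ _ ?F -> bd _ _ ?G => have -> : F = G end.
  by apply/funext => x; apply/funext => y => /=; ring.
apply: bd_mono => //.
have -> : c * e + (D * e + E * e + (D * e + E * e)) = (c + 2 * D + 2 * E) * e by ring.
rewrite ler_wpM2r// /c'; lra.
Qed.

(** Differentiating the remainder gives the remainder for [d i f] plus terms
    [d i a * (cmp a b g - g)] and likewise for [b], with [g] a derivative of [f]. Both factors of
    these are [O(e)], so the bound [e ^+ 2] passes to all orders. *)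
Lemma bd_cmp_taylor k (P : R) : 0 <= P -> exists2 c, 0 <= c & forall e f a b,
  0 <= e <= P -> sm f -> sm a -> sm b -> bd k.+2 P f -> bd k e a -> bd k e b ->
  bd k (c * e ^+ 2) (fun x y => cmp a b f x y - f x y -
    (a x y * d false f x y + b x y * d true f x y)).
Proof.
move=> P0; elim: k => [|k [c c0 IH]].
  exists (4 * P); first by rewrite mulr_ge0.
  move=> e f a b /andP[e0 e1] sf sa sb bf [ha _] [hb _].
  split=> // x y; rewrite /cmp.
  have := bd_taylor _ _ _ x y (a x y) (b x y) bf; rewrite opprD addrA => /le_trans; apply.
  rewrite [4 * P]mulrC -mulrA ler_wpM2l//.
  rewrite (_ : 4 * e ^+ 2 = (e + e) ^+ 2); last by ring.
  by rewrite ler_pXn2r ?nnegrE ?addr_ge0// lerD.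
have P10 : 0 <= P + 1 by rewrite addr_ge0.
have [q q0 Hq] := bd_cmp_sub k _ P10.
pose E := 2 ^+ k * q.
have E0 : 0 <= E by rewrite mulr_ge0 ?exprn_ge0.
pose c' := 4 * P + c + 2 * E.
have c'0 : 0 <= c' by rewrite /c'; lra.
exists c' => // e f a b /andP[e0 e1] sf sa sb bf ba bb.
apply: bdS => [x y|i].
  have := bd_taylor _ _ _ x y (a x y) (b x y) bf; rewrite /cmp opprD addrA => /le_trans; apply.
  apply: (@le_trans _ _ (4 * P * e ^+ 2)); last by rewrite ler_wpM2r ?sqr_ge0// /c'; lra.
  rewrite [4 * P]mulrC -mulrA ler_wpM2l//.
  rewrite (_ : 4 * e ^+ 2 = (e + e) ^+ 2); last by ring.
  by rewrite ler_pXn2r ?nnegrE ?addr_ge0// lerD// (bd_le0 _ _ _ ba, bd_le0 _ _ _ bb).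
have sd j : sm (d j f) by exact: sm_d.
have s1 : sm (fun x y => a x y * d false f x y + b x y * d true f x y).
  by apply: sm_add; exact: sm_mul.
have s2 : sm (fun x y => cmp a b f x y - f x y) by apply: sm_sub => //; exact: sm_cmp.
exists (d i (fun x y => cmp a b f x y - f x y -
    (a x y * d false f x y + b x y * d true f x y))).
  by apply: sm_pd; exact: sm_sub.
rewrite d_sub// d_sub//; last exact: sm_cmp.
rewrite d_cmp// d_add; try exact: sm_mul.
rewrite !d_mul// (d_comm i false)// (d_comm i true)//.
have me g (Hg : bd k.+1 e g) : bd k e g by exact: bd_mono Hg.
have mP g (Hg : bd k.+1 e g) : bd k (P + 1) g.
  by apply: bd_mono Hg => //; apply: le_trans e1 _; rewrite lerDl.
have I : bd k (c * e ^+ 2) (fun x y => cmp a b (d i f) x y - d i f x y -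
    (a x y * d false (d i f) x y + b x y * d true (d i f) x y)).
  by apply: IH; rewrite ?e0//; try exact: me; exact: bd_d.
have Q j : bd k (q * e) (fun x y => cmp a b (d j f) x y - d j f x y).
  have -> : (fun x y => cmp a b (d j f) x y - d j f x y) =
     (fun x y => cmp a b (d j f) x y - cmp (fun _ _ => 0) (fun _ _ => 0) (d j f) x y).
    by apply/funext => x; apply/funext => y; rewrite /cmp !addr0.
  have Z : bd k (P + 1) (fun _ _ => 0).
    by apply: bd_mono (bd_cst k 0) => //; rewrite normr0.
  have N g : bd k.+1 e g -> bd k e (fun x y => g x y - 0).
    by under [X in _ -> bd _ _ X]eq_fun do under eq_fun do rewrite subr0; exact: me.
  apply: Hq => //; try exact: sm_cst; try exact: mP; try exact: N.
  by apply: bd_mono (bd_d _ _ _ j bf) => //; rewrite lerDl.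
have T u j : bd k.+1 e u -> bd k (E * e ^+ 2) (fun x y => d i u x y *
    (cmp a b (d j f) x y - d j f x y)).
  move=> bu; have := bd_mul _ _ _ _ _ (bd_d _ _ _ i bu) (Q j).
  by apply: bd_mono => //; rewrite /E le_eqVlt; apply/orP; left; apply/eqP; ring.
have := bd_add _ _ _ _ _ I (bd_add _ _ _ _ _ (T a false ba) (T b true bb)).
match goal with |- bd _ _ ?F -> bd _ _ ?G => have -> : F = G end.
  by apply/funext => x; apply/funext => y => /=; ring.
apply: bd_mono => //.
have -> : c * e ^+ 2 + (E * e ^+ 2 + E * e ^+ 2) = (c + 2 * E) * e ^+ 2 by ring.
rewrite ler_wpM2r ?sqr_ge0// /c'; lra.
Qed.

End composition.

(** * Geometric convergence in every C^k, and functions supported in a box *)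

Section completeness.
Context {R : realType}.
Implicit Types (F : nat -> R -> R -> R) (k n : nat).

Lemma half_small (e : R) : 0 < e -> exists n, (2 ^+ n)^-1 < e.
Proof.
move=> e0; have ei : 0 <= e^-1 by rewrite invr_ge0 ltW.
have [n /= En] : exists n, e^-1 < n%:R by exists (Num.truncn e^-1).+1; exact: truncnS_gt.
exists n; rewrite invf_plt ?posrE ?exprn_gt0// (lt_trans En)//.
by rewrite -natrX ltr_nat ltn_expl.
Qed.

Lemma geo_cauchy (u : nat -> R) (C : R) :
  (forall n, `|u n.+1 - u n| <= C / 2 ^+ n) ->
  forall n m, (n <= m)%N -> `|u m - u n| <= 2 * C / 2 ^+ n.
Proof.
move=> H n m nm.
have C0 : 0 <= C.
  by have := H 0%N; rewrite expr0 divr1; exact: le_trans.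
(* With the tail subtracted, the induction on [p] closes with equality. *)
suff S p : `|u (n + p)%N - u n| <= 2 * C / 2 ^+ n - 2 * C / 2 ^+ (n + p).
  rewrite -(subnKC nm); apply: le_trans (S _) _.
  by rewrite lerBlDr lerDl divr_ge0 ?exprn_ge0// mulr_ge0.
elim: p => [|p IH]; first by rewrite addn0 !subrr normr0.
rewrite addnS -(subrKA (u (n + p)%N)); apply: le_trans (ler_normD _ _) _.
apply: le_trans (lerD (H _) IH) _.
have p2 : (2 : R) ^+ (n + p) != 0 by rewrite expf_neq0.
rewrite le_eqVlt; apply/orP; left; apply/eqP; rewrite [in RHS]exprS; field.
by rewrite p2 expf_neq0.
Qed.

Lemma geo_cvg (u : nat -> R) (C : R) :
  (forall n, `|u n.+1 - u n| <= C / 2 ^+ n) ->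
  forall n, `|limn u - u n| <= 2 * C / 2 ^+ n.
Proof.
move=> H.
have C0 : 0 <= C.
  by have := H 0%N; rewrite expr0 divr1; exact: le_trans.
have cu : cvgn u.
  apply/cauchy_cvgP/cauchy_exP => e e0.
  have [n hn] := half_small (e / (2 * C + 1)) (divr_gt0 e0 (ltr_wpDl (mulr_ge0 (ler0n _ 2) C0) ltr01)).
  exists (u n); exists n => // m /= nm; rewrite /ball /= distrC.
  apply: le_lt_trans (geo_cauchy _ _ H _ _ nm) _.
  have p2 : 0 < (2 ^+ n)^-1 :> R by rewrite invr_gt0 exprn_gt0.
  move: hn; rewrite ltr_pdivlMr; last by lra.
  by apply: le_lt_trans; rewrite mulrC; apply: ler_wpM2l; [exact: ltW | lra].
move=> n; apply/ler_addgt0Pr => e e0.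
have [m _ Hm] : \forall m \near \oo, `|limn u - u m| <= e.
  by move: cu => /cvgrPdist_le; apply.
have /= := Hm (maxn m n) (leq_maxl _ _) => L.
rewrite -(subrKA (u (maxn m n))); apply: le_trans (ler_normD _ _) _.
by rewrite addrC lerD// geo_cauchy// leq_maxr.
Qed.

Definition flim F : R -> R -> R := fun x y => limn (fun n => F n x y).

Section flim.
Variables (F : nat -> R -> R -> R).
Hypothesis sF : forall n, sm (F n).
Hypothesis HF : forall k, exists C, forall n, bd k (C / 2 ^+ n) (fun x y => F n.+1 x y - F n x y).

Lemma flim_dist : exists C, forall n x y, `|flim F x y - F n x y| <= C / 2 ^+ n.
Proof.
have [C HC] := HF 0%N; exists (2 * C) => n x y.
by apply: geo_cvg => m; have [H _] := HC m.
Qed.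

Lemma flim_bound k : exists B, forall n, bd k B (F n).
Proof.
have [C HC] := HF k; have [B B0 b0] := sm_bd _ k (sF 0%N).
have C0 : 0 <= C by have := bd_ge0 _ _ _ (HC 0%N); rewrite expr0 divr1.
exists (B + 2 * C) => n.
suff : bd k (B + 2 * C - 2 * C / 2 ^+ n) (F n).
  by apply: bd_mono => //; rewrite lerBlDr lerDl divr_ge0 ?exprn_ge0// mulr_ge0.
elim: n => [|n IH]; first by rewrite expr0 divr1 addrK.
have := bd_add _ _ _ _ _ IH (HC n).
rewrite (_ : (fun x y => _) = F n.+1); last by apply/funext=> x; apply/funext => y; rewrite addrC subrK.
apply: bd_mono => //; rewrite le_eqVlt; apply/orP; left; apply/eqP; rewrite [in RHS]exprS; field.
by rewrite expf_neq0.
Qed.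

(** The uniform C^2 bound gives every [F n] the same remainder constant [B]. Pointwise convergence
    of [F n] and of [d i (F n)] then carries the inequality to the limit. *)
Lemma flim_pd i : pd i (flim F) (flim (fun n => d i (F n))).
Proof.
have [C HC] := flim_dist.
have [B HB] := flim_bound 2.
have [C' HC'] : exists C', forall n x y, `|flim (fun n => d i (F n)) x y - d i (F n) x y| <= C' / 2 ^+ n.
  have [C1 HC1] := HF 1; exists (2 * C1) => n x y.
  apply: geo_cvg => m; have := bd_d _ _ _ i (HC1 m); rewrite d_sub//; by case=> + _; apply.
exists B => s x y; apply/ler_addgt0Pr => e e0.
have C0 : 0 <= C.
  by have := HC 0%N 0 0; rewrite expr0 divr1; exact: le_trans.
have C'0 : 0 <= C'.
  by have := HC' 0%N 0 0; rewrite expr0 divr1; exact: le_trans.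
pose K := 2 * C + `|s| * C' + 1.
have K0 : 0 < K by rewrite /K ltr_wpDl// addr_ge0// mulr_ge0.
have [n hn] := half_small (e / K) (divr_gt0 e0 K0).
set G := flim F; set H := flim _.
have -> : sh i s G x y - G x y - s * H x y =
  (sh i s (F n) x y - F n x y - s * d i (F n) x y) +
  ((sh i s G x y - sh i s (F n) x y) - (G x y - F n x y) - s * (H x y - d i (F n) x y)) by ring.
apply: le_trans (ler_normD _ _) (lerD _ _).
  have := bd_taylor _ _ _ x y ((~~ i)%:R * s) (i%:R * s) (HB n).
  rewrite /sh; case: (i) => /=; rewrite !mul0r !mul1r addr0 normr0 ?add0r ?addr0 ?subr0.
    by rewrite real_normK ?num_real.
  by rewrite real_normK ?num_real.
have p2 : 0 < (2 ^+ n)^-1 :> R by rewrite invr_gt0 exprn_gt0.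
apply: (@le_trans _ _ (C / 2 ^+ n + C / 2 ^+ n + `|s| * (C' / 2 ^+ n))).
  apply: le_trans (ler_normB _ _) (lerD _ _); last by rewrite normrM ler_wpM2l.
  apply: le_trans (ler_normB _ _) (lerD _ _) => //.
  by rewrite /sh; case: (i).
move: hn; rewrite ltr_pdivlMr// => /ltW; apply: le_trans.
rewrite /K -subr_ge0 (_ : _ - _ = (2 ^+ n)^-1); [exact: ltW | ring].
Qed.

End flim.

(** Two hypotheses on the increments play different parts: geometric decay at all orders, with
    unspecified constants, identifies the derivatives of the limit, while the constant [C] at order
    [k] gives the rate. *)
Lemma bd_flim k C F : (forall n, sm (F n)) ->
  (forall l, exists D, forall n, bd l (D / 2 ^+ n) (fun x y => F n.+1 x y - F n x y)) ->
  (forall n, bd k (C / 2 ^+ n) (fun x y => F n.+1 x y - F n x y)) ->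
  forall n, bd k (2 * C / 2 ^+ n) (fun x y => flim F x y - F n x y).
Proof.
have B0 l G : (forall n, bd l (C / 2 ^+ n) (fun x y => G n.+1 x y - G n x y)) ->
    forall n x y, `|flim G x y - G n x y| <= 2 * C / 2 ^+ n.
  by move=> H n x y; apply: geo_cvg => m; exact: bd_le0 (H m) _ _.
elim: k F => [|k IH] F sF HF HC n; first by split => //; exact: B0 HC n.
apply: bdS => [|i]; first exact: B0 HC n.
exists (fun x y => flim (fun n => d i (F n)) x y - d i (F n) x y).
  by apply: pd_sub; [exact: flim_pd | exact: sm_pd].
apply: IH.
- by move=> m; exact: sm_d.
- move=> l; have [D HD] := HF l.+1; exists D => m.
  by have := bd_d _ _ _ i (HD m); rewrite d_sub.
- by move=> m; have := bd_d _ _ _ i (HC m); rewrite d_sub.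
Qed.

Lemma sm_flim F : (forall n, sm (F n)) ->
  (forall k, exists C, forall n, bd k (C / 2 ^+ n) (fun x y => F n.+1 x y - F n x y)) ->
  sm (flim F).
Proof.
move=> sF HF k; have [C HC] := HF k; have [B bB] := sF 0%N k.
have := bd_add _ _ _ _ _ (bd_flim k C F sF HF HC 0%N) bB.
rewrite (_ : (fun x y => _) = flim F); first by move=> ?; eexists; eassumption.
by apply/funext=> x; apply/funext => y; rewrite subrK.
Qed.

Definition supped (r : R) (f : R -> R -> R) :=
  forall x y, f x y != 0 -> `|x| <= r /\ `|y| <= r.

Lemma supped0 r f x y : supped r f -> (r < `|x|) || (r < `|y|) -> f x y = 0.
Proof.
move=> sf; apply: contraTeq => /sf[hx hy]; by rewrite negb_or -!leNgt hx hy.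
Qed.

Lemma supped_mono r r' f : r <= r' -> supped r f -> supped r' f.
Proof. by move=> rr sf x y /sf[hx hy]; split; exact: le_trans rr. Qed.

Lemma supped_lin r f g (c e : R) : supped r f -> supped r g ->
  supped r (fun x y => c * f x y + e * g x y).
Proof.
move=> sf sg x y; have [fx|fx] := eqVneq (f x y) 0; last by move=> _; exact: sf.
have [gx|gx] := eqVneq (g x y) 0; last by move=> _; exact: sg.
by rewrite fx gx !mulr0 addr0 eqxx.
Qed.

Lemma supped_sub r f g : supped r f -> supped r g -> supped r (fun x y => f x y - g x y).
Proof.
move=> sf sg x y; have [fx|fx] := eqVneq (f x y) 0; last by move=> _; exact: sf.
have [gx|gx] := eqVneq (g x y) 0; last by move=> _; exact: sg.
by rewrite fx gx subr0 eqxx.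
Qed.

Lemma supped_mulr r f g : supped r g -> supped r (fun x y => f x y * g x y).
Proof. by move=> sg x y; rewrite mulf_eq0 negb_or => /andP[_]; exact: sg. Qed.

Lemma supped_d r f i : sm f -> supped r f -> supped r (d i f).
Proof.
move=> sf sp x y dn0.
suff H : ~~ ((r < `|x|) || (r < `|y|)).
  by move: H; rewrite negb_or -!leNgt => /andP[].
apply: contraNN dn0 => out.
have [C HC] := sm_pd _ i sf.
have f0 : f x y = 0 by exact: supped0 out.
(* the slice vanishes near the point, so [s * d f = O(s^2)] *)
have [e e0 He] : exists2 e, 0 < e & forall s, 0 <= s < e -> sh i s f x y = 0.
  have aux z : r < `|z| -> exists2 e, 0 < e & forall s, 0 <= s < e -> r < `|z + s|.
    move=> rz; exists (`|z| - r); first by lra.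
    move=> s /andP[s0 s1]; have := lerB_normD z s; rewrite (ger0_norm s0); lra.
  case/orP: out => [/aux|/aux] [e e0 He]; case: (i).
  - exists 1 => // s _; rewrite /sh (supped0 _ _ _ _ sp)//; apply/orP; left.
    by have := He 0; rewrite addr0 lexx e0; apply.
  - by exists e => // s /He ?; rewrite /sh (supped0 _ _ _ _ sp)//; apply/orP; left.
  - by exists e => // s /He ?; rewrite /sh (supped0 _ _ _ _ sp)//; apply/orP; right.
  - exists 1 => // s _; rewrite /sh (supped0 _ _ _ _ sp)//; apply/orP; right.
    by have := He 0; rewrite addr0 lexx e0; apply.
have C0 := quad_ge0 _ _ HC.
rewrite -normr_le0; apply/ler_addgt0Pr => t t0; rewrite add0r.
pose s := Num.min (e / 2) (t / (C + 1)).
have s0 : 0 < s by rewrite lt_min !divr_gt0// ltr_wpDl.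
have se : s < e by rewrite gt_min ltr_pdivrMr// ltr_pMr// ltr1n.
have := HC s x y; rewrite He ?(ltW s0) ?se// f0 subrr sub0r normrN normrM ger0_norm ?(ltW s0)//.
rewrite expr2 mulrCA ler_pM2l// => /le_trans; apply.
apply: (@le_trans _ _ ((C + 1) * s)); first by rewrite ler_wpM2r ?(ltW s0)// lerDl.
by rewrite mulrC -ler_pdivlMr ?ltr_wpDl// ge_min lexx orbT.
Qed.

End completeness.

(** * The Biot-Savart operator *)

Section plane_measure.
Context {R : realType}.

Local Notation RR := (measurableTypeR R * measurableTypeR R)%type.
Local Notation leb := (@lebesgue_measure R).
Local Notation mu2 := ((leb \x leb)%E).
Implicit Types (f g h : RR -> R) (r : R).

Lemma measurable_shift1 (s : R) (A : set R) : measurable A ->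
  measurable ((fun t : measurableTypeR R => t + s) @^-1` A).
Proof.
move=> mA; rewrite -[X in measurable X]setTI.
have mf : measurable_fun [set: measurableTypeR R] ((fun t => t + s) : _ -> measurableTypeR R).
  exact: measurable_funD.
exact: mf.
Qed.

(** By uniqueness of Lebesgue measure it is enough that the pushforward gives half-open intervals
    their length. The planar version repeats this with uniqueness of the product measure on
    rectangles. *)
Lemma lebesgue_shift (s : R) (A : set R) : measurable A ->
  pushforward leb ((fun t => t + s) : measurableTypeR R -> measurableTypeR R) A = leb A.
Proof.
have ms : measurable_fun [set: measurableTypeR R] ((fun t => t + s) : _ -> measurableTypeR R).
  exact: measurable_funD.
pose phi : {mfun measurableTypeR R >-> measurableTypeR R} :=
  HB.pack (fun t : measurableTypeR R => (t + s : measurableTypeR R)) (isMeasurableFun.Build _ _ _ _ _ ms).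
move=> mA; apply/esym.
apply: (@lebesgue_measure_unique R (pushforward leb phi)) => //= _ [[a b]] _ <-.
rewrite /pushforward (_ : phi @^-1` _ = `]a - s, b - s]%classic).
  by rewrite !lebesgue_measure_itv/= !lte_fin ltrBlDr subrK -!EFinD; congr (if _ then _%:E else _); ring.
by apply/seteqP; split => t /=; rewrite !in_itv/= ltrBlDr lerBrDr.
Qed.

Definition shift2 (s t : R) : RR -> RR := fun z => (z.1 + s, z.2 + t).

Lemma measurable_shift2 s t : measurable_fun setT (shift2 s t).
Proof.
by apply/measurable_fun_pairP; split; exact: measurable_funD.
Qed.

Lemma mu2_shift s t (A : set RR) : measurable A ->
  pushforward mu2 (shift2 s t) A = mu2 A.
Proof.
pose phi : {mfun RR >-> RR} :=
  HB.pack (shift2 s t) (isMeasurableFun.Build _ _ _ _ _ (measurable_shift2 s t)).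
move=> mA; apply/esym; apply: (@product_measure_unique _ _ _ _ _ leb leb (pushforward mu2 phi)) => //.
move=> B C mB mC.
change (mu2 (((fun u => u + s) @^-1` B) `*` ((fun u => u + t) @^-1` C)) = (leb B * leb C)%E).
rewrite -(lebesgue_shift s B mB) -(lebesgue_shift t C mC).
rewrite product_measure1E//.
- exact: (measurable_shift1 s B mB).
- exact: (measurable_shift1 t C mC).
Qed.

Lemma Rintegral_shift2 s t f : measurable_fun setT f ->
  mu2.-integrable setT (EFin \o (f \o shift2 s t)) ->
  Rintegral mu2 setT (f \o shift2 s t) = Rintegral mu2 setT f.
Proof.
move=> mf inf; rewrite /Rintegral; congr fine.
have mfe : measurable_fun setT (EFin \o f) by exact/measurable_EFinP.
have := @integral_pushforward _ _ _ _ R _ (measurable_shift2 s t) mu2 setT _ mfe.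
rewrite preimage_setT => /(_ inf measurableT) /= <-.
apply: eq_measure_integral; first exact: measurable_shift2.
by move=> m A mA _; exact: mu2_shift.
Qed.

(** Integrability and a bound on the L^1 norm in one predicate: estimates of integrals are then
    assembled by comparing integrands with explicit majorants. *)
Definition dominated h (c : R) :=
  measurable_fun setT h /\ (\int[mu2]_z (`|h z|)%:E <= c%:E)%E.

Lemma dominated_integrable h c : dominated h c -> mu2.-integrable setT (EFin \o h).
Proof.
move=> [mh hc]; apply/integrableP; split; first exact/measurable_EFinP.
by rewrite /= (le_lt_trans hc)// ltey.
Qed.

Lemma dominated_norm h c : dominated h c -> `|Rintegral mu2 setT h| <= c.
Proof.
move=> dh; have := @le_normr_Rintegral _ _ _ mu2 _ _ measurableT (dominated_integrable _ _ dh).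
move=> /le_trans; apply.
rewrite /Rintegral -lee_fin fineK; first by have [] := dh.
have [mh hc] := dh; rewrite ge0_fin_numE; last by apply: integral_ge0 => z _; rewrite lee_fin.
by rewrite (le_lt_trans hc)// ltey.
Qed.

Lemma dominated_le h g c c' : measurable_fun setT h -> (forall z, `|h z| <= `|g z|) -> c <= c' ->
  dominated g c -> dominated h c'.
Proof.
move=> mh hg cc [mg gc]; split => //.
apply: (@le_trans _ _ c%:E); last by rewrite lee_fin.
apply: le_trans gc; apply: ge0_le_integral => //=.
- by apply/measurable_EFinP; apply: measurableT_comp.
- by apply/measurable_EFinP; apply: measurableT_comp.
- by move=> z _; rewrite lee_fin.
Qed.

Lemma dominated_add h g c c' : dominated h c -> dominated g c' ->
  dominated (fun z => h z + g z) (c + c').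
Proof.
move=> [mh hc] [mg gc]; split; first exact: measurable_funD.
apply: (@le_trans _ _ (\int[mu2]_z ((`|h z|)%:E + (`|g z|)%:E))%E).
  apply: ge0_le_integral => //=.
  - by apply/measurable_EFinP; apply: measurableT_comp => //; exact: measurable_funD.
  - by apply: emeasurable_funD; apply/measurable_EFinP; apply: measurableT_comp.
  - by move=> z _; rewrite -EFinD lee_fin ler_normD.
rewrite ge0_integralD//=; try (by apply/measurable_EFinP; apply: measurableT_comp);
  try (by move=> z _; rewrite lee_fin).
by rewrite EFinD leeD.
Qed.

Lemma dominated_scale h c (k : R) : dominated h c -> dominated (fun z => k * h z) (`|k| * c).
Proof.
move=> [mh hc]; split; first exact: measurable_funM.
under eq_integral do rewrite normrM EFinM.
have mnh : measurable_fun setT (fun z : RR => (`|h z|)%:E).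
  by apply/measurable_EFinP; apply: measurableT_comp.
rewrite (ge0_integralZl_EFin mu2 measurableT _ mnh)//.
rewrite EFinM lee_pmul ?lee_fin//.
by apply: integral_ge0 => z _; rewrite lee_fin.
Qed.

Definition boxset (x y r : R) : set RR :=
  [set` `[x - r, x + r]] `*` [set` `[y - r, y + r]].

Lemma boxsetP x y r (z : RR) : boxset x y r z <-> `|x - z.1| <= r /\ `|y - z.2| <= r.
Proof.
rewrite /boxset /= !in_itv/= !ler_distl.
by split=> -[/andP[a b] /andP[c e]]; split; apply/andP; split; lra.
Qed.

Lemma measurable_boxset x y r : measurable (boxset x y r).
Proof. by apply: measurableX. Qed.

Lemma mu2_boxset x y r : 0 <= r -> mu2 (boxset x y r) = (4 * r ^+ 2)%:E.
Proof.
move=> r0.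
pose I (c : R) : set R := [set` `[c - r, c + r]].
have E (c : R) : leb (I c) = (2 * r)%:E.
  rewrite lebesgue_measure_itv/= lte_fin.
  have [->|rn0] := eqVneq r 0; first by rewrite !addr0 !subr0 !ltxx mulr0.
  have rp : 0 < r by rewrite lt_neqAle eq_sym rn0.
  by rewrite (_ : c - r < c + r); [rewrite -EFinD; congr _%:E; ring | lra].
transitivity (leb (I x) * leb (I y))%E; first exact: product_measure1E.
by rewrite !E -EFinM; congr _%:E; ring.
Qed.

Definition boxind (x y r : R) : RR -> R := fun z => \1_(boxset x y r) z.

Lemma boxindE x y r (z : RR) :
  boxind x y r z = ((`|x - z.1| <= r) && (`|y - z.2| <= r))%:R.
Proof.
rewrite /boxind indicE; congr (_%:R); congr nat_of_bool.
by apply/idP/idP => [/set_mem/boxsetP/andP|/andP/boxsetP/mem_set].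
Qed.

Lemma measurable_boxind x y r : measurable_fun setT (boxind x y r).
Proof. by apply: measurable_indic; exact: measurable_boxset. Qed.

Lemma integral_boxind x y r : 0 <= r ->
  (\int[mu2]_z (boxind x y r z)%:E = (4 * r ^+ 2)%:E)%E.
Proof.
move=> r0; rewrite /boxind integral_indic//; last exact: measurable_boxset.
by rewrite setIT; exact: mu2_boxset.
Qed.

Lemma dominated_box x y r : 0 <= r -> dominated (boxind x y r) (4 * r ^+ 2).
Proof.
move=> r0; split; first exact: measurable_boxind.
rewrite -(integral_boxind x y r r0) le_eqVlt; apply/orP; left; apply/eqP.
by apply: eq_integral => z _; rewrite ger0_norm// boxindE.
Qed.

(* A function bounded by [2 ^ (n + 1) / r] off the box of radius [r / 2 ^ (n + 1)]
   for all [n], and supported in the box of radius [r], has integral [O(r)]. *)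
Lemma dominated_dyadic h x y r : 0 < r -> measurable_fun setT h ->
  (forall z, h z != 0 -> boxset x y r z) -> h (x, y) = 0 ->
  (forall z s, 0 < s -> ~ boxset x y s z -> `|h z| <= s^-1) ->
  dominated h (16 * r).
Proof.
move=> r0 mh hs h0 hb; split=> //.
(* [M n] majorises [h] on the shell between radii [r / 2 ^+ n.+1] and [r / 2 ^+ n]. Its mass is
   [8 * r / 2 ^+ n], and these sum to [16 * r]. *)
pose M n (z : RR) : \bar R := (2 ^+ n.+1 / r * boxind x y (r / 2 ^+ n) z)%:E.
have M0 n z : (0 <= M n z)%E.
  by rewrite lee_fin mulr_ge0// ?divr_ge0 ?exprn_ge0 ?ltW// boxindE.
have mM n : measurable_fun setT (M n).
  by apply/measurable_EFinP; apply: measurable_funM => //; exact: measurable_boxind.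
apply: (@le_trans _ _ (\int[mu2]_z (\sum_(n <oo) M n z))%E).
  apply: ge0_le_integral => //=.
  - by apply/measurable_EFinP; apply: measurableT_comp.
  - by apply: ge0_emeasurable_sum => //.
  move=> z _; have [->|hz] := eqVneq (h z) 0.
    by rewrite normr0; apply: nneseries_ge0 => n _ _; exact: M0.
  have zr := hs _ hz.
  have [N [HN HN1]] : exists N, boxset x y (r / 2 ^+ N) z /\ ~ boxset x y (r / 2 ^+ N.+1) z.
    have [N HN] : exists N, ~ boxset x y (r / 2 ^+ N) z.
      pose m := Num.max `|x - z.1| `|y - z.2|.
      (* The value 0 of [h] at the centre keeps [z] away from it, so that [z] lies in some shell. *)
      have m0 : 0 < m.
        rewrite lt_max !normr_gt0 !subr_eq0 -negb_and; apply: contraNN hz => /andP[/eqP xz /eqP yz].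
        by rewrite [z]surjective_pairing -xz -yz h0.
      have [N HN] := half_small (m / r) (divr_gt0 m0 r0).
      exists N; rewrite boxsetP => -[a b].
      have : m <= r / 2 ^+ N by rewrite ge_max a b.
      by move: HN; rewrite ltr_pdivlMr// mulrC => /lt_le_trans /[apply]; rewrite ltxx.
    elim: N HN => [|N IH] HN; first by rewrite expr0 divr1 in HN.
    by have [zN|/IH//] := pselect (boxset x y (r / 2 ^+ N) z); exists N.
  apply: (@le_trans _ _ (M N z)).
    rewrite /M /boxind indicE mem_set// mulr1 lee_fin.
    have rp : 0 < r / 2 ^+ N.+1 by rewrite divr_gt0 ?exprn_gt0.
    have := hb _ _ rp HN1.
    by rewrite invfM invrK mulrC.
  rewrite (@nneseriesD1 _ (fun n => M n z) N xpredT (fun k _ => M0 k z) isT).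
  by rewrite leeDl//; apply: nneseries_ge0 => n _ _; exact: M0.
rewrite (integral_nneseries mu2 measurableT mM (fun n z _ => M0 n z)).
apply: lime_le.
  by apply: is_cvg_nneseries => n _ _; apply: integral_ge0 => z _; exact: M0.
apply: nearW => n; rewrite /= big_mkord.
apply: (@le_trans _ _ (\sum_(i < n) (8 * r / 2 ^+ i)%:E)%E).
  apply: lee_sum => i _; rewrite /M.
  under eq_integral do rewrite EFinM.
  have mb : measurable_fun setT (fun z : RR => (boxind x y (r / 2 ^+ i) z)%:E).
    by apply/measurable_EFinP; exact: measurable_boxind.
  have k0 : 0 <= 2 ^+ i.+1 / r by rewrite divr_ge0 ?exprn_ge0 ?ltW.
  have b0 z : setT z -> (0 <= (boxind x y (r / 2 ^+ i) z)%:E)%E.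
    by move=> _; rewrite lee_fin boxindE.
  rewrite (ge0_integralZl_EFin mu2 measurableT b0 mb k0).
  have ri0 : 0 <= r / 2 ^+ i by rewrite divr_ge0 ?exprn_ge0 ?ltW.
  rewrite integral_boxind// -EFinM lee_fin.
  rewrite le_eqVlt; apply/orP; left; apply/eqP; rewrite exprS; field.
  by rewrite expf_neq0//= gt_eqF.
rewrite sumEFin lee_fin.
suff -> : \sum_(i < n) 8 * r / 2 ^+ i = 16 * r - 16 * r / 2 ^+ n.
  by rewrite lerBlDr lerDl divr_ge0 ?exprn_ge0// mulr_ge0// ltW.
elim: n => [|n IH]; first by rewrite big_ord0 expr0 divr1 subrr.
rewrite big_ord_recr/= IH exprS; field.
by rewrite expf_neq0.
Qed.

Lemma measurable_bd1 k M (f : R -> R -> R) : bd k.+1 M f ->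
  measurable_fun setT (fun z : RR => f z.1 z.2).
Proof.
move=> bf.
have M0 := bd_ge0 _ _ _ bf.
have cf q : continuous (f q).
  move=> y; apply/cvgrPdist_le => e e0.
  have eM : 0 < e / (M + 1) by rewrite divr_gt0// ltr_wpDl.
  near=> t.
  have := bd_lip _ _ _ q y 0 (t - y) bf; rewrite addr0 subrKC normr0 add0r distrC => /le_trans; apply.
  have : `|t - y| <= e / (M + 1).
    by rewrite distrC; near: t; apply: cvgr_dist_le; [exact: cvg_id | exact: eM].
  rewrite ler_pdivlMr ?ltr_wpDl// => /(le_trans _); apply.
  by rewrite mulrC ler_wpM2l// lerDl.
move=> mT; apply: (measurability _ (RGenOInfty.measurableE R)) => //.
move=> _ [_ [c ->] <-]; rewrite setTI.
(* by the Lipschitz bound the superlevel set is a countable union over rational abscissas *)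
rewrite (_ : _ @^-1` _ = \bigcup_n
  [set z : RR | c < f (ratr (odflt 0 (unpickle n))) z.2 - M * `|ratr (odflt 0 (unpickle n)) - z.1|]).
  apply: bigcup_measurable => n _; set q : R := ratr _.
  rewrite -[X in measurable X]setTI.
  have mF : measurable_fun setT (fun z : RR => f q z.2 - M * `|q - z.1|).
    apply: measurable_funB.
      by apply: measurableT_comp (measurable_snd) => //; exact: continuous_measurable_fun.
    apply: measurable_funM => //; apply: measurableT_comp => //.
    by apply: measurable_funB => //; exact: measurable_fst.
  have := mF measurableT `]c, +oo[%classic (measurable_itv _).
  by congr measurable; apply/seteqP; split => z /=; rewrite in_itv/= andbT.
apply/seteqP; split => z /=; rewrite in_itv/= andbT.
  move=> cz; pose e := (f z.1 z.2 - c) / (2 * M + 1).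
  have D : 0 < 2 * M + 1 by rewrite ltr_wpDl// mulr_ge0.
  have e0 : 0 < e by rewrite divr_gt0// subr_gt0.
  have ze : z.1 - e < z.1 + e by rewrite ltrBlDr -addrA ltrDl addr_gt0.
  have [q] := rat_in_itvoo ze.
  rewrite in_itv/= => /andP[q1 q2].
  have qE : odflt 0 (unpickle (pickle q)) = q by rewrite pickleK.
  exists (pickle q); first by [].
  rewrite /mkset qE.
  have qe : `|ratr q - z.1| < e by rewrite ltr_distl q1 q2.
  have := bd_lip _ _ _ z.1 z.2 (ratr q - z.1) 0 bf; rewrite addr0 subrKC normr0 addr0.
  rewrite ler_distl => /andP[L _].
  have : (2 * M + 1) * e = f z.1 z.2 - c by rewrite /e mulrC divfK// gt_eqF.
  have : M * `|ratr q - z.1| <= M * e by rewrite ler_wpM2l// ltW.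
  by move: L e0 => *; lra.
move=> [n _ /=]; set q : R := ratr _ => cq.
have := bd_lip _ _ _ z.1 z.2 (q - z.1) 0 bf; rewrite addr0 subrKC normr0 addr0.
rewrite ler_distl => /andP[_ L]; apply: lt_le_trans cq _.
by rewrite lerBlDr.
Unshelve. all: by end_near. Qed.

End plane_measure.

(** * The kernel and its convolution with smooth functions of bounded support *)

Section biot_savart_operator.
Context {R : realType}.

Local Notation RR := (measurableTypeR R * measurableTypeR R)%type.
Local Notation mu2 := ((@lebesgue_measure R \x @lebesgue_measure R)%E).
Implicit Types (f g : R -> R -> R) (i j : bool) (x y r s M : R) (k : nat).

Definition kern i x y : R :=
  (2 * pi)^-1 * ((if i then x else - y) / (x ^+ 2 + y ^+ 2)).

Lemma far_sq r x y : 0 < r -> r <= `|x| \/ r <= `|y| -> r ^+ 2 <= x ^+ 2 + y ^+ 2.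
Proof.
move=> r0 [h|h].
  apply: le_trans (_ : x ^+ 2 <= _); last by rewrite lerDl sqr_ge0.
  by rewrite -[x ^+ 2]real_normK ?num_real// ler_pXn2r ?nnegrE// ltW.
apply: le_trans (_ : y ^+ 2 <= _); last by rewrite lerDr sqr_ge0.
by rewrite -[y ^+ 2]real_normK ?num_real// ler_pXn2r ?nnegrE// ltW.
Qed.

Lemma twopi_inv : 0 <= (2 * pi : R)^-1 <= 1.
Proof.
have p2 := pi_ge2 R.
by rewrite invr_ge0 invf_le1 ?mulr_gt0 ?pi_gt0//; apply/andP; split; [rewrite mulr_ge0 ?pi_ge0 | lra].
Qed.

(** A coordinate divided by the squared Euclidean norm is at most the inverse of the larger
    coordinate; the factor [(2 * pi)^-1] is simply bounded by 1. The disjunction says that the max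
    norm is at least [r], matching the boxes used for domination. *)
Lemma kern_bound i x y r : 0 < r -> r <= `|x| \/ r <= `|y| -> `|kern i x y| <= r^-1.
Proof.
move=> r0 h; have /andP[p0 p1] := twopi_inv.
have P := far_sq _ _ _ r0 h; have r2 : 0 < r ^+ 2 by rewrite exprn_gt0.
set P2 := x ^+ 2 + y ^+ 2 in P *; have P0 : 0 < P2 := lt_le_trans r2 P.
rewrite /kern normrM (ger0_norm p0).
suff : `|(if i then x else - y) / P2| <= r^-1.
  by move=> H; apply: le_trans H; rewrite ler_piMl.
rewrite normrM normfV (ger0_norm (ltW P0)) ler_pdivrMr// mulrC ler_pdivlMr//.
have -> : P2 = `|x| ^+ 2 + `|y| ^+ 2 by rewrite !real_normK ?num_real.
have -> : `|if i then x else - y| = if i then `|x| else `|y| by case: (i); rewrite ?normrN.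
have := normr_ge0 x; have := normr_ge0 y; move: h.
set a := `|x|; set b := `|y| => h b0 a0.
case: h => h; case: (i).
- by apply: (@le_trans _ _ (a * a)); [rewrite ler_wpM2l | nra].
- by apply: (@le_trans _ _ (b * a)); [rewrite ler_wpM2l | nra].
- by apply: (@le_trans _ _ (a * b)); [rewrite ler_wpM2l | nra].
- by apply: (@le_trans _ _ (b * b)); [rewrite ler_wpM2l | nra].
Qed.

(* The inversion [p |-> p / |p|^2] satisfies [|p/|p|^2 - q/|q|^2| = |p - q| / (|p| |q|)]. *)
Lemma kern_diff i x y x' y' r e : 0 < r -> 0 <= e ->
  r <= `|x| \/ r <= `|y| -> r <= `|x'| \/ r <= `|y'| ->
  `|x - x'| <= e -> `|y - y'| <= e ->
  `|kern i x y - kern i x' y'| <= 2 * e / r ^+ 2.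
Proof.
move=> r0 e0 h h' hx hy; have /andP[p0 p1] := twopi_inv.
have P := far_sq _ _ _ r0 h; have P' := far_sq _ _ _ r0 h'.
have r2 : 0 < r ^+ 2 by rewrite exprn_gt0.
rewrite /kern -mulrBr normrM (ger0_norm p0).
set A := x ^+ 2 + y ^+ 2 in P *; set B := x' ^+ 2 + y' ^+ 2 in P' *.
have A0 : 0 < A := lt_le_trans r2 P; have B0 : 0 < B := lt_le_trans r2 P'.
suff : `|(if i then x else - y) / A - (if i then x' else - y') / B| <= 2 * e / r ^+ 2.
  by move=> H; apply: le_trans H; rewrite ler_piMl.
have E : (x / A - x' / B) ^+ 2 + (y / A - y' / B) ^+ 2 =
    ((x - x') ^+ 2 + (y - y') ^+ 2) / (A * B).
  have An : A != 0 by rewrite gt_eqF.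
  have Bn : B != 0 by rewrite gt_eqF.
  rewrite [LHS](_ : _ = (A * B ^+ 2 + B * A ^+ 2 - 2 * (x * x' + y * y') * (A * B)) / (A * B) ^+ 2).
    by rewrite /A /B; field; apply/andP.
  by rewrite /A /B; field; apply/andP.
have Q : ((x - x') ^+ 2 + (y - y') ^+ 2) / (A * B) <= (2 * e / r ^+ 2) ^+ 2.
  rewrite expr_div_n ler_pM ?addr_ge0 ?sqr_ge0 ?invr_ge0 ?mulr_ge0 ?(ltW A0) ?(ltW B0)//.
    have sq z : `|z| <= e -> z ^+ 2 <= e ^+ 2.
      by move=> ze; rewrite -[z ^+ 2]real_normK ?num_real// ler_pXn2r ?nnegrE.
    by have := sq _ hx; have := sq _ hy; have := sqr_ge0 e; rewrite exprMn; lra.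
  by rewrite lef_pV2 ?posrE ?mulr_gt0 ?exprn_gt0// expr2 ler_pM// ltW.
have G : 0 <= 2 * e / r ^+ 2 by rewrite divr_ge0 ?mulr_ge0// ltW.
rewrite -(ler_pXn2r (n := 2)) ?nnegrE// real_normK ?num_real//.
apply: le_trans Q; rewrite -E; case: (i); first by rewrite lerDl sqr_ge0.
by rewrite !mulNr -opprD sqrrN lerDr sqr_ge0.
Qed.

Lemma measurable_kern i x y : measurable_fun setT (fun z : RR => kern i (x - z.1) (y - z.2)).
Proof.
have m1 : measurable_fun setT (fun z : RR => x - z.1).
  by apply: measurable_funB => //; exact: measurable_fst.
have m2 : measurable_fun setT (fun z : RR => y - z.2).
  by apply: measurable_funB => //; exact: measurable_snd.
rewrite /kern; apply: measurable_funM => //; apply: measurable_funM.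
  by case: i => //; apply: measurableT_comp.
(* The reciprocal of the nonnegative squared norm is written as a real power, whose measurability
   also covers the singular point. *)
rewrite (_ : (fun z : RR => _) = (fun t : R => t `^ (-1)) \o
  (fun z : RR => (x - z.1) ^+ 2 + (y - z.2) ^+ 2)).
  apply: measurableT_comp; first exact: measurable_powR.
  by apply: measurable_funD; exact: measurable_funX.
apply/funext => z /=; rewrite powRN powRr1//.
by rewrite addr_ge0 ?sqr_ge0.
Qed.

Lemma kern00 i : kern i 0 0 = 0.
Proof. by rewrite /kern; case: i; rewrite ?oppr0 mul0r mulr0. Qed.

Lemma dominated_near_kern i x y r : 0 < r ->
  dominated (fun z : RR => kern i (x - z.1) (y - z.2) * boxind x y r z) (16 * r).
Proof.
move=> r0; apply: (dominated_dyadic _ x y) => //.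
- by apply: measurable_funM; [exact: measurable_kern | exact: measurable_boxind].
- move=> z; rewrite boxindE mulf_eq0 negb_or => /andP[_].
  by case: andP => [? _|_ /eqP//]; exact/boxsetP.
- by rewrite /= !subrr kern00 mul0r.
- move=> z s s0 /boxsetP /not_andP H; rewrite normrM.
  apply: (@le_trans _ _ (`|kern i (x - z.1) (y - z.2)|)).
    by rewrite ler_piMr// boxindE; case: andP => _; rewrite ?normr1 ?normr0.
  by apply: kern_bound => //; case: H => /negP; rewrite -ltNge => /ltW; [left|right].
Qed.

Lemma U_subproof : {V : bool -> (R -> R -> R) -> R -> R -> R |
  forall i g x y, V i g x y =
    Rintegral (@lebesgue2 R) setT (fun z => kern i (x - z.1) (y - z.2) * g z.1 z.2)}.
Proof. by eexists; reflexivity. Qed.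

(* Opaque, like [d]: conversion must not unfold the integral. *)
Definition U := sval U_subproof.

Lemma UE i g x y : U i g x y =
  Rintegral mu2 setT (fun z : RR => kern i (x - z.1) (y - z.2) * g z.1 z.2).
Proof. exact: (svalP U_subproof). Qed.

Lemma measurable_integrand i g x y : sm g ->
  measurable_fun setT (fun z : RR => kern i (x - z.1) (y - z.2) * g z.1 z.2).
Proof.
move=> sg; have [M bM] := sg 1%N; apply: measurable_funM; first exact: measurable_kern.
exact: measurable_bd1 bM.
Qed.

(** In the box of radius [r] around the evaluation point the kernel has mass at most [16 * r];
    outside it is at most [1 / r], on a support of area at most [4 * r ^+ 2]. Hence [20 * r],
    uniformly in the evaluation point. *)
Lemma dominated_integrand i g x y r M : sm g -> supped r g -> 0 < r ->
  (forall x y, `|g x y| <= M) ->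
  dominated (fun z : RR => kern i (x - z.1) (y - z.2) * g z.1 z.2) (20 * r * M).
Proof.
move=> sg sp r0 gM; have M0 : 0 <= M := le_trans (normr_ge0 _) (gM 0 0).
have D1 := dominated_near_kern i x y r r0.
have D2 := dominated_scale _ _ r^-1 (dominated_box 0 0 r (ltW r0)).
have nD1 : dominated (fun z : RR => `|kern i (x - z.1) (y - z.2) * boxind x y r z|) (16 * r).
  apply: dominated_le D1 => //; last by move=> z; rewrite normr_id.
  by apply: measurableT_comp => //; have [] := dominated_near_kern i x y r r0.
have := dominated_scale _ _ M (dominated_add _ _ _ _ nD1 D2).
apply: dominated_le.
- exact: measurable_integrand.
- move=> z; rewrite normrM [in X in _ <= X]normrM (ger0_norm M0) mulrC.
  have [->|gz] := eqVneq (g z.1 z.2) 0; first by rewrite normr0 mul0r mulr_ge0.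
  rewrite ler_pM//.
  have B : boxind 0 0 r z = 1 by rewrite boxindE !sub0r !normrN; have [-> ->] := sp _ _ gz.
  rewrite B mulr1; set K := kern _ _ _.
  apply: le_trans (ler_norm _).
  rewrite [boxind x y r z]boxindE.
  have [/andP[h1 h2]|/nandP H] := boolP ((`|x - z.1| <= r) && (`|y - z.2| <= r)).
    by rewrite mulr1 lerDl invr_ge0 ltW.
  rewrite mulr0 normr0 add0r /K; apply: kern_bound => //.
  by case: H; rewrite -ltNge => /ltW; [left|right].
- rewrite !ger0_norm ?invr_ge0 ?(ltW r0)// le_eqVlt; apply/orP; left; apply/eqP; field.
  by rewrite gt_eqF.
Qed.

Lemma supped_gt0 r g : supped r g -> exists2 r', 0 < r' & supped r' g.
Proof.
move=> sp; exists (`|r| + 1); first by rewrite ltr_wpDl.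
by apply: supped_mono sp; rewrite (le_trans (ler_norm r))// lerDl.
Qed.

Lemma integrable_integrand i g x y r : sm g -> supped r g ->
  mu2.-integrable setT (EFin \o (fun z : RR => kern i (x - z.1) (y - z.2) * g z.1 z.2)).
Proof.
move=> sg sp; have [r' r0 sp'] := supped_gt0 _ _ sp; have [M bM] := sg 0%N.
apply: (dominated_integrable _ (20 * r' * M)); apply: dominated_integrand => //.
exact: bd_le0 bM.
Qed.

Lemma U_bound i g x y r M : sm g -> supped r g -> 0 < r ->
  (forall x y, `|g x y| <= M) -> `|U i g x y| <= 20 * r * M.
Proof. by move=> sg sp r0 gM; rewrite UE; apply: dominated_norm; exact: dominated_integrand. Qed.

Lemma U_lin i f g (c e : R) r : sm f -> sm g -> supped r f -> supped r g ->
  U i (fun x y => c * f x y + e * g x y) = fun x y => c * U i f x y + e * U i g x y.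
Proof.
move=> sf sg pf pg; apply/funext => x; apply/funext => y; rewrite !UE.
have If := integrable_integrand i f x y r sf pf.
have Ig := integrable_integrand i g x y r sg pg.
have Icf : mu2.-integrable setT (EFin \o (fun z : RR => c * (kern i (x - z.1) (y - z.2) * f z.1 z.2))).
  by have := integrableZl measurableT c If; apply: eq_integrable => // z _ /=; rewrite EFinM.
have Ieg : mu2.-integrable setT (EFin \o (fun z : RR => e * (kern i (x - z.1) (y - z.2) * g z.1 z.2))).
  by have := integrableZl measurableT e Ig; apply: eq_integrable => // z _ /=; rewrite EFinM.
rewrite -(RintegralZl c measurableT If) -(RintegralZl e measurableT Ig) -RintegralD//.
by apply: eq_Rintegral => z _; ring.
Qed.

Lemma U_sub i f g r : sm f -> sm g -> supped r f -> supped r g ->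
  U i (fun x y => f x y - g x y) = fun x y => U i f x y - U i g x y.
Proof.
move=> sf sg pf pg; have := U_lin i f g 1 (-1) r sf sg pf pg.
under eq_fun do under eq_fun do rewrite mul1r mulN1r.
by move=> ->; under eq_fun do under eq_fun do rewrite mul1r mulN1r.
Qed.

Lemma U_scale i f c r : sm f -> supped r f ->
  U i (fun x y => c * f x y) = fun x y => c * U i f x y.
Proof.
move=> sf pf; have := U_lin i f f c 0 r sf sf pf pf.
under eq_fun do under eq_fun do rewrite mul0r addr0.
by move=> ->; under eq_fun do under eq_fun do rewrite mul0r addr0.
Qed.

Lemma supped_sh j s r f : supped r f -> supped (r + `|s|) (sh j s f).
Proof.
have N (t : R) : `|t| <= `|t + s| + `|s|.
  by have := ler_normB (t + s) s; rewrite addrK.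
move=> sp x y; rewrite /sh; case: j => /sp[h1 h2]; split.
- by rewrite (le_trans h1)// lerDl.
- by rewrite (le_trans (N _))// lerD2r.
- by rewrite (le_trans (N _))// lerD2r.
- by rewrite (le_trans h2)// lerDl.
Qed.

Lemma U_sh i j s g r : sm g -> supped r g -> U i (sh j s g) = sh j s (U i g).
Proof.
move=> sg sp; apply/funext => x; apply/funext => y.
pose x' := if j then x else x + s; pose y' := if j then y + s else y.
have -> : sh j s (U i g) x y = U i g x' y' by rewrite /sh /x' /y'; case: (j).
rewrite !UE.
pose F := fun z : RR => kern i (x' - z.1) (y' - z.2) * g z.1 z.2.
have E : (fun z : RR => kern i (x - z.1) (y - z.2) * sh j s g z.1 z.2) =
    F \o shift2 (if j then 0 else s) (if j then s else 0).
  apply/funext => z; rewrite /F /shift2 /sh /x' /y' /=.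
  by case: (j) => /=; congr (kern _ _ _ * g _ _); ring.
rewrite E; apply: Rintegral_shift2; first exact: measurable_integrand.
rewrite -E; apply: integrable_integrand; first exact: sm_sh.
exact: supped_sh sp.
Qed.

(** Convolution commutes with translations, so the remainder of [U i g] is [U i] applied to the
    remainder of [g], which is [O(s^2)] in sup norm. The singular kernel is never differentiated. *)
Lemma pd_U i j g r : sm g -> supped r g -> pd j (U i g) (U i (d j g)).
Proof.
move=> sg sp0; have [q q0 sp] := supped_gt0 _ _ sp0.
have sd := sm_d _ j sg; have spd := supped_d _ _ j sg sp.
have [M M0 bM] := sm_bd _ 2 sg.
have B f : sm f -> supped q f -> (forall x y, `|f x y| <= M) -> forall x y, `|U i f x y| <= 20 * q * M.
  by move=> sf pf fM x y; exact: U_bound.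
have Bg := B g sg sp (bd_le0 _ _ _ bM).
have Bd := B _ sd spd (bd_le0 _ _ _ (bd_d _ _ _ j bM)).
have qM : 0 <= 20 * q * M by rewrite !mulr_ge0// ltW.
exists (3 * (20 * q * M) + 20 * (q + 1) * M) => s x y.
have s2 : 0 <= s ^+ 2 := sqr_ge0 s.
rewrite mulrDl.
(* The translated support grows with [s]. For [|s| < 1] the box of radius [q + 1] contains it; for
   [|s| >= 1] the three terms are bounded one by one, using [1 <= s ^+ 2]. *)
have [s1|s1] := leP 1 `|s|; last first.
  have sps : supped (q + 1) (sh j s g).
    by apply: supped_mono (supped_sh j s _ _ sp); rewrite lerD2l ltW.
  have sp1 : supped (q + 1) g by apply: supped_mono sp; rewrite lerDl.
  have spd1 : supped (q + 1) (d j g) by apply: supped_mono spd; rewrite lerDl.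
  have ss := sm_sh j s _ sg.
  rewrite -(U_sh i j s g q)//.
  have -> : U i (sh j s g) x y - U i g x y - s * U i (d j g) x y =
     U i (fun x y => 1 * (sh j s g x y - g x y) + (- s) * d j g x y) x y.
    rewrite (U_lin i _ _ _ _ (q + 1))//; last 2 first.
    - exact: sm_sub.
    - exact: supped_sub.
    by rewrite (U_sub i _ _ (q + 1))// mul1r mulNr.
  apply: le_trans (_ : 20 * (q + 1) * M * s ^+ 2 <= _); last by rewrite lerDr mulr_ge0// mulr_ge0.
  rewrite -mulrA; apply: U_bound; last 2 first.
  - by rewrite ltr_wpDl// ltW.
  - move=> u v; have := bd_taylor _ _ _ u v ((~~ j)%:R * s) (j%:R * s) bM.
    rewrite /sh; case: (j) => /=; rewrite !mul0r !mul1r addr0 normr0 ?add0r ?addr0 ?subr0.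
      by rewrite real_normK ?num_real// mulNr.
    by rewrite real_normK ?num_real// mulNr.
  - by apply: sm_lin => //; exact: sm_sub.
  - by apply: supped_lin => //; exact: supped_sub.
apply: le_trans (_ : 3 * (20 * q * M) * s ^+ 2 <= _); last first.
  by rewrite lerDl mulr_ge0// mulr_ge0// mulr_ge0// addr_ge0// ltW.
have s12 : 1 <= s ^+ 2 by rewrite -[s ^+ 2]real_normK ?num_real// expr_ge1.
have ss2 : `|s| <= s ^+ 2.
  by rewrite -[s ^+ 2]real_normK ?num_real// expr2 ler_peMl.
have T1 : `|sh j s (U i g) x y| <= 20 * q * M * s ^+ 2.
  by apply: (@le_trans _ _ (20 * q * M)); [rewrite /sh; case: (j) | rewrite ler_peMr].
have T2 : `|U i g x y| <= 20 * q * M * s ^+ 2.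
  by apply: (@le_trans _ _ (20 * q * M)); [|rewrite ler_peMr].
have T3 : `|s * U i (d j g) x y| <= 20 * q * M * s ^+ 2.
  by rewrite normrM mulrC ler_pM.
have := ler_normB (sh j s (U i g) x y - U i g x y) (s * U i (d j g) x y).
have := ler_normB (sh j s (U i g) x y) (U i g x y).
move: T1 T2 T3; set a := `|_|; set b := `|_|; set c := `|_|; set e := _ * _ ^+ 2.
by rewrite -mulrA -/e; lra.
Qed.

(** Derivatives fall on [g] without enlarging its support, so the constant of order 0 serves at
    every order. *)
Lemma bd_U k i g r M : sm g -> supped r g -> 0 < r -> bd k M g -> bd k (20 * r * M) (U i g).
Proof.
move=> + + r0; elim: k g => [|k IH] g sg sp bg.
  by split => // x y; apply: U_bound => //; exact: bd_le0 bg.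
apply: bdS; first by move=> x y; apply: U_bound => //; exact: bd_le0 bg.
move=> j; exists (U i (d j g)); first exact: pd_U sp.
by apply: IH; [exact: sm_d | exact: supped_d | exact: bd_d].
Qed.

Lemma sm_U i g r : sm g -> supped r g -> sm (U i g).
Proof.
move=> sg sp k; have [q q0 spq] := supped_gt0 _ _ sp; have [M bM] := sg k.
by exists (20 * q * M); exact: bd_U.
Qed.

End biot_savart_operator.

(** * The logarithmic bound on derivatives of the velocity *)

Section log_estimate.
Context {R : realType}.

Local Notation RR := (measurableTypeR R * measurableTypeR R)%type.
Implicit Types (f g : R -> R -> R) (i j : bool) (x y r s M : R) (k N : nat).

Let coef_ge0 r e N : 0 < r -> 0 <= e -> 0 <= 32 * e / (r / 2 ^+ N) ^+ 2.
Proof.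
move=> r0 e0; apply: divr_ge0; first exact: mulr_ge0.
by apply: exprn_ge0; rewrite divr_ge0 ?exprn_ge0// ltW.
Qed.

(** The coefficients are inverse squares of the radii, so each box contributes the same mass
    [128 * e]. This scale invariance is the source of the logarithm: [N] counts the scales. *)
Lemma dominated_boxes x y r e N : 0 < r -> 0 <= e -> dominated
  (fun z : RR => \sum_(n < N) (32 * e / (r / 2 ^+ n) ^+ 2) * boxind x y (r / 2 ^+ n) z)
  (128 * e * N%:R).
Proof.
move=> r0 e0; elim: N => [|N IH].
  under eq_fun do rewrite big_ord0.
  have := dominated_scale _ _ 0 (dominated_box 0 0 0 (lexx (0 : R))).
  by rewrite normr0 mul0r mulr0; congr dominated; apply/funext => z; rewrite mul0r.
under eq_fun do rewrite big_ord_recr /=.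
have rN : 0 < r / 2 ^+ N by rewrite divr_gt0 ?exprn_gt0.
have := dominated_add _ _ _ _ IH (dominated_scale _ _ (32 * e / (r / 2 ^+ N) ^+ 2)
  (dominated_box x y _ (ltW rN))).
apply: dominated_le => //.
  by have [] := dominated_add _ _ _ _ IH (dominated_scale _ _ (32 * e / (r / 2 ^+ N) ^+ 2)
  (dominated_box x y _ (ltW rN))).
rewrite ger0_norm; last exact: coef_ge0.
rewrite -(natr1 N) le_eqVlt; apply/orP; left; apply/eqP.
by field; rewrite ?(gt_eqF r0) ?expf_neq0.
Qed.

(* Near the singularity both kernels are bounded by [1 / |z|], which contributes
   [O(e)]; each of the [N] dyadic scales in between contributes [O(e)] as well. *)
Lemma kern_increment i j (s e : R) x y r N (z : RR) : e = r / 2 ^+ N -> 0 < r -> 0 <= s <= e ->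
  boxset 0 0 r z ->
  `|kern i (if j then x - z.1 else x + s - z.1) (if j then y + s - z.2 else y - z.2) -
    kern i (x - z.1) (y - z.2)| <=
  (`|kern i (if j then x - z.1 else x + s - z.1) (if j then y + s - z.2 else y - z.2) *
     boxind (if j then x else x + s) (if j then y + s else y) (5 * e) z| +
   `|kern i (x - z.1) (y - z.2) * boxind x y (5 * e) z|) +
  (\sum_(n < N) (32 * e / (r / 2 ^+ n) ^+ 2) * boxind x y (r / 2 ^+ n) z +
   8 * e / r ^+ 2 * boxind 0 0 r z).
Proof.
move=> eE r0 /andP[s0 se] zr.
have e0 : 0 < e by rewrite eE divr_gt0 ?exprn_gt0.
have e5 t u : t <= 4 * e -> u <= t + e -> t <= 5 * e /\ u <= 5 * e by move=> *; split; lra.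
have e1 t p q : 0 < t -> t + t <= p -> p - e <= q -> q < t -> ~ (4 * e < p) by move=> *; lra.
have e2 t p p' q q' : 0 < t -> t + t <= p -> p - e <= q -> q < t ->
    p' - e <= q' -> q' < t -> 4 * e < p' -> False by move=> *; lra.
have r2 t : r < t -> r / 2 + r / 2 <= t by move=> *; lra.
have e4 t : 4 * e < t -> t <= e -> False by move=> *; lra.
set p1 := x - z.1; set p2 := y - z.2.
set q1 := if j then _ else x + s - z.1; set q2 := if j then y + s - z.2 else _.
have pq1 : `|q1 - p1| <= e.
  rewrite /q1 /p1; case: (j); first by rewrite subrr normr0 ltW.
  by rewrite (_ : _ - _ = s) ?ger0_norm//; ring.
have pq2 : `|q2 - p2| <= e.
  rewrite /q2 /p2; case: (j); last by rewrite subrr normr0 ltW.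
  by rewrite (_ : _ - _ = s) ?ger0_norm//; ring.
have Sge0 : 0 <= \sum_(n < N) (32 * e / (r / 2 ^+ n) ^+ 2) * boxind x y (r / 2 ^+ n) z.
  apply: sumr_ge0 => n _; rewrite mulr_ge0// ?boxindE//.
  by apply: coef_ge0 => //; exact: ltW.
have B0 : boxind 0 0 r z = 1.
  by rewrite boxindE; have [-> ->] := (boxsetP _ _ _ _).1 zr.
have Tge0 : 0 <= 8 * e / r ^+ 2 * boxind 0 0 r z.
  by rewrite B0 mulr1 divr_ge0 ?exprn_ge0 ?mulr_ge0// ltW.
have A1 : `|q1| <= `|p1| + e.
  by apply: le_trans (_ : `|p1| + `|q1 - p1| <= _); rewrite ?lerD2l// addrC -{1}(subrK p1 q1) ler_normD.
have A2 : `|q2| <= `|p2| + e.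
  by apply: le_trans (_ : `|p2| + `|q2 - p2| <= _); rewrite ?lerD2l// addrC -{1}(subrK p2 q2) ler_normD.
have A3 : `|p1| - e <= `|q1|.
  by rewrite lerBlDr; apply: le_trans (_ : `|q1| + `|q1 - p1| <= _); rewrite ?lerD2l//
    -{1}(subKr q1 p1) ler_normB.
have A4 : `|p2| - e <= `|q2|.
  by rewrite lerBlDr; apply: le_trans (_ : `|q2| + `|q2 - p2| <= _); rewrite ?lerD2l//
    -{1}(subKr q2 p2) ler_normB.
(* Within [4 * e] no cancellation is sought: [z] is within [5 * e] of both evaluation points, and
   the two kernels are bounded separately. *)
have [/andP[h1 h2]|far] := boolP ((`|p1| <= 4 * e) && (`|p2| <= 4 * e)).
  have [[p5 q5] [p5' q5']] := (e5 _ _ h1 A1, e5 _ _ h2 A2).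
  have E1 : boxind x y (5 * e) z = 1 by rewrite boxindE -/p1 -/p2 p5 p5'.
  have E2 : boxind (if j then x else x + s) (if j then y + s else y) (5 * e) z = 1.
    rewrite boxindE (_ : (if j then x else x + s) - z.1 = q1); last by rewrite /q1; case: (j).
    rewrite (_ : (if j then y + s else y) - z.2 = q2); last by rewrite /q2; case: (j).
    by rewrite q5 q5'.
  rewrite E1 E2 !mulr1; apply: le_trans (ler_normB _ _) _.
  by rewrite lerDl addr_ge0.
have far' : 4 * e < `|p1| \/ 4 * e < `|p2|.
  by case/nandP: far; rewrite -ltNge; [left|right].
apply: le_trans (_ : 0 + (\sum_(n < N) (32 * e / (r / 2 ^+ n) ^+ 2) *
   boxind x y (r / 2 ^+ n) z + 8 * e / r ^+ 2 * boxind 0 0 r z) <= _); last first.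
  by rewrite lerD2r addr_ge0.
rewrite add0r.
(* If [p] has size at least [2 t], then [q] has size at least [t]: otherwise [t < e], and both
   coordinates of [p] would be below [2 e], against [far']. *)
have D t : 0 < t -> t + t <= `|p1| \/ t + t <= `|p2| ->
    `|kern i q1 q2 - kern i p1 p2| <= 2 * e / t ^+ 2.
  move=> t0 h; apply: kern_diff => //; [exact: ltW|..].
    have [c1|c1] := leP t `|q1|; [by left|right].
    have [//|c2] := leP t `|q2|; exfalso.
    case: far' => F; case: h => h.
    - exact: e1 h A3 c1 F.
    - exact: e2 h A4 c2 A3 c1 F.
    - exact: e2 h A3 c1 A4 c2 F.
    - exact: e1 h A4 c2 F.
  case: h => h; [left|right]; apply: le_trans h; exact: (ler_wpDl (ltW t0)).
have [/andP[h1 h2]|out] := boolP ((`|p1| <= r) && (`|p2| <= r)); last first.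
  apply: le_trans (_ : 8 * e / r ^+ 2 * boxind 0 0 r z <= _); last by rewrite lerDr.
  rewrite B0 mulr1 (_ : 8 * e / r ^+ 2 = 2 * e / (r / 2) ^+ 2); last by field; rewrite gt_eqF.
  apply: D; first by rewrite divr_gt0.
  by case/nandP: out; rewrite -ltNge => /r2; [left|right].
apply: le_trans (_ : \sum_(n < N) (32 * e / (r / 2 ^+ n) ^+ 2) * boxind x y (r / 2 ^+ n) z <= _);
  last by rewrite lerDl.
(* [n] is the dyadic shell of [z]; it exists because the smallest box has radius [e]. Taking
   [t = r / 2 ^+ n.+2] in [D] produces the coefficient 32. *)
have [n [nN Hn HnS]] : exists n, [/\ (n < N)%N, boxset x y (r / 2 ^+ n) z &
    ~ boxset x y (r / 2 ^+ n.+1) z].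
  have HN : ~ boxset x y (r / 2 ^+ N) z.
    by move/boxsetP; rewrite -eE => -[a1 a2]; case: far' => /e4; apply.
  elim: (N) HN => [|m IH] HN.
    by exfalso; apply: HN; apply/boxsetP; rewrite expr0 divr1.
  have [zm|/IH[n [nm ? ?]]] := pselect (boxset x y (r / 2 ^+ m) z); first by exists m.
  by exists n; split => //; exact: ltnW.
have b1 : boxind x y (r / 2 ^+ n) z = 1.
  by rewrite boxindE; have [-> ->] := (boxsetP _ _ _ _).1 Hn.
rewrite (bigD1 (Ordinal nN))//= b1 mulr1.
apply: le_trans (_ : 32 * e / (r / 2 ^+ n) ^+ 2 <= _); last first.
  rewrite lerDl; apply: sumr_ge0 => m _; rewrite mulr_ge0// ?boxindE//.
  by apply: coef_ge0 => //; exact: ltW.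
rewrite (_ : 32 * e / (r / 2 ^+ n) ^+ 2 = 2 * e / (r / 2 ^+ n.+2) ^+ 2); last first.
  by rewrite !exprS; field; rewrite ?(gt_eqF r0) ?expf_neq0.
apply: D; first by rewrite divr_gt0// exprn_gt0.
have -> : r / 2 ^+ n.+2 + r / 2 ^+ n.+2 = r / 2 ^+ n.+1.
  by rewrite !exprS; field; rewrite expf_neq0.
have /not_andP[] : ~ (`|p1| <= r / 2 ^+ n.+1 /\ `|p2| <= r / 2 ^+ n.+1).
  by move=> ?; apply: HnS; exact/boxsetP.
  by move/negP; rewrite -ltNge => /ltW; left.
by move/negP; rewrite -ltNge => /ltW; right.
Qed.

(** With [e = r / 2 ^+ N], the majorant of [kern_increment] has mass [160 * e] near the two
    singularities, [128 * e * N] over the intermediate scales, and [32 * e] from the rest of the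
    support. *)
Lemma U_log_lipschitz i j g x y r M N s : sm g -> supped r g -> 0 < r ->
  (forall x y, `|g x y| <= M) -> 0 <= s <= r / 2 ^+ N ->
  `|sh j s (U i g) x y - U i g x y| <= 192 * M * (r / 2 ^+ N) * (N%:R + 1).
Proof.
move=> sg sp r0 gM se.
have M0 : 0 <= M := le_trans (normr_ge0 _) (gM 0 0).
set e := r / 2 ^+ N in se *.
have e0 : 0 < e by rewrite divr_gt0 ?exprn_gt0.
pose x' := if j then x else x + s; pose y' := if j then y + s else y.
have -> : sh j s (U i g) x y = U i g x' y' by rewrite /sh /x' /y'; case: (j).
rewrite !UE -RintegralB//; last 2 first.
- exact: integrable_integrand sp.
- exact: integrable_integrand sp.
have e5 : 0 < 5 * e by rewrite mulr_gt0.
have nD a b : dominated (fun z : RR => `|kern i (a - z.1) (b - z.2) * boxind a b (5 * e) z|) (16 * (5 * e)).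
  have D := dominated_near_kern i a b _ e5; have [mD _] := D.
  apply: dominated_le D => //; last by move=> z; rewrite normr_id.
  exact: measurableT_comp.
have D1 := dominated_add _ _ _ _ (nD x' y') (nD x y).
have D2 := dominated_add _ _ _ _ (dominated_boxes x y r e N r0 (ltW e0))
  (dominated_scale _ _ (8 * e / r ^+ 2) (dominated_box 0 0 r (ltW r0))).
apply: dominated_norm; have := dominated_scale _ _ M (dominated_add _ _ _ _ D1 D2).
apply: dominated_le.
- by apply: measurable_funB; exact: measurable_integrand.
- move=> z; rewrite -mulrBl normrM [in X in _ <= X]normrM (ger0_norm M0) mulrC.
  have [->|gz] := eqVneq (g z.1 z.2) 0; first by rewrite normr0 mul0r mulr_ge0.
  rewrite ler_pM//; apply: le_trans (ler_norm _).
  have zr : boxset 0 0 r z by apply/boxsetP; rewrite !sub0r !normrN; exact: sp.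
  have := kern_increment i j s e x y r N z erefl r0 se zr.
  by rewrite /x' /y'; case: (j).
- rewrite !ger0_norm//; last by rewrite divr_ge0 ?exprn_ge0 ?mulr_ge0// ltW.
  rewrite (_ : 8 * e / r ^+ 2 * (4 * r ^+ 2) = 32 * e); last by field; rewrite gt_eqF.
  rewrite -subr_ge0 (_ : _ - _ = 64 * (M * e * N%:R)); last by ring.
  by rewrite !mulr_ge0// ltW.
Qed.

(** The derivative of [U i g] is replaced by its difference quotient at scale [e = r / 2 ^+ N],
    which involves only the sup bound [P]. The price is the oscillation of [U i (d j g)] over a
    distance at most [e], of order [Y * e * (N + 1)]; the choice [Y * r <= 2 ^+ N] makes
    [Y * e <= 1]. *)
Lemma U_d_log i j g r P Y x y N : sm g -> supped r g -> 0 < r ->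
  (forall x y, `|g x y| <= P) -> (forall x y, `|d j g x y| <= Y) -> Y * r <= 2 ^+ N ->
  `|U i (d j g) x y| <= 192 * (P + 1) * (N%:R + 1).
Proof.
move=> sg sp r0 gP gY YN.
have P0 : 0 <= P := le_trans (normr_ge0 _) (gP 0 0).
have Y0 : 0 <= Y := le_trans (normr_ge0 _) (gY 0 0).
set e := r / 2 ^+ N.
have e0 : 0 < e by rewrite divr_gt0 ?exprn_gt0.
have [t /andP[t0 t1] E] := pd_mvt _ _ _ e x y (pd_U i j g r sg sp).
have ee : 0 <= e <= r / 2 ^+ N by rewrite ltW//=.
have te : 0 <= t * e <= r / 2 ^+ N.
  by rewrite mulr_ge0 ?(ltW e0)//= ler_piMl// ltW.
have L1 := U_log_lipschitz i j g x y r P N e sg sp r0 gP ee.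
have L2 := U_log_lipschitz i j (d j g) x y r Y N (t * e) (sm_d _ _ sg)
  (supped_d _ _ j sg sp) r0 gY te.
have -> : U i (d j g) x y = e^-1 * (sh j e (U i g) x y - U i g x y) -
   (sh j (t * e) (U i (d j g)) x y - U i (d j g) x y).
  by rewrite E mulrA mulVf ?gt_eqF// mul1r subKr.
apply: le_trans (ler_normB _ _) _.
have N0 : 0 <= N%:R + 1 :> R by rewrite addr_ge0.
have K1 : `|e^-1 * (sh j e (U i g) x y - U i g x y)| <= 192 * P * (N%:R + 1).
  rewrite normrM ger0_norm ?invr_ge0 ?(ltW e0)// mulrC ler_pdivrMr// (le_trans L1)//.
  by rewrite -/e le_eqVlt; apply/orP; left; apply/eqP; ring.
have K2 : `|sh j (t * e) (U i (d j g)) x y - U i (d j g) x y| <= 192 * (N%:R + 1).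
  apply: le_trans L2 _; rewrite ler_wpM2r// -mulrA ler_piMr//.
  by rewrite mulrA ler_pdivrMr ?exprn_gt0// mul1r.
apply: le_trans (lerD K1 K2) _; rewrite le_eqVlt; apply/orP; left; apply/eqP; ring.
Qed.

Let aux1 (u v : R) : u <= v + 1 -> u + 1 <= v + 2.
Proof. lra. Qed.

Let aux2 (p q l : R) : 0 < l -> 0 <= p -> 0 <= q ->
  (p + q) / l + 2 <= (2 + (1 + p) / l) * (1 + q).
Proof.
move=> l0 p0 q0; rewrite -subr_ge0.
rewrite (_ : _ - _ = 2 * q + (1 + p * q) / l); last by field; rewrite gt_eqF.
apply: addr_ge0; first exact: mulr_ge0.
by apply: divr_ge0; [rewrite addr_ge0 ?mulr_ge0 | exact: ltW].
Qed.

(** A derivative of order [k + 1] of [U i g] is [U i (d j g')] with [g'] a derivative of order [k]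
    of [g], so [P] bounds [g'] and only the logarithm sees the top order. The constant does not
    depend on [k]. *)
Lemma bd_U_log r : 0 < r -> exists2 C, 0 <= C & forall k i g P Y, sm g -> supped r g ->
  bd k P g -> bd k.+1 Y g -> bd k.+1 (C * (1 + P) * (1 + ln (1 + Y))) (U i g).
Proof.
move=> r0.
have ln2 : 0 < ln (2 : R) by rewrite ln_gt0// ltr1n.
have lnr : 0 <= ln (1 + r) by rewrite ln_ge0// lerDl ltW.
pose C := 20 * r + 192 * (2 + (1 + ln (1 + r)) / ln 2).
have C20 : 20 * r <= C.
  by rewrite lerDl mulr_ge0// addr_ge0// divr_ge0// ?addr_ge0// ltW.
have C0 : 0 <= C by apply: le_trans C20; rewrite mulr_ge0// ltW.
exists C => // k i g P Y; have main g' j P' Y' x y : sm g' -> supped r g' ->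
    (forall x y, `|g' x y| <= P') -> (forall x y, `|d j g' x y| <= Y') ->
    `|U i (d j g') x y| <= C * (1 + P') * (1 + ln (1 + Y')).
  move=> sg sp gP gY.
  have P0 : 0 <= P' := le_trans (normr_ge0 _) (gP 0 0).
  have Y0 : 0 <= Y' := le_trans (normr_ge0 _) (gY 0 0).
  have lY : 0 <= ln (1 + Y') by rewrite ln_ge0// lerDl.
  (* The base-2 logarithm of [(1 + r) * (1 + Y')]: the next integer [N] satisfies [Y' * r <= 2 ^+ N]
     with [N <= a + 1]. *)
  pose a := (ln (1 + r) + ln (1 + Y')) / ln 2.
  have a0 : 0 <= a by rewrite divr_ge0 ?addr_ge0// ltW.
  pose N := (Num.truncn a).+1.
  have aN : a <= N%:R by rewrite ltW// truncnS_gt.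
  have Na : N%:R <= a + 1 by rewrite -natr1 lerD2r truncn_le.
  have YN : Y' * r <= 2 ^+ N.
    apply: (@le_trans _ _ ((1 + r) * (1 + Y'))); first by nra.
    have p1 : 0 < 1 + r by rewrite addr_gt0.
    have p2 : 0 < 1 + Y' by rewrite ltr_pwDl.
    rewrite -ler_ln ?posrE ?mulr_gt0 ?exprn_gt0// lnM ?posrE// lnXn//.
    by move: aN; rewrite /a ler_pdivrMr// mulr_natl.
  have := U_d_log i j g' r P' Y' x y N sg sp r0 gP gY YN => /le_trans; apply.
  rewrite mulrAC [C * _ * _]mulrAC [P' + 1]addrC ler_wpM2r// ?addr_ge0//.
  apply: (@le_trans _ _ (192 * (2 + (1 + ln (1 + r)) / ln 2) * (1 + ln (1 + Y')))); last first.
    by rewrite ler_wpM2r ?addr_ge0// lerDr mulr_ge0// ltW.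
  rewrite -mulrA ler_wpM2l//; apply: (@le_trans _ _ (a + 2)); first exact: aux1.
  exact: aux2.
have B0 M g' Y' x y : sm g' -> supped r g' -> (forall x y, `|g' x y| <= M) -> 0 <= Y' ->
    `|U i g' x y| <= C * (1 + M) * (1 + ln (1 + Y')).
  move=> sg sp gM Y0; have M0 : 0 <= M := le_trans (normr_ge0 _) (gM 0 0).
  apply: le_trans (U_bound i g' x y r M sg sp r0 gM) _.
  have lY : 0 <= ln (1 + Y') by rewrite ln_ge0// lerDl.
  apply: (@le_trans _ _ (C * (1 + M))).
    by rewrite ler_pM// ?mulr_ge0 ?(ltW r0)// lerDr.
  have CM : 0 <= C * (1 + M) := mulr_ge0 C0 (addr_ge0 ler01 M0).
  by apply: ler_peMr => //; rewrite lerDl.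
elim: k g => [|k IH] g sg sp bP bY.
  apply: bdS => [x y|j].
    by apply: B0 => //; [exact: bd_le0 bP | exact: bd_ge0 bY].
  exists (U i (d j g)); first exact: pd_U sp.
  split => // x y; apply: main => //; first exact: bd_le0 bP.
  exact: bd_le0 (bd_d _ _ _ j bY).
apply: bdS => [x y|j].
  by apply: B0 => //; [exact: bd_le0 bP | exact: bd_ge0 bY].
exists (U i (d j g)); first exact: pd_U sp.
by apply: IH; [exact: sm_d | exact: supped_d | exact: bd_d | exact: bd_d].
Qed.

End log_estimate.

(** * The Lagrangian Euler scheme *)

Section scheme.
Context {R : realType}.
Implicit Types (f g : R -> R -> R) (i j : bool) (x y r s c h B : R) (k n : nat).

(** One Euler step for transport of [f] by the velocity of [g], pulled back along straight segments.
    No inverse map is required, and the sign of [c] serves the two equations of the system. *)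
Definition adv c f g : R -> R -> R :=
  cmp (fun x y => c * U false g x y) (fun x y => c * U true g x y) f.

Definition nl f g : R -> R -> R :=
  fun x y => U false g x y * d false f x y + U true g x y * d true f x y.

Definition cls r f := sm f /\ supped r f.

Lemma sm_scale c f : sm f -> sm (fun x y => c * f x y).
Proof. by move=> sf k; have [M bM] := sf k; eexists; exact: bd_scale bM. Qed.

Lemma sm_cU c i g r : cls r g -> sm (fun x y => c * U i g x y).
Proof. by move=> [sg pg]; apply: sm_scale; exact: sm_U pg. Qed.

Lemma sm_adv c f g r : cls r f -> cls r g -> sm (adv c f g).
Proof. by move=> [sf _] cg; apply: sm_cmp => //; exact: sm_cU cg. Qed.

Lemma adv_le c f g B : (forall x y, `|f x y| <= B) -> forall x y, `|adv c f g x y| <= B.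
Proof. by move=> fB x y; rewrite /adv /cmp. Qed.

Lemma supped_adv c f g r r' M : cls r f -> cls r g -> 0 < r -> supped r' f -> r <= r' ->
  (forall x y, `|g x y| <= M) ->
  supped (r' + `|c| * (20 * r * M)) (adv c f g).
Proof.
move=> _ [sg pg] r0 pf rr gM x y; rewrite /adv /cmp => /pf [h1 h2].
have b i : `|c * U i g x y| <= `|c| * (20 * r * M) by rewrite normrM ler_wpM2l// U_bound.
have N (t s e : R) : `|t + s| <= r' -> `|s| <= e -> `|t| <= r' + e.
  move=> h he; have := ler_normB (t + s) s; rewrite addrK => /le_trans; apply.
  exact: lerD.
by split; [exact: N h1 (b false) | exact: N h2 (b true)].
Qed.

Lemma bd_cU k c h i g r B : 0 < r -> cls r g -> bd k B g -> `|c| <= h ->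
  bd k (h * (20 * r * B)) (fun x y => c * U i g x y).
Proof.
move=> r0 [sg pg] bg ch; apply: bd_mono (bd_scale _ _ _ c (bd_U k i g r B sg pg r0 bg)) => //.
by rewrite ler_wpM2r// !mulr_ge0 ?(bd_ge0 _ _ _ bg)// ltW.
Qed.

(* Osgood step: a bound [expR z] grows at most to [expR (z * expR (D h))]. *)
Lemma adv_growth k r B : 0 < r -> 0 <= B -> exists2 D, 0 <= D & forall c h f g z,
  `|c| <= h -> h <= 1 -> 1 <= z -> cls r f -> cls r g -> bd k B f -> bd k B g ->
  bd k.+1 (expR z) f -> bd k.+1 (expR z) g -> bd k.+1 (expR (z * expR (D * h))) (adv c f g).
Proof.
move=> r0 B0; have [C C0 HC] := bd_U_log r r0.
have P0 : 0 <= 20 * r * B by rewrite !mulr_ge0// ltW.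
have [q q0 Hq] := bd_cmp k _ P0.
pose E := C * (1 + B).
have E0 : 0 <= E by rewrite mulr_ge0// addr_ge0.
exists (q * (1 + 3 * E)); first by rewrite mulr_ge0// addr_ge0// mulr_ge0.
move=> c h f g z ch h1 z1 cf cg bf bg Bf Bg.
have h0 : 0 <= h := le_trans (normr_ge0 c) ch.
(* For [Y = expR z] the logarithmic factor is at most [z + 2]; the assumption [1 <= z] makes this
   linear in [z]. *)
have lnz : 1 + ln (1 + expR z) <= 3 * z.
  have e1 : 1 + expR z <= expR (z + 1).
    rewrite addrC expRD; have := expR_ge1Dx (1 : R); have z0 : 0 <= z := le_trans ler01 z1.
    have := expR_ge1Dx z => ez e2; apply: (@le_trans _ _ (expR z * (1 + 1))).
      by rewrite mulrDr mulr1 lerD2l; apply: le_trans ez; rewrite lerDl.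
    by rewrite ler_wpM2l// expR_ge0.
  have : ln (1 + expR z) <= z + 1.
    by rewrite -[leRHS]expRK ler_ln// posrE ?expR_gt0// addr_gt0// expR_gt0.
  by move: z1; set l := ln _; move: l => l *; lra.
pose A := E * (1 + ln (1 + expR z)).
have bA i : bd k.+1 (h * A) (fun x y => c * U i g x y).
  have [sg pg] := cg.
  apply: bd_mono (bd_scale _ _ _ c (HC k i g B _ sg pg bg Bg)) => //.
  rewrite -/E ler_wpM2r// mulr_ge0// addr_ge0// ln_ge0// lerDl expR_ge0 //.
have hh : 0 <= h <= 1 by apply/andP.
have [sf _] := cf.
have [_ H] := Hq h A _ _ hh (sm_cU c false g r cg) (sm_cU c true g r cg)
   (bd_cU k c h false g r B r0 cg bg ch) (bd_cU k c h true g r B r0 cg bg ch)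
   (bA false) (bA true).
have {H} := H f _ sf Bf; apply: bd_mono => //.
pose D := q * (1 + 3 * E).
have D0 : 0 <= D by rewrite mulr_ge0// addr_ge0// mulr_ge0.
have qA : q * (1 + A) <= D * z.
  rewrite /D -mulrA ler_wpM2l// mulrDl mul1r lerD//.
  have -> : 3 * E * z = E * (3 * z) by rewrite [RHS]mulrCA mulrA.
  exact: (ler_wpM2l E0 lnz).
(* From here [1 + w <= expR w] is used twice: on the growth factor, then on [1 + D * h] in the
   exponent. *)
apply: (@le_trans _ _ ((1 + h * (D * z)) * expR z)).
  by rewrite ler_wpM2r ?expR_ge0// lerD2l ler_wpM2l.
apply: (@le_trans _ _ (expR (h * (D * z)) * expR z)).
  by rewrite ler_wpM2r ?expR_ge0// expR_ge1Dx.
rewrite -expRD ler_expR.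
have -> : h * (D * z) + z = z * (1 + D * h).
  by rewrite mulrDr mulr1 addrC (mulrCA h D z) (mulrCA z D h) (mulrC h z).
by rewrite ler_wpM2l ?(le_trans ler01 z1)// expR_ge1Dx.
Qed.

Lemma adv_near k r B : 0 < r -> 0 <= B -> exists2 C, 0 <= C & forall c f g,
  `|c| <= 1 -> cls r f -> cls r g -> bd k.+1 B f -> bd k B g ->
  bd k (C * `|c|) (fun x y => adv c f g x y - f x y).
Proof.
move=> r0 B0; have P0 : 0 <= 20 * r * B by rewrite !mulr_ge0// ltW.
have Q0 : 0 <= B + 20 * r * B by rewrite addr_ge0.
have [q q0 Hq] := bd_cmp_sub k _ Q0.
exists (q * (20 * r * B)); first exact: mulr_ge0.
move=> c f g c1 cf cg bf bg; have [sf _] := cf.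
have b1 i : bd k (B + 20 * r * B) (fun x y => c * U i g x y).
  by apply: bd_mono (bd_cU k c 1 i g r B r0 cg bg c1) => //; rewrite mul1r lerDr.
have b2 i : bd k (`|c| * (20 * r * B)) (fun x y => c * U i g x y - 0).
  have := bd_cU k c _ i g r B r0 cg bg (lexx _).
  by congr bd; apply/funext => x; apply/funext => y; rewrite subr0.
have b3 : bd k (B + 20 * r * B) (fun _ _ => 0).
  by apply: bd_mono (bd_cst k 0) => //; rewrite normr0.
have b4 : bd k.+1 (B + 20 * r * B) f by apply: bd_mono bf => //; rewrite lerDl.
have := Hq _ f _ _ (fun _ _ => 0) (fun _ _ => 0) sf (sm_cU c false g r cg)
  (sm_cU c true g r cg) (sm_cst 0) (sm_cst 0) b4 (b1 false) (b1 true) b3 b3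
  (b2 false) (b2 true).
rewrite [_ * (`|c| * _)]mulrCA [`|c| * _]mulrC.
by congr bd; apply/funext => x; apply/funext => y; rewrite /cmp !addr0.
Qed.

(** Stability without loss of order. [f - f'] is moved by one common displacement, with factor
    [1 + O(c)] from [bd_cmp]; only [f'] is compared under two displacements, and it alone pays the
    derivative lost in [bd_cmp_sub]. *)
Lemma adv_lip k r B : 0 < r -> 0 <= B -> exists2 C, 0 <= C & forall c f g f' g' e,
  `|c| <= 1 -> cls r f -> cls r g -> cls r f' -> cls r g' ->
  bd k.+1 B g -> bd k.+1 B f' -> bd k.+1 B g' ->
  bd k e (fun x y => f x y - f' x y) -> bd k e (fun x y => g x y - g' x y) ->
  bd k ((1 + C * `|c|) * e) (fun x y => adv c f g x y - adv c f' g' x y).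
Proof.
move=> r0 B0; have P0 : 0 <= 20 * r * B by rewrite !mulr_ge0// ltW.
have [p p0 Hp] := bd_cmp k _ P0.
have Q0 : 0 <= B + 20 * r * B by rewrite addr_ge0.
have [q q0 Hq] := bd_cmp_sub k _ Q0.
exists (p + q * (20 * r)); first by rewrite addr_ge0// mulr_ge0// mulr_ge0// ltW.
move=> c f g f' g' e c1 cf cg cf' cg' bg bf' bg' ef eg.
have [sf pf] := cf; have [sf' pf'] := cf'; have [sg pg] := cg; have [sg' pg'] := cg'.
have lo u : bd k.+1 B u -> bd k B u by exact: bd_mono.
have cc : 0 <= `|c| <= 1 by rewrite normr_ge0.
have b1 u i : cls r u -> bd k.+1 B u -> bd k (B + 20 * r * B) (fun x y => c * U i u x y).
  move=> cu bu; apply: bd_mono (bd_cU k c 1 i u r B r0 cu (lo _ bu) c1) => //.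
  by rewrite mul1r lerDr.
have b2 i : bd k (`|c| * (20 * r * e)) (fun x y => c * U i g x y - c * U i g' x y).
  have cgg : cls r (fun x y => g x y - g' x y) by split; [exact: sm_sub | exact: supped_sub].
  have := bd_cU k c _ i _ r e r0 cgg eg (lexx _); rewrite (U_sub i g g' r)//.
  by congr bd; apply/funext => x; apply/funext => y; rewrite mulrBr.
have b4 : bd k.+1 (B + 20 * r * B) f' by apply: bd_mono bf' => //; rewrite lerDl.
have X := Hq _ f' _ _ _ _ sf' (sm_cU c false g r cg)
  (sm_cU c true g r cg) (sm_cU c false g' r cg') (sm_cU c true g' r cg') b4
  (b1 _ false cg bg) (b1 _ true cg bg) (b1 _ false cg' bg') (b1 _ true cg' bg')
  (b2 false) (b2 true).
have c20 i : bd k (`|c| * (20 * r * B)) (fun x y => c * U i g x y).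
  exact: (bd_cU k c _ i g r B r0 cg (lo _ bg) (lexx _)).
have [M M0 bM] := sm_bd _ k.+1 sg.
have cM i : bd k.+1 (`|c| * (20 * r * M)) (fun x y => c * U i g x y).
  exact: (bd_cU k.+1 c _ i g r M r0 cg bM (lexx _)).
have [Y _] := Hp `|c| _ _ _ cc (sm_cU c false g r cg) (sm_cU c true g r cg)
  (c20 false) (c20 true) (cM false) (cM true).
have {}Y := Y _ _ (sm_sub _ _ sf sf') ef.
have := bd_add _ _ _ _ _ Y X.
have -> : (1 + `|c| * p) * e + q * (`|c| * (20 * r * e)) = (1 + (p + q * (20 * r)) * `|c|) * e.
  by move: `|c| => a; ring.
by congr bd; apply/funext => x; apply/funext => y; rewrite /adv /cmp /=; rewrite addrA subrK.
Qed.

(** Consistency: [nl] is the generator of the scheme, with local error [O(c^2)]. *)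
Lemma adv_taylor k r B : 0 < r -> 0 <= B -> exists2 C, 0 <= C & forall c f g,
  `|c| <= 1 -> cls r f -> cls r g -> bd k.+2 B f -> bd k B g ->
  bd k (C * `|c| ^+ 2) (fun x y => adv c f g x y - f x y - c * nl f g x y).
Proof.
move=> r0 B0; have P0 : 0 <= 20 * r * B by rewrite !mulr_ge0// ltW.
have Q0 : 0 <= B + 20 * r * B by rewrite addr_ge0.
have [q q0 Hq] := bd_cmp_taylor k _ Q0.
exists (q * (20 * r * B) ^+ 2); first by rewrite mulr_ge0// sqr_ge0.
move=> c f g c1 cf cg bf bg; have [sf _] := cf.
have b2 i : bd k (`|c| * (20 * r * B)) (fun x y => c * U i g x y).
  exact: (bd_cU k c _ i g r B r0 cg bg (lexx _)).
have b4 : bd k.+2 (B + 20 * r * B) f by apply: bd_mono bf => //; rewrite lerDl.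
have ee : 0 <= `|c| * (20 * r * B) <= B + 20 * r * B.
  rewrite mulr_ge0//=; apply: le_trans (_ : 20 * r * B <= _); last by rewrite lerDr.
  by rewrite ler_piMl.
have := Hq _ f _ _ ee sf (sm_cU c false g r cg) (sm_cU c true g r cg) b4 (b2 false) (b2 true).
rewrite exprMn [`|c| ^+ 2 * _]mulrC mulrA.
by congr bd; apply/funext => x; apply/funext => y; rewrite /nl mulrDr !mulrA.
Qed.

Lemma bd_nl k r B : 0 < r -> 0 <= B -> exists2 C, 0 <= C & forall f g,
  cls r f -> cls r g -> bd k.+1 B f -> bd k B g -> bd k C (nl f g).
Proof.
move=> r0 B0; exists (2 ^+ k * (20 * r * B * B) + 2 ^+ k * (20 * r * B * B)).
  by rewrite addr_ge0// mulr_ge0 ?exprn_ge0// !mulr_ge0// ltW.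
move=> f g [sf pf] [sg pg] bf bg.
by apply: bd_add; apply: bd_mul; solve [exact: bd_U | exact: bd_d].
Qed.

Lemma nl_lip k r B : 0 < r -> 0 <= B -> exists2 C, 0 <= C & forall f g f' g' e,
  cls r f -> cls r g -> cls r f' -> cls r g' -> bd k B g -> bd k.+1 B f' ->
  bd k.+1 e (fun x y => f x y - f' x y) -> bd k e (fun x y => g x y - g' x y) ->
  bd k (C * e) (fun x y => nl f g x y - nl f' g' x y).
Proof.
move=> r0 B0; exists (4 * (2 ^+ k * (20 * r * B))).
  by rewrite mulr_ge0// mulr_ge0 ?exprn_ge0// !mulr_ge0// ltW.
move=> f g f' g' e [sf pf] [sg pg] [sf' pf'] [sg' pg'] bg bf' ef eg.
have T i : bd k (2 ^+ k * (20 * r * B * e) + 2 ^+ k * (20 * r * e * B))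
    (fun x y => U i g x y * d i f x y - U i g' x y * d i f' x y).
  have E1 : bd k e (fun x y => d i f x y - d i f' x y).
    by have := bd_d _ _ _ i ef; rewrite d_sub.
  have E2 : bd k (20 * r * e) (fun x y => U i g x y - U i g' x y).
    rewrite -(U_sub i g g' r)//; apply: bd_U => //; [exact: sm_sub | exact: supped_sub].
  have := bd_add _ _ _ _ _ (bd_mul _ _ _ _ _ (bd_U k i g r B sg pg r0 bg) E1)
     (bd_mul _ _ _ _ _ E2 (bd_d _ _ _ i bf')).
  congr bd; apply/funext => x; apply/funext => y /=.
  by rewrite mulrBr mulrBl addrA subrK.
have := bd_add _ _ _ _ _ (T false) (T true).
have -> : forall w, w * (20 * r * B * e) + w * (20 * r * e * B) +
    (w * (20 * r * B * e) + w * (20 * r * e * B)) = 4 * (w * (20 * r * B)) * e by move=> w; ring.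
congr bd; apply/funext => x; apply/funext => y /=; rewrite /nl.
by rewrite opprD addrACA.
Qed.

End scheme.

(** * Bounds on the iterates and comparison of step sizes *)

Section iteration.
Context {R : realType}.
Local Notation pl := (R -> R -> R).
Implicit Types (f g : pl) (p q : pl * pl) (r c h B e T : R) (k n j l : nat).

(** Both components are updated from the old pair; the opposite signs are those of the two
    equations. *)
Definition step h p : pl * pl := (adv h p.1 p.2, adv (- h) p.2 p.1).
Definition st h p n : pl * pl := iter n (step h) p.

Definition cls2 r p := cls r p.1 /\ cls r p.2.
Definition bd2 k e p := bd k e p.1 /\ bd k e p.2.
Definition dif p q : pl * pl := (fun x y => p.1 x y - q.1 x y, fun x y => p.2 x y - q.2 x y).
Definition nl2 p : pl * pl := (nl p.1 p.2, fun x y => - nl p.2 p.1 x y).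
Definition scl c p : pl * pl := (fun x y => c * p.1 x y, fun x y => c * p.2 x y).

Lemma bd2_mono k k' M M' p : (k' <= k)%N -> M <= M' -> bd2 k M p -> bd2 k' M' p.
Proof. by move=> kk MM [b1 b2]; split; exact: bd_mono kk MM _. Qed.

Lemma bd2_tri k e e' p q q' : bd2 k e (dif p q) -> bd2 k e' (dif q q') -> bd2 k (e + e') (dif p q').
Proof.
move=> [b1 b2] [b1' b2']; split; [have := bd_add _ _ _ _ _ b1 b1' | have := bd_add _ _ _ _ _ b2 b2'];
  by congr bd; apply/funext => x; apply/funext => y /=; rewrite addrA subrK.
Qed.

Lemma bd2_sym k e p q : bd2 k e (dif p q) -> bd2 k e (dif q p).
Proof.
move=> [b1 b2]; split; [have := bd_scale _ _ _ (-1) b1 | have := bd_scale _ _ _ (-1) b2];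
  rewrite normrN1 mul1r; congr bd; apply/funext => x; apply/funext => y /=;
  by rewrite mulN1r opprB.
Qed.

Lemma bd2_scl k e c p : bd2 k e p -> bd2 k (`|c| * e) (scl c p).
Proof. by move=> [b1 b2]; split; exact: bd_scale. Qed.

Lemma bd2_dif k e e' p q : bd2 k e p -> bd2 k e' q -> bd2 k (e + e') (dif p q).
Proof. by move=> [b1 b2] [b1' b2']; split; exact: bd_sub. Qed.

Lemma bd2_refl k p : bd2 k 0 (dif p p).
Proof.
by split; rewrite /= (_ : (fun x y => _) = (fun _ _ => 0)); try (by apply/funext => x; apply/funext => y;
  rewrite subrr); have := @bd_cst R k 0; rewrite normr0.
Qed.

Lemma norm_half h : 0 <= h -> `|h / 2| <= h.
Proof. by move=> h0; rewrite ger0_norm ?divr_ge0// ler_pdivrMr// ler_peMr// ler1n. Qed.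

Lemma step_near k r B : 0 < r -> 0 <= B -> exists2 C, 0 <= C & forall h p,
  0 <= h <= 1 -> cls2 r p -> bd2 k.+1 B p -> bd2 k (C * h) (dif (step h p) p).
Proof.
move=> r0 B0; have [C C0 H] := adv_near k r B r0 B0; exists C => // h p /andP[h0 h1] [c1 c2] [b1 b2].
have lo (u : pl) : bd k.+1 B u -> bd k B u by exact: bd_mono.
split; rewrite /=.
  by have := H h _ _ _ c1 c2 b1 (lo _ b2); rewrite ger0_norm//; apply.
by have := H (- h) _ _ _ c2 c1 b2 (lo _ b1); rewrite normrN ger0_norm//; apply.
Qed.

Lemma step_lip k r B : 0 < r -> 0 <= B -> exists2 C, 0 <= C & forall h p q e,
  0 <= h <= 1 -> cls2 r p -> cls2 r q -> bd2 k.+1 B p -> bd2 k.+1 B q ->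
  bd2 k e (dif p q) -> bd2 k ((1 + C * h) * e) (dif (step h p) (step h q)).
Proof.
move=> r0 B0; have [C C0 H] := adv_lip k r B r0 B0.
exists C => // h p q e /andP[h0 h1] [c1 c2] [c1' c2'] [b1 b2] [b1' b2'] [d1 d2].
split; rewrite /=.
  by have := H h _ _ _ _ e _ c1 c2 c1' c2' b2 b1' b2' d1 d2; rewrite ger0_norm//; apply.
by have := H (- h) _ _ _ _ e _ c2 c1 c2' c1' b1 b2' b1' d2 d1; rewrite normrN ger0_norm//; apply.
Qed.

Lemma step_taylor k r B : 0 < r -> 0 <= B -> exists2 C, 0 <= C & forall h p,
  0 <= h <= 1 -> cls2 r p -> bd2 k.+2 B p ->
  bd2 k (C * h ^+ 2) (dif (dif (step h p) p) (scl h (nl2 p))).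
Proof.
move=> r0 B0; have [C C0 H] := adv_taylor k r B r0 B0; exists C => // h p /andP[h0 h1] [c1 c2] [b1 b2].
have lo (u : pl) : bd k.+2 B u -> bd k B u by apply: bd_mono; rewrite ?leqW.
split; rewrite /=.
  by have := H h _ _ _ c1 c2 b1 (lo _ b2); rewrite ger0_norm//; apply.
have := H (- h) _ _ _ c2 c1 b2 (lo _ b1); rewrite normrN ger0_norm// => /(_ h1).
by congr bd; apply/funext => x; apply/funext => y; rewrite mulrN mulNr.
Qed.

Lemma nl2_lip k r B : 0 < r -> 0 <= B -> exists2 C, 0 <= C & forall p q e,
  cls2 r p -> cls2 r q -> bd2 k.+1 B p -> bd2 k.+1 B q ->
  bd2 k.+1 e (dif p q) -> bd2 k (C * e) (dif (nl2 p) (nl2 q)).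
Proof.
move=> r0 B0; have [C C0 H] := nl_lip k r B r0 B0.
exists C => // p q e [c1 c2] [c1' c2'] [b1 b2] [b1' b2'] [d1 d2].
have lo (u : pl) (v : R) : bd k.+1 v u -> bd k v u by exact: bd_mono.
split; rewrite /=; first exact: (H _ _ _ _ e c1 c2 c1' c2' (lo _ _ b2) b1' d1 (lo _ _ d2)).
have := bd_scale _ _ _ (-1) (H _ _ _ _ e c2 c1 c2' c1' (lo _ _ b1) b2' d2 (lo _ _ d1)).
rewrite normrN1 mul1r; congr bd; apply/funext => x; apply/funext => y /=.
by rewrite mulN1r opprB addrC opprK.
Qed.

Lemma bd2_nl2 k r B : 0 < r -> 0 <= B -> exists2 C, 0 <= C & forall p,
  cls2 r p -> bd2 k.+1 B p -> bd2 k C (nl2 p).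
Proof.
move=> r0 B0; have [C C0 H] := bd_nl k r B r0 B0; exists C => // p [c1 c2] [b1 b2].
have lo (u : pl) (v : R) : bd k.+1 v u -> bd k v u by exact: bd_mono.
split; rewrite /=; first exact: H _ _ c1 c2 b1 (lo _ _ b2).
have := bd_scale _ _ _ (-1) (H _ _ c2 c1 b2 (lo _ _ b1)); rewrite normrN1 mul1r.
by congr bd; apply/funext => x; apply/funext => y; rewrite mulN1r.
Qed.

(** One full step and two half steps both expand as [p + h nl2 p + O(h^2)]; evaluating [nl2] at the
    midpoint instead of at [p] costs [O(h)], again multiplied by [h]. *)
Lemma step_half k r B : 0 < r -> 0 <= B -> exists2 C, 0 <= C & forall h p,
  0 <= h <= 1 -> cls2 r p -> cls2 r (step (h / 2) p) ->
  bd2 k.+2 B p -> bd2 k.+2 B (step (h / 2) p) ->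
  bd2 k (C * h ^+ 2) (dif (step h p) (step (h / 2) (step (h / 2) p))).
Proof.
move=> r0 B0; have [C1 C10 H1] := step_taylor k r B r0 B0.
have [C2 C20 H2] := nl2_lip k r B r0 B0; have [C3 C30 H3] := step_near k.+1 r B r0 B0.
exists (3 * C1 + C2 * C3); first by rewrite addr_ge0// mulr_ge0.
move=> h p /andP[h0 h1] cp cp1 bp bp1; set p1 := step (h / 2) p in cp1 bp1 *.
have hh : 0 <= h <= 1 by rewrite h0.
have h2 : 0 <= h / 2 <= 1.
  by rewrite divr_ge0//= (le_trans _ h1)// ler_pdivrMr// ler_peMr// ler1n.
have lo (u : pl * pl) : bd2 k.+2 B u -> bd2 k.+1 B u by exact: bd2_mono.
have X1 := H1 h p hh cp bp.
have X2 := H1 (h / 2) p h2 cp bp.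
have X3 := H1 (h / 2) p1 h2 cp1 bp1.
have X4 := bd2_scl _ _ (h / 2) _ (H2 p1 p _ cp1 cp (lo _ bp1) (lo _ bp) (H3 (h / 2) p h2 cp bp)).
have h20 : 0 <= h / 2 by case/andP: h2.
rewrite ger0_norm// in X4.
have hh2 : h / 2 <= h by have := norm_half h h0; rewrite ger0_norm.
have := bd2_dif _ _ _ _ _ (bd2_dif _ _ _ _ _ (bd2_dif _ _ _ _ _ X1 X2) X3) X4.
have E : dif (dif (dif (dif (dif (step h p) p) (scl h (nl2 p)))
     (dif (dif (step (h / 2) p) p) (scl (h / 2) (nl2 p))))
     (dif (dif (step (h / 2) p1) p1) (scl (h / 2) (nl2 p1))))
     (scl (h / 2) (dif (nl2 p1) (nl2 p))) = dif (step h p) (step (h / 2) p1).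
  rewrite -/p1 /dif /scl; congr pair; apply/funext => x; apply/funext => y /=.
    move: (adv h p.1 p.2 x y) (adv (h / 2) p.1 p.2 x y) (p.1 x y) (nl p.1 p.2 x y)
      (nl (adv (h / 2) p.1 p.2) (adv (- (h / 2)) p.2 p.1) x y)
      (adv (h / 2) (adv (h / 2) p.1 p.2) (adv (- (h / 2)) p.2 p.1) x y).
    by move=> a b c' d' e' f'; field.
  move: (adv (- h) p.2 p.1 x y) (adv (- (h / 2)) p.2 p.1 x y) (p.2 x y) (nl p.2 p.1 x y)
      (nl (adv (- (h / 2)) p.2 p.1) (adv (h / 2) p.1 p.2) x y)
      (adv (- (h / 2)) (adv (- (h / 2)) p.2 p.1) (adv (h / 2) p.1 p.2) x y).
  by move=> a b c' d' e' f'; field.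
rewrite E; apply: bd2_mono => //.
have q1 : (h / 2) ^+ 2 <= h ^+ 2 by rewrite ler_pXn2r ?nnegrE.
have q2 : h / 2 * (C2 * (C3 * (h / 2))) <= C2 * C3 * h ^+ 2.
  rewrite (_ : h / 2 * _ = C2 * C3 * (h / 2) ^+ 2); last by move: (h / 2) => t; ring.
  by rewrite ler_wpM2l// mulr_ge0.
have q3 : C1 * (h / 2) ^+ 2 <= C1 * h ^+ 2 by rewrite ler_wpM2l.
rewrite (_ : (3 * C1 + C2 * C3) * h ^+ 2 = C1 * h ^+ 2 + C1 * h ^+ 2 + C1 * h ^+ 2 + C2 * C3 * h ^+ 2); last by ring.
exact: (lerD (lerD (lerD (lexx _) q3) q3) q2).
Qed.

Section data.
Variables (p0 : pl * pl) (r0 : R).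
Hypotheses (r00 : 0 < r0) (cp0 : cls2 r0 p0).

Local Notation tim h n T := [/\ 0 < h, h <= 1 & h * n%:R <= T].

Lemma tim_pred h n T : tim h n.+1 T -> tim h n T.
Proof.
by case=> h0 h1 hT; split => //; apply: le_trans hT; rewrite ler_wpM2l ?(ltW h0)// ler_nat.
Qed.

(** Sup norms never increase, so the velocity is at most [20 * r * M] with fixed [M]. Being
    proportional to the current radius [r], it enlarges the support at most exponentially. *)
Lemma st_cls T : exists2 r, 0 < r & forall h n, tim h n T -> cls2 r (st h p0 n).
Proof.
have [[s1 _] [s2 _]] := cp0.
have [M1 M10 bM1] := sm_bd _ 0 s1; have [M2 M20 bM2] := sm_bd _ 0 s2.
pose M := M1 + M2.
have M0 : 0 <= M by rewrite addr_ge0.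
pose D := 20 * M.
have D0 : 0 <= D by rewrite mulr_ge0.
exists (r0 * expR (D * T)); first by rewrite mulr_gt0 ?expR_gt0.
have main h n : 0 < h -> h <= 1 -> cls2 (r0 * expR (D * (h * n%:R))) (st h p0 n) /\
    bd2 0 M (st h p0 n).
  move=> h0 h1; elim: n => [|n [[c1 c2] [b1 b2]]].
    rewrite !mulr0 expR0 mulr1; split => //; split; split => // x y.
      by apply: le_trans (bd_le0 _ _ _ bM1 x y) _; rewrite lerDl.
    by apply: le_trans (bd_le0 _ _ _ bM2 x y) _; rewrite lerDr.
  pose r := r0 * expR (D * (h * n%:R)).
  have rr : 0 < r by rewrite mulr_gt0 ?expR_gt0.
  have grow : r + h * (20 * r * M) <= r0 * expR (D * (h * n.+1%:R)).
    rewrite (_ : D * (h * n.+1%:R) = D * (h * n%:R) + D * h); last by rewrite -natr1; ring.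
    rewrite expRD [r0 * _]mulrA -/r (_ : r + _ = r * (1 + D * h)); last by rewrite /D; ring.
    exact: (ler_wpM2l (ltW rr) (expR_ge1Dx _)).
  have [[sf pf] [sg pg]] := (c1, c2).
  rewrite /st iterS -/(st h p0 n); split; last first.
    by split; split => // x y; apply: adv_le; [exact: bd_le0 b1 | exact: bd_le0 b2].
  split; split; rewrite /=.
  - exact: sm_adv c1 c2.
  - apply: supped_mono grow _; have := supped_adv h _ _ r r M c1 c2 rr pf (lexx _) (bd_le0 _ _ _ b2).
    by rewrite ger0_norm ?ltW.
  - exact: sm_adv c2 c1.
  - apply: supped_mono grow _; have := supped_adv (- h) _ _ r r M c2 c1 rr pg (lexx _) (bd_le0 _ _ _ b1).
    by rewrite normrN ger0_norm ?ltW.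
move=> h n [h0 h1 hT]; have [[[s1' q1] [s2' q2]] _] := main h n h0 h1.
have le : r0 * expR (D * (h * n%:R)) <= r0 * expR (D * T).
  by rewrite ler_wpM2l ?(ltW r00)// ler_expR ler_wpM2l.
by split; split => //; apply: supped_mono le _.
Qed.

Lemma st_sup : exists2 M, 0 <= M & forall h n, bd2 0 M (st h p0 n).
Proof.
have [[s1 _] [s2 _]] := cp0.
have [M1 M10 bM1] := sm_bd _ 0 s1; have [M2 M20 bM2] := sm_bd _ 0 s2.
exists (M1 + M2); first by rewrite addr_ge0.
move=> h; elim=> [|n [b1 b2]].
  split; split => // x y.
    by apply: le_trans (bd_le0 _ _ _ bM1 x y) _; rewrite lerDl.
  by apply: le_trans (bd_le0 _ _ _ bM2 x y) _; rewrite lerDr.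
rewrite /st iterS -/(st h p0 n).
by split; split => // x y; apply: adv_le; [exact: bd_le0 b1 | exact: bd_le0 b2].
Qed.

(** Induction on the order: the bound already known at order [k] fixes the constant [D] of the
    Osgood step at order [k + 1]. The result is independent of [h]. *)
Lemma st_bd T k : exists2 B, 0 <= B & forall h n, tim h n T -> bd2 k B (st h p0 n).
Proof.
have [r rr cT] := st_cls T.
elim: k => [|k [B B0 IH]].
  by have [M M0 H] := st_sup; exists M.
have [D D0 HD] := adv_growth k r B rr B0.
have [[s1 _] [s2 _]] := cp0.
have [M1 M10 bM1] := sm_bd _ k.+1 s1; have [M2 M20 bM2] := sm_bd _ k.+1 s2.
(* The summand 1 provides the [1 <= z] required by [adv_growth]. *)
pose z0 := 1 + M1 + M2.
have z01 : 1 <= z0 by rewrite /z0 -addrA lerDl addr_ge0.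
have Mz : M1 <= expR z0 /\ M2 <= expR z0.
  have := expR_ge1Dx z0; move: (expR z0) => E; rewrite /z0 => ?; split; lra.
exists (expR (z0 * expR (D * T))); first exact: expR_ge0.
have main h n : tim h n T -> bd2 k.+1 (expR (z0 * expR (D * (h * n%:R)))) (st h p0 n).
  elim: n => [|n IHn] th.
    rewrite !mulr0 expR0 mulr1.
    by split; [apply: bd_mono bM1 | apply: bd_mono bM2] => //; case: Mz.
  have th' := tim_pred _ _ _ th; have [h0 h1 hT] := th.
  have [b1 b2] := IHn th'; have [c1 c2] := cT _ _ th'; have [l1 l2] := IH _ _ th'.
  pose z := z0 * expR (D * (h * n%:R)).
  have z1 : 1 <= z.
    rewrite mulr_ege1// -expR0 ler_expR mulr_ge0//.
    by rewrite mulr_ge0// ltW.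
  have E : z0 * expR (D * (h * n.+1%:R)) = z * expR (D * h).
    by rewrite /z -mulrA -expRD; congr (_ * expR _); rewrite -natr1; ring.
  rewrite /st iterS -/(st h p0 n) E; split; rewrite /=.
    by apply: (HD h h _ _ z _ h1 z1 c1 c2 l1 l2 b1 b2); rewrite (ger0_norm (ltW h0)).
  by apply: (HD (- h) h _ _ z _ h1 z1 c2 c1 l2 l1 b2 b1); rewrite normrN (ger0_norm (ltW h0)).
move=> h n th; apply: bd2_mono (main h n th) => //.
by have [h0 h1 hT] := th; rewrite ler_expR ler_wpM2l ?(le_trans ler01 z01)// ler_expR ler_wpM2l.
Qed.

Lemma st_step T k : exists2 C, 0 <= C & forall h n, tim h n T ->
  bd2 k (C * h) (dif (st h p0 n.+1) (st h p0 n)).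
Proof.
have [r rr cT] := st_cls T; have [B B0 HB] := st_bd T k.+1.
have [C C0 H] := step_near k r B rr B0; exists C => // h n th.
by apply: H; [case: th => h0 -> _; rewrite ltW | exact: cT | exact: HB].
Qed.

Lemma st_lip T k : exists2 C, 0 <= C & forall h n l, tim h (n + l)%N T ->
  bd2 k (C * (h * l%:R)) (dif (st h p0 (n + l)) (st h p0 n)).
Proof.
have [C C0 H] := st_step T k; exists C => // h n; elim=> [|l IH] th.
  by rewrite addn0 !mulr0; exact: bd2_refl.
rewrite addnS in th *; have th' := tim_pred _ _ _ th.
have := bd2_tri _ _ _ _ _ _ (H _ _ th') (IH th').
by rewrite -mulrDr -[X in X + _]mulr1 -mulrDr [1 + _]addrC natr1.
Qed.

(** Each step adds a local error [O(h^2)] and a change of [nl2] by [O(h l)], weighted by [h]. Over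
    [l] steps this is [O((h l)^2)], uniformly in [h], and becomes the differential equation in the
    limit. *)
Lemma st_quad T k : exists2 C, 0 <= C & forall h n l, tim h (n + l)%N T ->
  bd2 k (C * (h * l%:R) ^+ 2)
    (dif (dif (st h p0 (n + l)) (st h p0 n)) (scl (h * l%:R) (nl2 (st h p0 n)))).
Proof.
have [r rr cT] := st_cls T; have [B B0 HB] := st_bd T k.+2.
have [C1 C10 H1] := step_taylor k r B rr B0.
have [C2 C20 H2] := nl2_lip k r B rr B0.
have [C3 C30 H3] := st_lip T k.+1.
pose C := C1 + C2 * C3; have CC : 0 <= C by rewrite addr_ge0// mulr_ge0.
exists C => // h n; elim=> [|l IH] th.
  rewrite addn0 !mulr0 expr0n mulr0.
  have := bd2_refl k (st h p0 n); congr bd2.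
  by congr pair; apply/funext => x; apply/funext => y /=; rewrite subrr mul0r subr0.
rewrite addnS in th *; have th' := tim_pred _ _ _ th; have [h0 h1 _] := th.
have hh : 0 <= h <= 1 by rewrite ltW.
have thn : tim h n T by elim: (l) th' => [|m I]; rewrite ?addn0 ?addnS// => /tim_pred.
have lo (u : pl * pl) : bd2 k.+2 B u -> bd2 k.+1 B u by exact: bd2_mono.
have X1 := H1 h _ hh (cT _ _ th') (HB _ _ th').
have X2 := bd2_scl _ _ h _ (H2 _ _ _ (cT _ _ th') (cT _ _ thn) (lo _ (HB _ _ th'))
  (lo _ (HB _ _ thn)) (H3 _ _ _ th')).
rewrite ger0_norm ?(ltW h0)// in X2.
have := bd2_dif _ _ _ _ _ (bd2_dif _ _ _ _ _ (IH th') (bd2_scl _ _ (-1) _ X1)) (bd2_scl _ _ (-1) _ X2).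
rewrite normrN1 !mul1r.
have -> : dif (dif (dif (dif (st h p0 (n + l)) (st h p0 n)) (scl (h * l%:R) (nl2 (st h p0 n))))
     (scl (-1) (dif (dif (step h (st h p0 (n + l))) (st h p0 (n + l))) (scl h (nl2 (st h p0 (n + l)))))))
     (scl (-1) (scl h (dif (nl2 (st h p0 (n + l))) (nl2 (st h p0 n))))) =
   dif (dif (st h p0 (n + l).+1) (st h p0 n)) (scl (h * l.+1%:R) (nl2 (st h p0 n))).
  rewrite [st h p0 (n + l).+1]/st iterS -/(st h p0 (n + l)) -natr1.
  move: (step h (st h p0 (n + l))) (nl2 (st h p0 (n + l))) (nl2 (st h p0 n)) (st h p0 (n + l))
     (st h p0 n) (l%:R : R) => a b c' d' e' w.
  by congr pair; apply/funext => x; apply/funext => y /=; ring.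
apply: bd2_mono => //.
rewrite -natr1; move: (l%:R : R) (ler0n R l) => w w0.
rewrite -subr_ge0 /C (_ : _ - _ = C1 * (2 * (h ^+ 2 * w)) + C2 * C3 * (h ^+ 2 * w + h ^+ 2)).
  have h20 : 0 <= h ^+ 2 := sqr_ge0 h; have hw : 0 <= h ^+ 2 * w := mulr_ge0 h20 w0.
  apply: addr_ge0; first by apply: mulr_ge0 => //; exact: mulr_ge0.
  by apply: mulr_ge0; [exact: mulr_ge0 | exact: addr_ge0].
ring.
Qed.

(** Discrete Gronwall: local errors [C1 * h ^+ 2], each amplified by at most [1 + C2 * h] per step,
    add up to [O(h)] on a bounded time interval. *)
Lemma st_half T k : exists2 C, 0 <= C & forall h n, tim h n T ->
  bd2 k (C * h) (dif (st h p0 n) (st (h / 2) p0 (n + n))).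
Proof.
have [r rr cT] := st_cls T; have [B B0 HB] := st_bd T k.+2.
have [C1 C10 H1] := step_half k r B rr B0.
have [C2 C20 H2] := step_lip k r B rr B0.
have [T0|T0] := leP 0 T; last first.
  exists 0 => // h n [h0 h1]; have : 0 <= h * n%:R by rewrite mulr_ge0// ltW.
  by move=> H /(le_trans H); rewrite leNgt T0.
have main h n : tim h n T ->
    bd2 k (C1 * h ^+ 2 * n%:R * expR (C2 * (h * n%:R))) (dif (st h p0 n) (st (h / 2) p0 (n + n))).
  elim: n => [|n IH] th; first by rewrite mulr0 mul0r; exact: bd2_refl.
  have th' := tim_pred _ _ _ th; have [h0 h1 hT] := th.
  have hh : 0 <= h <= 1 by rewrite ltW.
  have h2 : tim (h / 2) (n.+1 + n.+1)%N T.
    split; first by rewrite divr_gt0.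
      by rewrite (le_trans _ h1)// ler_pdivrMr// ler_peMr ?(ltW h0)// ler1n.
    by rewrite (_ : h / 2 * _ = h * n.+1%:R)//; rewrite natrD; move: (n.+1%:R : R) => w; field.
  rewrite addnS addSn in h2 *.
  have h2' := tim_pred _ _ _ h2; have h2'' := tim_pred _ _ _ h2'.
  have S2 : st (h / 2) p0 (n + n).+2 = step (h / 2) (step (h / 2) (st (h / 2) p0 (n + n))) by [].
  have S1 : st h p0 n.+1 = step h (st h p0 n) by [].
  have lo (u : pl * pl) : bd2 k.+2 B u -> bd2 k.+1 B u by exact: bd2_mono.
  rewrite S1 S2.
  have X := H2 h _ _ _ hh (cT _ _ th') (cT _ _ h2'') (lo _ (HB _ _ th')) (lo _ (HB _ _ h2'')) (IH th').
  have Y := H1 h (st (h / 2) p0 (n + n)) hh (cT _ _ h2'') (cT _ _ h2') (HB _ _ h2'') (HB _ _ h2').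
  apply: bd2_mono (bd2_tri _ _ _ _ _ _ X Y) => //.
  set a := C1 * h ^+ 2; have a0 : 0 <= a by rewrite mulr_ge0// sqr_ge0.
  have -> : C2 * (h * n.+1%:R) = C2 * h + C2 * (h * n%:R) by rewrite -natr1; ring.
  rewrite expRD -natr1.
  have e1 := expR_ge1Dx (C2 * h).
  have e2 : 1 <= expR (C2 * (h * n%:R)).
    by rewrite -expR0 ler_expR mulr_ge0// mulr_ge0// ltW.
  have Ch : 0 <= C2 * h by rewrite mulr_ge0// ltW.
  move: (expR (C2 * h)) (expR (C2 * (h * n%:R))) e1 e2 => E F e1 e2.
  move: (n%:R : R) (ler0n R n) => w w0.
  have E1 : 1 <= E by apply: le_trans e1; rewrite lerDl.
  rewrite (_ : a * (w + 1) * (E * F) = a * w * F * E + a * (E * F)); last by ring.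
  have awF : 0 <= a * w * F := mulr_ge0 (mulr_ge0 a0 w0) (le_trans ler01 e2).
  apply: lerD; first by rewrite mulrC; exact: (ler_wpM2l awF e1).
  by rewrite ler_peMr// mulr_ege1.
exists (C1 * T * expR (C2 * T)); first by rewrite mulr_ge0 ?expR_ge0// mulr_ge0.
move=> h n th; have [h0 h1 hT] := th; apply: bd2_mono (main h n th) => //.
have hn0 : 0 <= h * n%:R by rewrite mulr_ge0// ltW.
rewrite (_ : C1 * h ^+ 2 * n%:R * _ = C1 * (h * n%:R) * expR (C2 * (h * n%:R)) * h); last first.
  by move: (expR _) => E; ring.
apply: (ler_wpM2r (ltW h0)).
have u1 : C1 * (h * n%:R) <= C1 * T := ler_wpM2l C10 hT.
have u2 : expR (C2 * (h * n%:R)) <= expR (C2 * T) by rewrite ler_expR ler_wpM2l.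
exact: (ler_pM (mulr_ge0 C10 hn0) (expR_ge0 _) u1 u2).
Qed.

End data.
End iteration.

(** * Characteristics of the scheme *)

Section characteristics.
Context {R : realType}.
Local Notation pl := (R -> R -> R).

(* Backward characteristics of the scheme stay [O((h n)^2)]-close to straight lines. *)
Lemma adv_char (f g : nat -> pl) (c h C1 C2 L C : R) :
  0 <= h -> `|c| = h -> 0 <= C1 -> 0 <= C2 -> 0 <= L -> C1 + 2 * L * C2 <= C ->
  (forall n, f n.+1 = adv c (f n) (g n)) ->
  (forall n i x y, h * n%:R <= 1 -> `|U i (g n) x y - U i (g 0%N) x y| <= C1 * (h * n%:R)) ->
  (forall n i x y, h * n%:R <= 1 -> `|U i (g n) x y| <= C2) ->
  (forall i x y p q, `|U i (g 0%N) (x + p) (y + q) - U i (g 0%N) x y| <= L * (`|p| + `|q|)) ->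
  forall n x y, h * n%:R <= 1 -> exists u v, [/\ f n x y = f 0%N u v,
    `|u - x - n%:R * c * U false (g 0%N) x y| <= C * (h * n%:R) ^+ 2 &
    `|v - y - n%:R * c * U true (g 0%N) x y| <= C * (h * n%:R) ^+ 2].
Proof.
move=> h0 ch C10 C20 L0 CC fS gC1 gC2 gL; elim=> [|n IH] x y hn.
  by exists x, y; rewrite !subrr !mul0r !subrr normr0 mulr0 expr0n mulr0.
have hn' : h * n%:R <= 1 by apply: le_trans hn; rewrite ler_wpM2l// ler_nat.
pose p := c * U false (g n) x y; pose q := c * U true (g n) x y.
have [u [v [E E1 E2]]] := IH (x + p) (y + q) hn'.
exists u, v.
have pB : `|p| <= h * C2 by rewrite normrM ch ler_wpM2l// gC2.
have qB : `|q| <= h * C2 by rewrite normrM ch ler_wpM2l// gC2.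
(* A step adds the drift of the velocity in time, [C1 h^2 n], and in space, [2 L C2 h^2 n]. Both fit
   into the increase of [C (h n)^2], which is [C h^2 (2 n + 1)]. *)
have key i z w : `|w - (z + c * U i (g n) x y) - n%:R * c * U i (g 0%N) (x + p) (y + q)| <= C * (h * n%:R) ^+ 2 ->
    `|w - z - n.+1%:R * c * U i (g 0%N) x y| <= C * (h * n.+1%:R) ^+ 2.
  move=> H.
  have D1 : `|c * (U i (g n) x y - U i (g 0%N) x y)| <= h * (C1 * (h * n%:R)).
    by rewrite normrM ch ler_wpM2l// gC1.
  have D2 : `|n%:R * c * (U i (g 0%N) (x + p) (y + q) - U i (g 0%N) x y)| <= n%:R * h * (L * (h * C2 + h * C2)).
    rewrite !normrM ch ger0_norm// ler_pM ?mulr_ge0//.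
    by apply: le_trans (gL _ _ _ _ _) _; rewrite ler_wpM2l// lerD.
  have -> : w - z - n.+1%:R * c * U i (g 0%N) x y =
    (w - (z + c * U i (g n) x y) - n%:R * c * U i (g 0%N) (x + p) (y + q)) +
    (c * (U i (g n) x y - U i (g 0%N) x y) +
     n%:R * c * (U i (g 0%N) (x + p) (y + q) - U i (g 0%N) x y)).
    rewrite -natr1; move: (U i (g n) x y) (U i (g 0%N) x y) (U i (g 0%N) (x + p) (y + q)) => a b e.
    by ring.
  apply: le_trans (ler_normD _ _) _; apply: le_trans (lerD H (ler_normD _ _)) _.
  apply: le_trans (lerD (lexx _) (lerD D1 D2)) _.
  rewrite -natr1; move: (n%:R : R) (ler0n R n) => m m0.
  rewrite -subr_ge0 (_ : _ - _ = (C - (C1 + 2 * L * C2)) * (h ^+ 2 * m) + C * (h ^+ 2 * m + h ^+ 2)).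
    have a1 : 0 <= h ^+ 2 * m := mulr_ge0 (sqr_ge0 h) m0.
    have C0 : 0 <= C.
      apply: le_trans CC; apply: addr_ge0 => //; apply: mulr_ge0 => //; exact: mulr_ge0.
    by apply: addr_ge0; apply: mulr_ge0; rewrite ?subr_ge0// addr_ge0// sqr_ge0.
  by ring.
split; first by rewrite fS.
- exact: key E1.
- exact: key E2.
Qed.

End characteristics.

(** * The limit of the dyadic schemes for nonnegative times *)

Section solution.
Context {R : realType}.
Local Notation pl := (R -> R -> R).
Implicit Types (t s T : R) (n k : nat) (p q : pl * pl).
Variables (p0 : pl * pl) (r0 : R).
Hypotheses (r00 : 0 < r0) (cp0 : cls2 r0 p0).

Definition idx t n := Num.truncn (t * 2 ^+ n).
Definition traj t n := st (2 ^+ n)^-1 p0 (idx t n).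
Definition sol t : pl * pl := (flim (fun n => (traj t n).1), flim (fun n => (traj t n).2)).

Lemma half_pow n : 0 < (2 ^+ n)^-1 :> R /\ (2 ^+ n)^-1 <= 1 :> R.
Proof.
split; first by rewrite invr_gt0 exprn_gt0.
by rewrite invf_le1 ?exprn_gt0// exprn_ege1// ler1n.
Qed.

Lemma idx_le t n : 0 <= t -> (2 ^+ n)^-1 * (idx t n)%:R <= t.
Proof.
move=> t0; rewrite mulrC ler_pdivrMr ?exprn_gt0//.
by have /andP[] := truncn_itv (mulr_ge0 t0 (exprn_ge0 n (ler0n R 2))).
Qed.

Lemma idx_gt t n : 0 <= t -> t <= (2 ^+ n)^-1 * (idx t n)%:R + (2 ^+ n)^-1.
Proof.
move=> t0; rewrite -[X in _ + X]mulr1 -mulrDr natr1 mulrC ler_pdivlMr ?exprn_gt0//.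
by have /andP[_ /ltW] := truncn_itv (mulr_ge0 t0 (exprn_ge0 n (ler0n R 2))).
Qed.

Lemma tim_idx t T n : 0 <= t <= T ->
  [/\ 0 < (2 ^+ n)^-1 :> R, (2 ^+ n)^-1 <= 1 :> R & (2 ^+ n)^-1 * (idx t n)%:R <= T].
Proof.
move=> /andP[t0 tT]; have [a b] := half_pow n; split => //.
exact: le_trans (idx_le t n t0) tT.
Qed.

(** Halving the step doubles the number of steps up to one additional half step, which changes the
    iterate by [O(2^-n)]. Hence [traj t n] converges at every [t], dyadic or not. *)
Lemma idxS t n : 0 <= t ->
  idx t n.+1 = (idx t n + idx t n)%N \/ idx t n.+1 = (idx t n + idx t n).+1.
Proof.
move=> t0.
have /andP[a1 a2] := truncn_itv (mulr_ge0 t0 (exprn_ge0 n (ler0n R 2))).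
have /andP[b1 b2] := truncn_itv (mulr_ge0 t0 (exprn_ge0 n.+1 (ler0n R 2))).
rewrite -/(idx t n) in a1 a2; rewrite -/(idx t n.+1) in b1 b2.
have E : t * 2 ^+ n.+1 = t * 2 ^+ n + t * 2 ^+ n by rewrite exprS; move: (2 ^+ n) => w; ring.
rewrite E in b1 b2.
have c1 : (idx t n + idx t n < (idx t n.+1).+1)%N.
  by rewrite -(ltr_nat R) natrD; apply: le_lt_trans b2; exact: lerD.
have c2 : (idx t n.+1 < (idx t n).+1 + (idx t n).+1)%N.
  by rewrite -(ltr_nat R) natrD; apply: (le_lt_trans b1); exact: ltrD.
rewrite addSn addnS !ltnS in c1 c2.
move: c2; rewrite leq_eqVlt ltnS => /predU1P[->|c2]; [by right | left].
by apply/eqP; rewrite eqn_leq c2 c1.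
Qed.

Lemma traj_cauchy T k : exists2 C, 0 <= C & forall t n, 0 <= t <= T ->
  bd2 k (C / 2 ^+ n) (dif (traj t n.+1) (traj t n)).
Proof.
have [C1 C10 H1] := st_half p0 r0 r00 cp0 T k.
have [C2 C20 H2] := st_step p0 r0 r00 cp0 T k.
exists (C1 + C2); first exact: addr_ge0.
move=> t n tT; have t0 : 0 <= t by case/andP: tT.
have th := tim_idx t T n tT; have th' := tim_idx t T n.+1 tT.
have [h0 _] := half_pow n.
have hh : (2 ^+ n.+1)^-1 = (2 ^+ n)^-1 / 2 :> R by rewrite exprS invfM mulrC.
have X := bd2_sym _ _ _ _ (H1 _ _ th); rewrite -hh in X.
have le1 : C1 * (2 ^+ n)^-1 <= (C1 + C2) / 2 ^+ n.
  by rewrite ler_wpM2r ?(ltW h0)// lerDl.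
rewrite /traj; have [e|e] := idxS t n t0; rewrite e; first exact: bd2_mono X.
rewrite e in th'; have := bd2_tri _ _ _ _ _ _ (H2 _ _ (tim_pred _ _ _ th')) X.
apply: bd2_mono => //; rewrite [in leRHS]mulrDl addrC lerD2l ler_wpM2l//.
by rewrite hh ler_pdivrMr// ler_peMr ?(ltW h0)// ler1n.
Qed.

Lemma traj_sm t n : 0 <= t -> sm (traj t n).1 /\ sm (traj t n).2.
Proof.
move=> t0; have [r rr H] := st_cls p0 r0 r00 cp0 t.
have tt : 0 <= t <= t by rewrite t0 lexx.
by have [[? _] [? _]] := H _ _ (tim_idx t t n tt).
Qed.

Lemma traj_geo t l : 0 <= t ->
  (exists D, forall n, bd l (D / 2 ^+ n) (fun x y => (traj t n.+1).1 x y - (traj t n).1 x y)) /\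
  (exists D, forall n, bd l (D / 2 ^+ n) (fun x y => (traj t n.+1).2 x y - (traj t n).2 x y)).
Proof.
move=> t0; have [C C0 H] := traj_cauchy t l.
have tt : 0 <= t <= t by rewrite t0 lexx.
by split; exists C => n; have [] := H t n tt.
Qed.

Lemma sol_near T k : exists2 C, 0 <= C & forall t n, 0 <= t <= T ->
  bd2 k (C / 2 ^+ n) (dif (sol t) (traj t n)).
Proof.
have [C C0 H] := traj_cauchy T k; exists (2 * C); first exact: mulr_ge0.
move=> t n tT; have t0 : 0 <= t by case/andP: tT.
split; rewrite /=; apply: bd_flim.
- by move=> m; have [] := traj_sm t m t0.
- by move=> l; have [] := traj_geo t l t0.
- by move=> m; have [] := H t m tT.
- by move=> m; have [] := traj_sm t m t0.
- by move=> l; have [] := traj_geo t l t0.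
- by move=> m; have [] := H t m tT.
Qed.

Lemma supped_flim (r : R) (F : nat -> pl) : (forall n, supped r (F n)) -> supped r (flim F).
Proof.
move=> H x y.
have [/orP out|] := boolP ((r < `|x|) || (r < `|y|)); last first.
  by rewrite negb_or -!leNgt => /andP[].
rewrite /flim (_ : (fun n => F n x y) = fun=> 0) ?lim_cst ?eqxx//.
by apply/funext => n; apply: supped0 (H n) _; apply/orP.
Qed.

Lemma sol_cls T : exists2 r, 0 < r & forall t, 0 <= t <= T -> cls2 r (sol t).
Proof.
have [r rr H] := st_cls p0 r0 r00 cp0 T; exists r => // t tT.
have t0 : 0 <= t by case/andP: tT.
split; split.
- by apply: sm_flim => [m|l]; [have [] := traj_sm t m t0 | have [] := traj_geo t l t0].
- by apply: supped_flim => n; have [[] ] := H _ _ (tim_idx t T n tT).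
- by apply: sm_flim => [m|l]; [have [] := traj_sm t m t0 | have [] := traj_geo t l t0].
- by apply: supped_flim => n; have [_ []] := H _ _ (tim_idx t T n tT).
Qed.

Lemma bd2_of_dif k (e e' : R) p q : bd2 k e (dif p q) -> bd2 k e' q -> bd2 k (e + e') p.
Proof.
move=> [b1 b2] [b1' b2']; split; [have := bd_add _ _ _ _ _ b1 b1' | have := bd_add _ _ _ _ _ b2 b2'];
  by congr bd; apply/funext => x; apply/funext => y /=; rewrite subrK.
Qed.

Lemma sol_bd T k : exists2 B, 0 <= B & forall t, 0 <= t <= T -> bd2 k B (sol t).
Proof.
have [C C0 H] := sol_near T k; have [B B0 HB] := st_bd p0 r0 r00 cp0 T k.
exists (C + B) => [|t tT]; first exact: addr_ge0.
have := bd2_of_dif _ _ _ _ _ (H t 0%N tT) (HB _ _ (tim_idx t T 0%N tT)).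
by rewrite expr0 divr1.
Qed.

Lemma bd2_lim k (M K : R) p : 0 <= K -> (forall n, bd2 k (M + K / 2 ^+ n) p) -> bd2 k M p.
Proof.
move=> K0 H; split; apply: bd_lim => e e0.
  have [n hn] := half_small (e / (K + 1)) (divr_gt0 e0 (ltr_wpDl K0 ltr01)).
  have [b _] := H n; apply: bd_mono b => //; rewrite lerD2l.
  have [h0 _] := half_pow n.
  move: hn; rewrite ltr_pdivlMr ?ltr_wpDl// => /ltW; apply: le_trans.
  by rewrite mulrC ler_wpM2l ?(ltW h0)// lerDl.
have [n hn] := half_small (e / (K + 1)) (divr_gt0 e0 (ltr_wpDl K0 ltr01)).
have [_ b] := H n; apply: bd_mono b => //; rewrite lerD2l.
have [h0 _] := half_pow n.
move: hn; rewrite ltr_pdivlMr ?ltr_wpDl// => /ltW; apply: le_trans.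
by rewrite mulrC ler_wpM2l ?(ltW h0)// lerDl.
Qed.

(** [st_quad] at level [n] has the right form up to errors [O(2^-n)]: the distance to the limit at
    [t] and at [s], the rounding of [t - s] to the grid, and the distance between the values of
    [nl2]. [bd2_lim] removes them. *)
Lemma sol_quad T k : exists2 C, 0 <= C & forall s t, 0 <= s -> s <= t -> t <= T ->
  bd2 k (C * (t - s) ^+ 2) (dif (dif (sol t) (sol s)) (scl (t - s) (nl2 (sol s)))).
Proof.
have [T0|T0] := leP 0 T; last first.
  exists 0 => // s t s0 st' tT.
  by move: (le_trans s0 (le_trans st' tT)); rewrite leNgt T0.
have [r rr cT] := sol_cls T; have [r' rr' cT'] := st_cls p0 r0 r00 cp0 T.
pose q := r + r'.
have q0 : 0 < q by rewrite addr_gt0.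
have [B1 B10 HB1] := sol_bd T k.+1; have [B2 B20 HB2] := st_bd p0 r0 r00 cp0 T k.+1.
pose B := B1 + B2.
have B0 : 0 <= B by rewrite addr_ge0.
have [Q Q0 HQ] := st_quad p0 r0 r00 cp0 T k.
have [N N0 HN] := sol_near T k.+1.
have [L L0 HL] := nl2_lip k q B q0 B0.
have [D D0 HD] := bd2_nl2 k q B q0 B0.
exists Q => // s t s0 st' tT.
have t0 : 0 <= t := le_trans s0 st'.
have hs : 0 <= s <= T by rewrite s0 (le_trans st' tT).
have ht : 0 <= t <= T by rewrite t0.
have ts0 : 0 <= t - s by rewrite subr_ge0.
have tsT : t - s <= T by rewrite lerBlDr (le_trans tT)// lerDl.
have clsq (u : R) (v : pl * pl) : u <= q -> cls2 u v -> cls2 q v.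
  by move=> uq [[a b] [c' d']]; split; split => //; exact: supped_mono uq _.
apply: (bd2_lim _ _ (N + N + Q * (2 * T + 1) + D + T * (L * N))).
  by rewrite !addr_ge0// mulr_ge0// ?addr_ge0// mulr_ge0.
move=> n; pose h : R := (2 ^+ n)^-1; have [h0 h1] := half_pow n; rewrite -/h in h0 h1.
have [m Em] : exists m, idx t n = (idx s n + m)%N.
  exists (idx t n - idx s n)%N; rewrite subnKC// /idx; apply: le_truncn.
  by rewrite ler_wpM2r ?exprn_ge0.
have thT := tim_idx t T n ht.
have X3 := HQ h (idx s n) m; rewrite -Em in X3; have {}X3 := X3 thT.
rewrite -/h in thT.
have X1 := HN t n ht; have X2 := HN s n hs.
rewrite -/(traj s n) -/(traj t n) in X3.
have cs : cls2 q (sol s) by apply: clsq (cT s hs) => //; rewrite lerDl ltW.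
have cj : cls2 q (traj s n) by apply: clsq (cT' _ _ (tim_idx s T n hs)) => //; rewrite lerDr ltW.
have bs : bd2 k.+1 B (sol s) by apply: bd2_mono (HB1 s hs) => //; rewrite lerDl.
have bj : bd2 k.+1 B (traj s n) by apply: bd2_mono (HB2 _ _ (tim_idx s T n hs)) => //; rewrite lerDr.
have X4 := bd2_scl _ _ (h * m%:R - (t - s)) _ (HD _ cj bj).
have X5 := bd2_scl _ _ (t - s) _ (HL _ _ _ cj cs bj bs (bd2_sym _ _ _ _ X2)).
have lo (e : R) (p : pl * pl) : bd2 k.+1 e p -> bd2 k e p by exact: bd2_mono.
have := bd2_dif _ _ _ _ _ (bd2_dif _ _ _ _ _ (bd2_dif _ _ _ _ _ (bd2_dif _ _ _ _ _
  (lo _ _ X1) (lo _ _ X2)) (bd2_scl _ _ (-1) _ X3)) (bd2_scl _ _ (-1) _ X4)) (bd2_scl _ _ (-1) _ X5).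
have -> : dif (dif (dif (dif (dif (sol t) (traj t n)) (dif (sol s) (traj s n)))
  (scl (-1) (dif (dif (traj t n) (traj s n)) (scl (h * m%:R) (nl2 (traj s n))))))
  (scl (-1) (scl (h * m%:R - (t - s)) (nl2 (traj s n)))))
  (scl (-1) (scl (t - s) (dif (nl2 (traj s n)) (nl2 (sol s))))) =
  dif (dif (sol t) (sol s)) (scl (t - s) (nl2 (sol s))).
  move: (sol t) (sol s) (traj t n) (traj s n) (nl2 (traj s n)) (nl2 (sol s)) (h * m%:R) (t - s).
  move=> a b c' d' e f w u.
  by congr pair; apply/funext => x; apply/funext => y /=; ring.
apply: bd2_mono => //.
rewrite normrN1 !mul1r (ger0_norm ts0).
have w0 : 0 <= h * m%:R by rewrite mulr_ge0// ltW.
have [wb1 wb2] : h * m%:R <= t - s + h /\ t - s - h <= h * m%:R.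
  have := idx_le t n t0; have := idx_gt t n t0; have := idx_le s n s0; have := idx_gt s n s0.
  rewrite -/h Em natrD mulrDr.
  by move: (h * m%:R) (h * _) h0 => a b e *; split; lra.
have wn : `|h * m%:R - (t - s)| <= h by rewrite ler_distl; apply/andP; split; lra.
move: (h * m%:R) w0 wb1 wb2 wn => w w0 wb1 wb2 wn.
rewrite -/h.
have G1 : Q * w ^+ 2 <= Q * (t - s) ^+ 2 + Q * (2 * T + 1) * h.
  rewrite -mulrA -mulrDr ler_wpM2l//.
  apply: (@le_trans _ _ ((t - s + h) ^+ 2)).
    by rewrite ler_pXn2r ?nnegrE// addr_ge0// ltW.
  rewrite -subr_ge0 (_ : _ - _ = 2 * (T - (t - s)) * h + (1 - h) * h); last by ring.
  by apply: addr_ge0; apply: mulr_ge0; rewrite ?(ltW h0) ?mulr_ge0 ?subr_ge0.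
have G2 : `|w - (t - s)| * D <= D * h by rewrite mulrC ler_wpM2l.
have G3 : (t - s) * (L * (N * h)) <= T * (L * N) * h.
  by rewrite -(mulrA T) -(mulrA L) ler_wpM2r// !mulr_ge0// ltW.
rewrite (_ : Q * (t - s) ^+ 2 + (N + N + Q * (2 * T + 1) + D + T * (L * N)) * h =
  N * h + N * h + (Q * (t - s) ^+ 2 + Q * (2 * T + 1) * h) + D * h + T * (L * N) * h); last by ring.
exact: (lerD (lerD (lerD (lexx _) G1) G2) G3).
Qed.

Lemma sol0 : sol 0 = p0.
Proof.
have E n : traj 0 n = p0 by rewrite /traj /idx mul0r truncn0.
by rewrite /sol [RHS]surjective_pairing; congr pair; apply/funext => x; apply/funext => y;
  rewrite /flim; under eq_fun do rewrite E; rewrite lim_cst.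
Qed.

(** Characteristics are followed at a level [n] chosen from [e], so the foot point [(u, v)] depends
    on [e]. Approximate equality of the values is enough to decide where the solution vanishes. *)
Lemma sol_char : exists2 C, 0 <= C & forall t x y e, 0 <= t <= 1 -> 0 < e ->
  (exists u v, [/\ `|p0.1 u v - (sol t).1 x y| <= e,
     `|u - x - t * U false p0.2 x y| <= C * t ^+ 2 + e &
     `|v - y - t * U true p0.2 x y| <= C * t ^+ 2 + e]) /\
  (exists u v, [/\ `|p0.2 u v - (sol t).2 x y| <= e,
     `|u - x + t * U false p0.1 x y| <= C * t ^+ 2 + e &
     `|v - y + t * U true p0.1 x y| <= C * t ^+ 2 + e]).
Proof.
have [r rr cT] := st_cls p0 r0 r00 cp0 1.
have [B B0 HB] := st_bd p0 r0 r00 cp0 1 1.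
have [D D0 HD] := st_lip p0 r0 r00 cp0 1 0.
have [N N0 HN] := sol_near 1 0.
pose C1 := 20 * r * D; pose C2 := 20 * r * B; pose C := C1 + 2 * C2 * C2.
have r20 : 0 <= 20 * r by rewrite mulr_ge0// ltW.
have C10 : 0 <= C1 by exact: mulr_ge0.
have C20 : 0 <= C2 by exact: mulr_ge0.
have CC : 0 <= C by rewrite addr_ge0// mulr_ge0// mulr_ge0.
exists C => // t x y e t01 e0; have t0 : 0 <= t by case/andP: t01.
(* [N] accounts for the distance between scheme and limit, [C2] for the displacement during the time
   lost by rounding [t] to the grid. *)
pose K := N + C2 + 1.
have K0 : 0 < K by rewrite /K ltr_wpDl// addr_ge0.
have [n hn] := half_small (e / K) (divr_gt0 e0 K0).
pose h : R := (2 ^+ n)^-1; have [h0 h1] := half_pow n; rewrite -/h in h0 h1 hn.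
have tm m : h * m%:R <= 1 -> [/\ 0 < h, h <= 1 & h * m%:R <= 1] by [].
have z0 : h * 0%:R <= 1 by rewrite mulr0 ler01.
have [[s1 p1] [s2 p2]] := cT h 0%N (tm _ z0); have [b1 b2] := HB h 0%N (tm _ z0).
have K1 m i x' y' (m1 : h * m%:R <= 1) :
  `|U i (st h p0 m).1 x' y' - U i p0.1 x' y'| <= C1 * (h * m%:R) /\
  `|U i (st h p0 m).2 x' y' - U i p0.2 x' y'| <= C1 * (h * m%:R).
  have [[sa pa] [sb pb]] := cT h m (tm _ m1).
  have [d1 d2] := HD h 0%N m (tm _ m1); rewrite add0n in d1 d2.
  split.
    have := U_sub i _ _ r sa s1 pa p1 => /(congr1 (fun F : pl => F x' y')) /= <-.
    rewrite -mulrA; apply: U_bound => //; [exact: sm_sub | exact: supped_sub | exact: bd_le0 d1].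
  have := U_sub i _ _ r sb s2 pb p2 => /(congr1 (fun F : pl => F x' y')) /= <-.
  rewrite -mulrA; apply: U_bound => //; [exact: sm_sub | exact: supped_sub | exact: bd_le0 d2].
have K2 m i x' y' (m1 : h * m%:R <= 1) :
    `|U i (st h p0 m).1 x' y'| <= C2 /\ `|U i (st h p0 m).2 x' y'| <= C2.
  have [[sa pa] [sb pb]] := cT h m (tm _ m1); have [ba bb] := HB h m (tm _ m1).
  by split; apply: U_bound => //; [exact: bd_le0 ba | exact: bd_le0 bb].
have K3 i x' y' a b :
    `|U i p0.1 (x' + a) (y' + b) - U i p0.1 x' y'| <= C2 * (`|a| + `|b|) /\
    `|U i p0.2 (x' + a) (y' + b) - U i p0.2 x' y'| <= C2 * (`|a| + `|b|).
  split; first exact: (bd_lip 0 _ _ _ _ _ _ (bd_U 1 i _ r B s1 p1 rr b1)).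
  exact: (bd_lip 0 _ _ _ _ _ _ (bd_U 1 i _ r B s2 p2 rr b2)).
pose m := idx t n.
have m1 : h * m%:R <= 1 by have [] := tim_idx t 1 n t01.
have hm : `|h * m%:R - t| <= h.
  rewrite ler_distl; have := idx_le t n t0; have := idx_gt t n t0; rewrite -/h -/m.
  by move: (h * m%:R) h0 => w *; apply/andP; split; lra.
have hmt : h * m%:R <= t := idx_le t n t0.
have he : (N + C2) * h <= e.
  move: hn; rewrite ltr_pdivlMr// => /ltW; apply: le_trans.
  by rewrite mulrC ler_wpM2l ?(ltW h0)// lerDl.
have Nh : N * h <= e by apply: le_trans he; rewrite ler_wpM2r ?(ltW h0)// lerDl.
have Ch : C2 * h <= e by apply: le_trans he; rewrite ler_wpM2r ?(ltW h0)// lerDr.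
have sq : C * (h * m%:R) ^+ 2 <= C * t ^+ 2.
  by rewrite ler_wpM2l// ler_pXn2r ?nnegrE// mulr_ge0// ltW.
have [n1 n2] := HN t n t01.
have close (w z a : R) : `|w - z| <= C * (h * m%:R) ^+ 2 -> `|a| <= h * C2 ->
    `|w - (z + a)| <= C * t ^+ 2 + e.
  move=> H1 H2; rewrite opprD addrA; apply: le_trans (ler_normB _ _) (lerD (le_trans H1 sq) _).
  by apply: le_trans H2 _; rewrite mulrC.
have diffU i (f : pl) : `|U i f x y| <= C2 -> `|(t - h * m%:R) * U i f x y| <= h * C2.
  by move=> H; rewrite normrM ler_pM// distrC.
split.
  have [u [v [E E1 E2]]] := @adv_char R (fun n => (st h p0 n).1) (fun n => (st h p0 n).2) h h
     C1 C2 C2 C (ltW h0) (ger0_norm (ltW h0)) C10 C20 C20 (lexx _) (fun n => erefl)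
     (fun m i x y H => (K1 m i x y H).2) (fun m i x y H => (K2 m i x y H).2)
     (fun i x y a b => (K3 i x y a b).2) m x y m1.
  exists u, v; split.
  - have := bd_le0 _ _ _ n1 x y; rewrite /= -[flim _ x y]/((sol t).1 x y) -/(traj t n).
    by rewrite -[(traj t n).1]/((st h p0 m).1) E distrC => /le_trans; apply.
  - have := close _ _ _ E1 (diffU false _ (K2 0%N false x y z0).2).
    by rewrite (_ : m%:R * h * _ + _ = t * U false p0.2 x y)//=; move: (U _ _ _ _) => w; ring.
  - have := close _ _ _ E2 (diffU true _ (K2 0%N true x y z0).2).
    by rewrite (_ : m%:R * h * _ + _ = t * U true p0.2 x y)//=; move: (U _ _ _ _) => w; ring.
have hN : `|- h| = h by rewrite normrN (ger0_norm (ltW h0)).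
have [u [v [E E1 E2]]] := @adv_char R (fun n => (st h p0 n).2) (fun n => (st h p0 n).1) (- h) h
     C1 C2 C2 C (ltW h0) hN C10 C20 C20 (lexx _) (fun n => erefl)
     (fun m i x y H => (K1 m i x y H).1) (fun m i x y H => (K2 m i x y H).1)
     (fun i x y a b => (K3 i x y a b).1) m x y m1.
have diffU' i : `|(h * m%:R - t) * U i p0.1 x y| <= h * C2.
  by rewrite normrM ler_pM//; exact: (K2 0%N i x y z0).1.
exists u, v; split.
- have := bd_le0 _ _ _ n2 x y; rewrite /= -[flim _ x y]/((sol t).2 x y) -/(traj t n).
  by rewrite -[(traj t n).2]/((st h p0 m).2) E distrC => /le_trans; apply.
- have := close _ _ _ E1 (diffU' false).
  rewrite (_ : m%:R * - h * _ + _ = - (t * U false p0.1 x y)) ?opprK//=.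
  by move: (U _ _ _ _) => w; ring.
- have := close _ _ _ E2 (diffU' true).
  rewrite (_ : m%:R * - h * _ + _ = - (t * U true p0.1 x y)) ?opprK//=.
  by move: (U _ _ _ _) => w; ring.
Qed.

End solution.

(** * Two-sided times and smoothness in space-time *)

Section two_sided.
Context {R : realType}.
Local Notation pl := (R -> R -> R).
Implicit Types (t s T : R) (n k : nat) (p q : pl * pl).
Variables (p0 : pl * pl) (r0 : R).
Hypotheses (r00 : 0 < r0) (cp0 : cls2 r0 p0).

Definition sw p : pl * pl := (p.2, p.1).

Lemma cls2_sw r p : cls2 r p -> cls2 r (sw p).
Proof. by case. Qed.

Lemma bd2_sw k e p : bd2 k e p -> bd2 k e (sw p).
Proof. by case. Qed.

(* Exchanging the two components reverses time. *)
Definition full t : pl * pl := if 0 <= t then sol p0 t else sw (sol (sw p0) (- t)).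

Lemma full_ge0 t : 0 <= t -> full t = sol p0 t.
Proof. by rewrite /full => ->. Qed.

Lemma full_le0 t : t <= 0 -> full t = sw (sol (sw p0) (- t)).
Proof.
rewrite le_eqVlt => /predU1P[->|t0]; last by rewrite /full leNgt t0.
rewrite full_ge0// oppr0 !sol0.
by rewrite /sw /= -surjective_pairing.
Qed.

Lemma full_cls T : exists2 r, 0 < r & forall t, `|t| <= T -> cls2 r (full t).
Proof.
have [r1 r10 H1] := sol_cls p0 r0 r00 cp0 T.
have [r2 r20 H2] := sol_cls (sw p0) r0 r00 (cls2_sw _ _ cp0) T.
have mo r p : cls2 r p -> r <= r1 + r2 -> cls2 (r1 + r2) p.
  by move=> [[a b] [c e]] rr; split; split => //; exact: supped_mono rr _.
exists (r1 + r2); first exact: addr_gt0.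
move=> t tT; have [t0|t0] := leP 0 t.
  rewrite full_ge0//; apply: mo (H1 t _) _; last by rewrite lerDl ltW.
  by rewrite t0 -(ger0_norm t0).
rewrite (full_le0 _ (ltW t0)); apply: cls2_sw; apply: mo (H2 (- t) _) _; last by rewrite lerDr ltW.
by rewrite oppr_ge0 ltW//= -(ltr0_norm t0).
Qed.

Lemma full_bd T k : exists2 B, 0 <= B & forall t, `|t| <= T -> bd2 k B (full t).
Proof.
have [r1 r10 H1] := sol_bd p0 r0 r00 cp0 T k.
have [r2 r20 H2] := sol_bd (sw p0) r0 r00 (cls2_sw _ _ cp0) T k.
exists (r1 + r2); first exact: addr_ge0.
move=> t tT; have [t0|t0] := leP 0 t.
  rewrite full_ge0//; apply: bd2_mono (H1 t _) => //; first by rewrite lerDl.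
  by rewrite t0 -(ger0_norm t0).
rewrite (full_le0 _ (ltW t0)); apply: bd2_sw; apply: bd2_mono (H2 (- t) _) => //.
  by rewrite lerDr.
by rewrite oppr_ge0 ltW//= -(ltr0_norm t0).
Qed.

Lemma nl2_sw p : nl2 (sw p) = scl (-1) (sw (nl2 p)).
Proof.
by congr pair; apply/funext => x; apply/funext => y /=; rewrite mulN1r ?opprK.
Qed.

(** Each half-line inherits [sol_quad], whose base time is the one closer to 0; on the negative side
    the exchange of components turns [nl2] into its negative, as reversal of time demands. *)
Lemma full_outward T k : exists2 C, 0 <= C & forall m u, (0 <= m <= u) || (u <= m <= 0) -> `|u| <= T ->
  bd2 k (C * (u - m) ^+ 2) (dif (dif (full u) (full m)) (scl (u - m) (nl2 (full m)))).
Proof.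
have [C1 C10 H1] := sol_quad p0 r0 r00 cp0 T k.
have [C2 C20 H2] := sol_quad (sw p0) r0 r00 (cls2_sw _ _ cp0) T k.
exists (C1 + C2); first exact: addr_ge0.
move=> m u /orP[/andP[m0 mu]|/andP[um m0]] uT.
  have u0 : 0 <= u := le_trans m0 mu.
  rewrite !full_ge0//; apply: bd2_mono (H1 m u m0 mu _) => //; last by rewrite -(ger0_norm u0).
  by rewrite ler_wpM2r ?sqr_ge0// lerDl.
have u0 : u <= 0 := le_trans um m0.
have := H2 (- m) (- u).
rewrite oppr_ge0 lerN2 -(ler0_norm u0) => /(_ m0 um uT) H.
rewrite !full_le0//.
rewrite nl2_sw.
have {}H := bd2_sw _ _ _ H.
rewrite (ler0_norm u0) in H.
rewrite (_ : dif _ _ = sw (dif (dif (sol (sw p0) (- u)) (sol (sw p0) (- m)))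
  (scl (- u - - m) (nl2 (sol (sw p0) (- m)))))); last first.
  move: (sol (sw p0) (- u)) (sol (sw p0) (- m)) => a b.
  move: (nl2 b) => c.
  by rewrite /sw /dif /scl /=; congr pair; apply/funext => x; apply/funext => y /=; ring.
apply: bd2_mono H => //.
rewrite (_ : (- u - - m) ^+ 2 = (u - m) ^+ 2); last by ring.
by rewrite ler_wpM2r ?sqr_ge0// lerDr.
Qed.

(* Estimates that hold when moving away from [0] extend to all pairs of times by
   passing through the median of [0], [s] and [t]. *)
Lemma median s t : exists m, [/\ (0 <= m <= s) || (s <= m <= 0),
  (0 <= m <= t) || (t <= m <= 0), `|s - m| <= `|t - s| & `|t - m| <= `|t - s|].
Proof.
have [s0|s0] := leP 0 s; have [t0|t0] := leP 0 t; have [st'|ts] := leP s t.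
- exists s; rewrite subrr normr0 lexx s0 st'; split => //.
- by exists t; rewrite subrr normr0 t0 lexx (ltW ts) distrC; split.
- by move: (lt_le_trans t0 s0); rewrite ltNge st'.
- exists 0; rewrite !subr0 !lexx s0 (ltW t0) orbT; split => //.
    by rewrite ger0_norm// ltr0_norm ?subr_lt0//; lra.
  by rewrite ltr0_norm// ltr0_norm ?subr_lt0//; lra.
- exists 0; rewrite !subr0 !lexx t0 (ltW s0) orbT; split => //.
    by rewrite ltr0_norm// ger0_norm ?subr_ge0//; lra.
  by rewrite ger0_norm// ger0_norm ?subr_ge0//; lra.
- by move: (lt_le_trans s0 t0); rewrite ltNge (ltW ts).
- by exists t; rewrite subrr normr0 st' lexx (ltW t0) distrC !orbT; split.
- exists s; rewrite subrr normr0 lexx (ltW s0) (ltW ts) !orbT; split => //.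
Qed.

Lemma outward_norm (m u : R) T : (0 <= m <= u) || (u <= m <= 0) -> `|u| <= T -> `|m| <= T.
Proof.
case/orP => /andP[a b]; apply: le_trans.
  by rewrite !ger0_norm// (le_trans a b).
by rewrite !ler0_norm ?lerN2// (le_trans a b).
Qed.

Lemma norm_sub2 T (a b : R) : `|a| <= T -> `|b| <= T -> `|a - b| <= 2 * T.
Proof. by move=> ha hb; have := ler_normB a b; move: ha hb; lra. Qed.

Lemma full_lip T k : exists2 C, 0 <= C & forall s t, `|s| <= T -> `|t| <= T ->
  bd2 k (C * `|t - s|) (dif (full t) (full s)).
Proof.
have [T0|T0] := leP 0 T; last first.
  by exists 0 => // s t sT; move: (le_trans (normr_ge0 s) sT); rewrite leNgt T0.
have [Q Q0 HQ] := full_outward T k.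
have [r rr cT] := full_cls T; have [B B0 HB] := full_bd T k.+1.
have [N N0 HN] := bd2_nl2 k r B rr B0.
pose L := Q * (2 * T) + N.
have L0 : 0 <= L by rewrite addr_ge0// mulr_ge0// mulr_ge0.
have out m u : (0 <= m <= u) || (u <= m <= 0) -> `|u| <= T ->
    bd2 k (L * `|u - m|) (dif (full u) (full m)).
  move=> mu uT; have mT := outward_norm m u T mu uT.
  have := bd2_dif _ _ _ _ _ (HQ m u mu uT) (bd2_scl _ _ (-1) _
     (bd2_scl _ _ (u - m) _ (HN _ (cT m mT) (HB m mT)))).
  rewrite (_ : dif _ _ = dif (full u) (full m)); last first.
    move: (full u) (full m) => a b; move: (nl2 b) => c.
    by rewrite /dif /scl; congr pair; apply/funext => x; apply/funext => y /=; ring.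
  apply: bd2_mono => //; rewrite normrN1 mul1r /L mulrDl [N * _]mulrC lerD//.
  rewrite -[(u - m) ^+ 2]real_normK ?num_real// expr2 -!mulrA ler_wpM2l// mulrA ler_wpM2r//.
  exact: norm_sub2.
exists (2 * L); first exact: mulr_ge0.
move=> s t sT tT; have [m [ms mt d1 d2]] := median s t.
have := bd2_tri _ _ _ _ _ _ (out m t mt tT) (bd2_sym _ _ _ _ (out m s ms sT)).
apply: bd2_mono => //.
have := lerD (ler_wpM2l L0 d2) (ler_wpM2l L0 d1).
by move/le_trans; apply; rewrite le_eqVlt; apply/orP; left; apply/eqP; move: `|t - s| => w; ring.
Qed.

(** Subtracting the outward expansions at [t] and [s], both based at the median [m], leaves [nl2] at
    [m]; moving it to [s] costs [(t - s)] times a Lipschitz error. This also gives differentiability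
    across time 0. *)
Lemma full_quad T k : exists2 C, 0 <= C & forall s t, `|s| <= T -> `|t| <= T ->
  bd2 k (C * (t - s) ^+ 2) (dif (dif (full t) (full s)) (scl (t - s) (nl2 (full s)))).
Proof.
have [Q Q0 HQ] := full_outward T k.
have [r rr cT] := full_cls T; have [B B0 HB] := full_bd T k.+1.
have [N N0 HN] := nl2_lip k r B rr B0.
have [L L0 HL] := full_lip T k.+1.
exists (Q + Q + N * L); first by rewrite !addr_ge0// mulr_ge0.
move=> s t sT tT; have [m [ms mt d1 d2]] := median s t.
have mT := outward_norm m s T ms sT.
have X := bd2_scl _ _ (t - s) _ (HN _ _ _ (cT m mT) (cT s sT) (HB m mT) (HB s sT) (HL s m sT mT)).
have := bd2_dif _ _ _ _ _ (bd2_dif _ _ _ _ _ (HQ m t mt tT) (HQ m s ms sT)) (bd2_scl _ _ (-1) _ X).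
rewrite (_ : dif _ _ = dif (dif (full t) (full s)) (scl (t - s) (nl2 (full s)))); last first.
  move: (full t) (full s) (full m) => a b c; move: (nl2 b) (nl2 c) => e f.
  by rewrite /dif /scl; congr pair; apply/funext => x; apply/funext => y /=; ring.
apply: bd2_mono => //; rewrite normrN1 mul1r.
have sq (u : R) : `|u| <= `|t - s| -> u ^+ 2 <= (t - s) ^+ 2.
  by move=> h; rewrite -[u ^+ 2]real_normK ?num_real// -[(t - s) ^+ 2]real_normK ?num_real// ler_pXn2r ?nnegrE.
rewrite !mulrDl; apply: lerD.
  by apply: lerD; apply: ler_wpM2l => //; exact: sq.
rewrite -[(t - s) ^+ 2]real_normK ?num_real//.
have d3 : `|m - s| <= `|t - s| by rewrite distrC.
have := ler_wpM2l (mulr_ge0 (mulr_ge0 N0 L0) (normr_ge0 (t - s))) d3.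
move: `|t - s| `|m - s| => w v h; rewrite (_ : w * _ = N * L * w * v); last by ring.
by apply: le_trans h _; rewrite expr2 mulrA.
Qed.

End two_sided.

(** * Time derivatives of all orders *)

Section time_smooth.
Context {R : realType}.
Local Notation pl := (R -> R -> R).
Implicit Types (t s T : R) (n k : nat) (f g : R -> pl).

Definition slab f := forall T k, exists B, forall t, `|t| <= T -> bd k B (f t).

(** The analogue of [pd] in time, with the remainder measured in every C^k of the space variables.
    Space derivatives and [U] can therefore be applied to the remainder directly. *)
Definition tpd f g := forall T k, exists C, forall s t, `|s| <= T -> `|t| <= T ->
  bd k (C * (t - s) ^+ 2) (fun x y => f t x y - f s x y - (t - s) * g s x y).

Fixpoint TS n f : Prop :=
  slab f /\ if n is m.+1 then exists2 g, tpd f g & TS m g else True.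

Definition tsupp f := forall T, exists2 r, 0 < r & forall t, `|t| <= T -> supped r (f t).

Lemma TS_slab n f : TS n f -> slab f.
Proof. by case: n => [|n] []. Qed.

Lemma slab_sm f t : slab f -> sm (f t).
Proof. by move=> sf k; have [B H] := sf `|t| k; exists B; exact: H. Qed.

Lemma slab_ge f : slab f -> forall T k, exists2 B, 0 <= B & forall t, `|t| <= T -> bd k B (f t).
Proof.
move=> sf T k; have [B H] := sf T k; exists `|B| => // t tT.
by apply: bd_mono (H t tT) => //; exact: ler_norm.
Qed.

Lemma tpd_ge f g : tpd f g -> forall T k, exists2 C, 0 <= C & forall s t, `|s| <= T -> `|t| <= T ->
  bd k (C * (t - s) ^+ 2) (fun x y => f t x y - f s x y - (t - s) * g s x y).
Proof.
move=> sf T k; have [B H] := sf T k; exists `|B| => // s t sT tT.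
by apply: bd_mono (H s t sT tT) => //; rewrite ler_wpM2r ?sqr_ge0// ler_norm.
Qed.

Lemma tpd_lip f g : tpd f g -> slab g -> forall T k, exists2 C, 0 <= C &
  forall s t, `|s| <= T -> `|t| <= T -> bd k (C * `|t - s|) (fun x y => f t x y - f s x y).
Proof.
move=> fg sg T k; have [C C0 H] := tpd_ge _ _ fg T k; have [B B0 HB] := slab_ge _ sg T k.
have [T0|T0] := leP 0 T; last first.
  by exists 0 => // s t sT; move: (le_trans (normr_ge0 s) sT); rewrite leNgt T0.
exists (C * (2 * T) + B); first by rewrite addr_ge0// mulr_ge0// mulr_ge0.
move=> s t sT tT; have := bd_add _ _ _ _ _ (H s t sT tT) (bd_scale _ _ _ (t - s) (HB s sT)).
rewrite (_ : (fun x y => _) = (fun x y => f t x y - f s x y)); last first.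
  by apply/funext => x; apply/funext => y; rewrite subrK.
apply: bd_mono => //; rewrite mulrDl [B * _]mulrC lerD//.
rewrite -[(t - s) ^+ 2]real_normK ?num_real// expr2 -!mulrA ler_wpM2l// mulrA ler_wpM2r//.
exact: norm_sub2.
Qed.

Lemma tpd_lin f g f' g' (c e : R) : tpd f f' -> tpd g g' ->
  tpd (fun t x y => c * f t x y + e * g t x y) (fun t x y => c * f' t x y + e * g' t x y).
Proof.
move=> H1 H2 T k; have [C HC] := H1 T k; have [D HD] := H2 T k.
exists (`|c| * C + `|e| * D) => s t sT tT.
have := bd_lin _ _ _ _ _ c e (HC s t sT tT) (HD s t sT tT).
have -> : forall u v w : R, u * (C * w) + v * (D * w) = (u * C + v * D) * w by move=> *; ring.
congr bd; apply/funext => x; apply/funext => y /=.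
by move: (f t x y) (f s x y) (f' s x y) (g t x y) (g s x y) (g' s x y) => *; ring.
Qed.

Lemma slab_lin f g (c e : R) : slab f -> slab g -> slab (fun t x y => c * f t x y + e * g t x y).
Proof.
move=> H1 H2 T k; have [C HC] := H1 T k; have [D HD] := H2 T k.
by eexists => t tT; apply: bd_lin; [exact: HC | exact: HD].
Qed.

Lemma TS_lin n f g (c e : R) : TS n f -> TS n g -> TS n (fun t x y => c * f t x y + e * g t x y).
Proof.
elim: n f g => [|n IH] f g [sf Hf] [sg Hg]; split=> //; try exact: slab_lin.
have [f' pf tf] := Hf; have [g' pg tg] := Hg.
exists (fun t x y => c * f' t x y + e * g' t x y); first exact: tpd_lin.
exact: IH.
Qed.

Lemma slab_mul f g : slab f -> slab g -> slab (fun t x y => f t x y * g t x y).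
Proof.
move=> H1 H2 T k; have [C HC] := H1 T k; have [D HD] := H2 T k.
by eexists => t tT; apply: bd_mul; [exact: HC | exact: HD].
Qed.

(** The factors [1] put the derivative in the form to which [TS_lin] applies. *)
Lemma tpd_mul f g f' g' : slab f -> slab g -> slab f' -> slab g' -> tpd f f' -> tpd g g' ->
  tpd (fun t x y => f t x y * g t x y)
      (fun t x y => 1 * (f' t x y * g t x y) + 1 * (f t x y * g' t x y)).
Proof.
move=> sf sg sf' sg' pf pg T k.
have [F F0 HF] := slab_ge _ sf T k; have [G G0 HG] := slab_ge _ sg T k.
have [F' F'0 HF'] := slab_ge _ sf' T k.
have [C C0 HC] := tpd_ge _ _ pf T k; have [D D0 HD] := tpd_ge _ _ pg T k.
have [L L0 HL] := tpd_lip _ _ pg sg' T k.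
exists (2 ^+ k * (C * G) + 2 ^+ k * (F' * L) + 2 ^+ k * (F * D)) => s t sT tT.
have X1 := bd_mul _ _ _ _ _ (HC s t sT tT) (HG t tT).
have X2 := bd_scale _ _ _ (t - s) (bd_mul _ _ _ _ _ (HF' s sT) (HL s t sT tT)).
have X3 := bd_mul _ _ _ _ _ (HF s sT) (HD s t sT tT).
have := bd_add _ _ _ _ _ (bd_add _ _ _ _ _ X1 X2) X3.
have -> : 2 ^+ k * (C * (t - s) ^+ 2 * G) + `|t - s| * (2 ^+ k * (F' * (L * `|t - s|))) +
    2 ^+ k * (F * (D * (t - s) ^+ 2)) =
   (2 ^+ k * (C * G) + 2 ^+ k * (F' * L) + 2 ^+ k * (F * D)) * (t - s) ^+ 2.
  by rewrite -[(t - s) ^+ 2]real_normK ?num_real//; move: `|t - s| (2 ^+ k) => *; ring.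
congr bd; apply/funext => x; apply/funext => y /=.
by move: (f t x y) (f s x y) (f' s x y) (g t x y) (g s x y) (g' s x y) => *; ring.
Qed.

Lemma TS_pred n f : TS n.+1 f -> TS n f.
Proof.
elim: n f => [|n IH] f [sf [g pg tg]]; first by split.
by split => //; exists g => //; exact: IH.
Qed.

Lemma TS_mul n f g : TS n f -> TS n g -> TS n (fun t x y => f t x y * g t x y).
Proof.
elim: n f g => [|n IH] f g tf tg.
  by split => //; apply: slab_mul; [exact: TS_slab tf | exact: TS_slab tg].
have tf0 := TS_pred _ _ tf; have tg0 := TS_pred _ _ tg.
have [sf [f' pf tf']] := tf; have [sg [g' pg tg']] := tg.
split; first exact: slab_mul.
eexists; first exact: (tpd_mul _ _ _ _ sf sg (TS_slab _ _ tf') (TS_slab _ _ tg') pf pg).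
by apply: TS_lin; exact: IH.
Qed.

Lemma tpd_d i f g : slab f -> slab g -> tpd f g -> tpd (fun t => d i (f t)) (fun t => d i (g t)).
Proof.
move=> sf sg fg T k; have [C H] := fg T k.+1; exists C => s t sT tT.
have smf u := slab_sm f u sf; have smg u := slab_sm g u sg.
have := bd_d _ _ _ i (H s t sT tT).
rewrite d_sub; [|exact: sm_sub | exact: sm_scale].
by rewrite d_sub// d_scale.
Qed.

Lemma TS_d i n f : TS n f -> TS n (fun t => d i (f t)).
Proof.
have sl h : slab h -> slab (fun t => d i (h t)).
  by move=> sf T k; have [B H] := sf T k.+1; exists B => t /H; exact: bd_d.
elim: n f => [|n IH] f [sf Hf]; first by split => //; exact: sl.
split; first exact: sl.
have [g pg tg] := Hf; exists (fun t => d i (g t)); last exact: IH.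
by apply: tpd_d => //; exact: TS_slab tg.
Qed.

Lemma tpd_pointwise f g t x y : tpd f g -> is_derive t (1 : R) (fun s => f s x y) (g t x y).
Proof.
move=> fg.
have [C H] := fg (`|t| + 1) 0%N.
have E : h^-1 *: (((fun s => f s x y) \o shift t) (h *: (1:R)) - f t x y) @[h --> 0^'] --> g t x y.
  apply/cvgrPdist_le => e e0.
  have C0 : 0 <= C.
    have t1 : `|t| <= `|t| + 1 by rewrite lerDl.
    have t2 : `|t + 1| <= `|t| + 1 by rewrite (le_trans (ler_normD _ _))// normr1.
    by have := bd_ge0 _ _ _ (H t (t + 1) t1 t2); rewrite (addrC t) addrK expr1n mulr1.
  near=> h.
  have hn0 : h != 0 by near: h; exact: nbhs_dnbhs_neq.
  have h1 : `|h| <= 1 by near: h; exact: dnbhs0_le.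
  have hle : `|h| <= e / (C + 1).
    by near: h; apply: dnbhs0_le; rewrite divr_gt0// ltr_wpDl.
  have tT : `|t| <= `|t| + 1 by rewrite lerDl.
  have thT : `|h + t| <= `|t| + 1 by rewrite addrC (le_trans (ler_normD _ _))// lerD2l.
  have := bd_le0 _ _ _ (H t (h + t) tT thT) x y; rewrite addrK => Hh.
  rewrite /= [_%:A]mulr1 distrC.
  rewrite (_ : _ - g t x y = h^-1 * (f (h + t) x y - f t x y - h * g t x y)); last first.
    by rewrite /GRing.scale /=; move: (f (h + t) x y) (f t x y) (g t x y) => a b c; field.
  rewrite normrM normfV ler_pdivrMl ?normr_gt0//.
  apply: (le_trans Hh); rewrite -[h ^+ 2]real_normK ?num_real// expr2 mulrCA.
  rewrite ler_wpM2l//; apply: (@le_trans _ _ ((C + 1) * `|h|)).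
    by rewrite ler_wpM2r// lerDl.
  by rewrite mulrC -ler_pdivlMr// ltr_wpDl.
apply: DeriveDef; first by apply/cvg_ex; exists (g t x y).
by rewrite /derive; apply/cvg_lim.
Unshelve. all: by end_near. Qed.

Lemma tpd_uniq f g g' : tpd f g -> tpd f g' -> g = g'.
Proof.
move=> H H'; apply/funext => t; apply/funext => x; apply/funext => y.
have [_ <-] := tpd_pointwise f g t x y H.
by have [_ ->] := tpd_pointwise f g' t x y H'.
Qed.

Lemma tpd_tsupp f g : tpd f g -> tsupp f -> tsupp g.
Proof.
(* The extra unit of time makes the support bound hold in a neighbourhood of [t], also when
   [|t| = T]. *)
move=> fg sf T; have [r r0 H] := sf (`|T| + 1); exists r => // t tT x y.
suff K : (r < `|x|) || (r < `|y|) -> g t x y = 0.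
  move=> gn; suff : ~~ ((r < `|x|) || (r < `|y|)) by rewrite negb_or -!leNgt => /andP[].
  by apply: contraNN gn => /K ->.
move=> out; have [_ <-] := tpd_pointwise f g t x y fg.
have tT' : `|t| < `|T| + 1.
  by apply: le_lt_trans tT _; apply: le_lt_trans (ler_norm T) _; rewrite ltrDl.
have -> : 'D_1 (fun s => f s x y) t = 'D_1 (fun=> (0 : R)) t.
  apply: near_eq_derive.
  near=> s; apply: supped0 (H s _) out.
  apply: (@le_trans _ _ (`|t| + `|s - t|)).
    by rewrite -{1}(subrK t s) addrC ler_normD.
  rewrite addrC -lerBrDr; near: s.
  have e0 : 0 < `|T| + 1 - `|t| by rewrite subr_gt0.
  by near do rewrite distrC; apply: cvgr_dist_le; [exact: cvg_id | exact: e0].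
exact: derive_cst.
Unshelve. all: by end_near. Qed.

Lemma slab_U i f : slab f -> tsupp f -> slab (fun t => U i (f t)).
Proof.
move=> sf pf T k; have [r r0 H] := pf T; have [B HB] := sf T k.
by exists (20 * r * B) => t tT; apply: bd_U; [exact: slab_sm | exact: H | | exact: HB].
Qed.

Lemma TS_U i n f : TS n f -> tsupp f -> TS n (fun t => U i (f t)).
Proof.
elim: n f => [|n IH] f [sf Hf] pf; first by split => //; exact: slab_U.
split; first exact: slab_U.
have [g fg tg] := Hf; have pg := tpd_tsupp _ _ fg pf; have sg := TS_slab _ _ tg.
exists (fun t => U i (g t)); last exact: IH.
move=> T k; have [C H] := fg T k; have [r1 r10 P1] := pf T; have [r2 r20 P2] := pg T.
pose r := r1 + r2.
have r0 : 0 < r by rewrite addr_gt0.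
exists (20 * r * C) => s t sT tT.
have smf u := slab_sm f u sf; have smg u := slab_sm g u sg.
have Q1 u : `|u| <= T -> supped r (f u).
  by move=> uT; apply: supped_mono (P1 u uT); rewrite lerDl ltW.
have Q2 u : `|u| <= T -> supped r (g u).
  by move=> uT; apply: supped_mono (P2 u uT); rewrite lerDr ltW.
have s1 : supped r (fun x y => f t x y - f s x y) by apply: supped_sub; exact: Q1.
have s2 : supped r (fun x y => (t - s) * g s x y) by apply: supped_mulr; exact: Q2.
have m1 : sm (fun x y => f t x y - f s x y) by exact: sm_sub.
have m2 : sm (fun x y => (t - s) * g s x y) by exact: sm_scale.
have := bd_U k i _ r _ (sm_sub _ _ m1 m2) (supped_sub _ _ _ s1 s2) r0 (H s t sT tT).
rewrite mulrA (U_sub i _ _ r)// (U_sub i _ _ r)//; last 2 first.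
- exact: Q1.
- exact: Q1.
by rewrite (U_scale i _ _ r)//; exact: Q2.
Qed.

Lemma TS_nl n f g : TS n f -> TS n g -> tsupp g -> TS n (fun t => nl (f t) (g t)).
Proof.
move=> tf tg pg.
have := TS_lin n _ _ 1 1 (TS_mul _ _ _ (TS_U false _ _ tg pg) (TS_d false _ _ tf))
   (TS_mul _ _ _ (TS_U true _ _ tg pg) (TS_d true _ _ tf)).
by congr TS; apply/funext => t; apply/funext => x; apply/funext => y; rewrite /nl !mul1r.
Qed.

(** Bootstrap: the time derivative is [nl] of the solution, which has as many time derivatives as
    the solution itself because [nl] involves only space operations. So [n] derivatives yield
    [n + 1]. *)
Lemma TS_full (p0 : pl * pl) (r0 : R) : 0 < r0 -> cls2 r0 p0 ->
  forall n, TS n (fun t => (full p0 t).1) /\ TS n (fun t => (full p0 t).2).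
Proof.
move=> r00 cp0.
have s1 : slab (fun t => (full p0 t).1).
  by move=> T k; have [B B0 H] := full_bd p0 r0 r00 cp0 T k; exists B => t /H [].
have s2 : slab (fun t => (full p0 t).2).
  by move=> T k; have [B B0 H] := full_bd p0 r0 r00 cp0 T k; exists B => t /H [].
have q1 : tsupp (fun t => (full p0 t).1).
  by move=> T; have [r rr H] := full_cls p0 r0 r00 cp0 T; exists r => // t /H [[]].
have q2 : tsupp (fun t => (full p0 t).2).
  by move=> T; have [r rr H] := full_cls p0 r0 r00 cp0 T; exists r => // t /H [_ []].
elim=> [|n [IH1 IH2]]; first by split; split.
split; split => //.
  exists (fun t => nl (full p0 t).1 (full p0 t).2); last exact: TS_nl.
  by move=> T k; have [C C0 H] := full_quad p0 r0 r00 cp0 T k; exists C => s t sT tT;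
    have [] := H s t sT tT.
exists (fun t x y => - nl (full p0 t).2 (full p0 t).1 x y).
  by move=> T k; have [C C0 H] := full_quad p0 r0 r00 cp0 T k; exists C => s t sT tT;
    have [] := H s t sT tT.
have tn := TS_nl n _ _ IH2 IH1 q1.
have := TS_lin n _ _ (-1) 0 tn tn.
by congr TS; apply/funext => t; apply/funext => x; apply/funext => y; rewrite mul0r addr0 mulN1r.
Qed.

End time_smooth.

(** * Joint smoothness in space-time and passage to the notions of the statement *)

Section spacetime.
Context {R : realType}.
Local Notation pl := (R -> R -> R).
Local Notation V3 := (R * (R * R))%type.
Implicit Types (t s T a b c : R) (n k : nat) (f g : R -> pl).

Definition lin3 a b c (v : V3) : R := v.1 * a + (v.2.1 * b + v.2.2 * c).

Lemma lin3_linear a b c : linear (lin3 a b c).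
Proof.
move=> k u v; rewrite /lin3 /= /GRing.scale /=.
by move: u v => [u1 [u2 u3]] [v1 [v2 v3]] /=; rewrite /GRing.scale /=; ring.
Qed.

HB.instance Definition _ a b c := GRing.isLinear.Build R V3 R *:%R (lin3 a b c) (lin3_linear a b c).

Lemma norm3 (v : V3) : [/\ `|v.1| <= `|v|, `|v.2.1| <= `|v| & `|v.2.2| <= `|v|].
Proof.
have p1 : `|v.1| <= `|v| by rewrite prod_normE le_max lexx.
have p2 : `|v.2| <= `|v| by rewrite prod_normE le_max lexx orbT.
split => //; apply: le_trans p2; rewrite prod_normE le_max lexx ?orbT//.
Qed.

Lemma continuous_lin3 a b c : continuous (lin3 a b c).
Proof.
move=> v; rewrite /lin3.
have c1 : {for v, continuous (fun u : V3 => u.1)} by exact: cvg_fst.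
have c2 : {for v, continuous (fun u : V3 => u.2)} by exact: cvg_snd.
have c21 : {for v, continuous (fun u : V3 => u.2.1)}.
  by apply: (continuous_comp c2); exact: cvg_fst.
have c22 : {for v, continuous (fun u : V3 => u.2.2)}.
  by apply: (continuous_comp c2); exact: cvg_snd.
apply: cvgD; first by apply: cvgMl; exact: c1.
by apply: cvgD; apply: cvgMl; [exact: c21 | exact: c22].
Qed.

Definition stf f : V3 -> R := fun z => f z.1 z.2.1 z.2.2.

(** The increment is taken first in space at the fixed time, then in time at the displaced point;
    moving [g] back to [z] costs a mixed quadratic term. *)
Lemma stf_taylor f g (z : V3) : slab f -> slab g -> tpd f g -> exists2 K, 0 <= K &
  forall v : V3, `|v| <= 1 -> `|stf f (v + z) - stf f z -
    lin3 (stf g z) (stf (fun t => d false (f t)) z) (stf (fun t => d true (f t)) z) v| <= K * `|v| ^+ 2.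
Proof.
move=> sf sg fg; case: z => [t [x y]].
pose T := `|t| + 1.
have [C C0 HC] := tpd_ge _ _ fg T 0.
have [B B0 HB] := slab_ge _ sf T 2; have [B' B'0 HB'] := slab_ge _ sg T 1.
exists (C + 2 * B' + 4 * B); first by rewrite !addr_ge0// mulr_ge0.
move=> v v1; have [n1 n2 n3] := norm3 v.
move: v v1 n1 n2 n3 => [tau [p q]]; set w := `|_|; move: w => w /= w1 n1 n2 n3.
have w0 : 0 <= w := le_trans (normr_ge0 _) n1.
have tT : `|t| <= T by rewrite lerDl.
have ttT : `|t + tau| <= T by rewrite (le_trans (ler_normD _ _))// lerD2l (le_trans n1).
rewrite /stf /lin3 /= !(addrC _ t) !(addrC _ x) !(addrC _ y).
have -> : f (t + tau) (x + p) (y + q) - f t x y -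
    (tau * g t x y + (p * d false (f t) x y + q * d true (f t) x y)) =
  (f (t + tau) (x + p) (y + q) - f t (x + p) (y + q) - tau * g t (x + p) (y + q)) +
  tau * (g t (x + p) (y + q) - g t x y) +
  (f t (x + p) (y + q) - f t x y - p * d false (f t) x y - q * d true (f t) x y).
  move: (f (t + tau) (x + p) (y + q)) (f t x y) (f t (x + p) (y + q)) (g t (x + p) (y + q)) (g t x y).
  by move: (d false (f t) x y) (d true (f t) x y) => *; ring.
have E1 := bd_le0 _ _ _ (HC t (t + tau) tT ttT) (x + p) (y + q).
rewrite (addrC t) addrK in E1.
have E2 := bd_lip _ _ _ x y p q (HB' t tT).
have E3 := bd_taylor _ _ _ x y p q (HB t tT).
have pq : `|p| + `|q| <= 2 * w by have := lerD n2 n3; lra.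
have pq0 : 0 <= `|p| + `|q| by rewrite addr_ge0.
rewrite (addrC t).
apply: le_trans (ler_normD _ _) _; rewrite 2!mulrDl; apply: lerD.
  apply: le_trans (ler_normD _ _) (lerD _ _).
    apply: le_trans E1 _; rewrite ler_wpM2l// -[tau ^+ 2]real_normK ?num_real//.
    by rewrite ler_pXn2r ?nnegrE.
  rewrite normrM; apply: (@le_trans _ _ (w * (B' * (2 * w)))).
    by apply: ler_pM => //; apply: le_trans E2 _; rewrite ler_wpM2l.
  by rewrite le_eqVlt; apply/orP; left; apply/eqP; ring.
apply: le_trans E3 _; apply: (@le_trans _ _ (B * (2 * w) ^+ 2)).
  by rewrite ler_wpM2l// ler_pXn2r ?nnegrE ?mulr_ge0.
by rewrite le_eqVlt; apply/orP; left; apply/eqP; ring.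
Qed.

Lemma stf_differential f g (z : V3) : slab f -> slab g -> tpd f g ->
  differentiable (stf f) z /\
  forall v, 'D_v (stf f) z =
    lin3 (stf g z) (stf (fun t => d false (f t)) z) (stf (fun t => d true (f t)) z) v.
Proof.
move=> sf sg fg; have [K K0 HK] := stf_taylor f g z sf sg fg.
set L := lin3 _ _ _.
have cL : continuous L by exact: continuous_lin3.
have E : stf f \o shift z = cst (stf f z) + L +o_ (0 : V3) id.
  apply/eqaddoP => e e0.
  have eK : 0 < e / (K + 1) by rewrite divr_gt0// ltr_wpDl.
  have N1 : \forall v \near (0 : V3), `|v| <= 1 by exact: (nbhs0_le ltr01).
  have N2 : \forall v \near (0 : V3), `|v| <= e / (K + 1) by exact: (nbhs0_le eK).
  near=> v.
  have v1 : `|v| <= 1 by near: v; exact: N1.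
  have ve : `|v| <= e / (K + 1) by near: v; exact: N2.
  have -> : ((stf f \o shift z) - (cst (stf f z) + L)) v = stf f (v + z) - stf f z - L v.
    by rewrite !fctE /= opprD addrA.
  have := HK v v1; rewrite -/L => /le_trans; apply.
  rewrite expr2 mulrA ler_wpM2r//; apply: (@le_trans _ _ ((K + 1) * `|v|)).
    by rewrite ler_wpM2r// lerDl.
  by rewrite mulrC -ler_pdivlMr// ltr_wpDl.
have dL := diff_unique cL E.
have df : differentiable (stf f) z.
  by apply/diff_locallyP; rewrite dL.
by split => // v; rewrite deriveE// dL.
Unshelve. all: by end_near. Qed.

Definition TI f := forall n, TS n f.

(** Each order supplies its own time derivative; by uniqueness they are all the same function. *)
Lemma TI_tpd f : TI f -> exists2 g, tpd f g & TI g.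
Proof.
move=> tf; have [_ [g fg _]] := tf 1%N; exists g => // n.
by have [_ [g' fg' tg']] := tf n.+1; rewrite (tpd_uniq _ _ _ fg fg').
Qed.

(** The class [TI] is closed under directional derivatives: in a fixed direction these are constant
    combinations of the time derivative and of the two space derivatives. *)
Lemma smooth_stf f : TI f -> smooth (stf f).
Proof.
move=> tf k; elim: k f tf => [|k IH] f tf.
  have [g fg tg] := TI_tpd f tf; move=> z.
  apply: differentiable_continuous.
  by have [] := stf_differential f g z (TS_slab _ _ (tf 0%N)) (TS_slab _ _ (tg 0%N)) fg.
have [g fg tg] := TI_tpd f tf.
have H z := stf_differential f g z (TS_slab _ _ (tf 0%N)) (TS_slab _ _ (tg 0%N)) fg.
split; first by move=> z; have [] := H z.
move=> v.
have -> : (fun z => 'D_v (stf f) z) = stf (fun t x y => v.1 * g t x y +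
     1 * (v.2.1 * d false (f t) x y + v.2.2 * d true (f t) x y)).
  by apply/funext => z; have [_ ->] := H z; rewrite /stf /lin3 mul1r.
apply: IH => n; apply: TS_lin; first exact: tg.
by apply: TS_lin; exact: TS_d.
Qed.

Lemma derive_dir i (F : pl) (v x : R * R) : sm F -> v = (if i then (0, 1) else (1, 0)) ->
  'D_v (fun z => F z.1 z.2) x = d i F x.1 x.2.
Proof.
move=> sF vE; have [C HC] := sm_pd _ i sF; rewrite /derive; apply/cvg_lim => //.
have := @quad_cvg R (fun h => sh i h F x.1 x.2) (d i F x.1 x.2) C.
rewrite sh0 => /(_ (fun h => HC h x.1 x.2)).
rewrite (_ : (fun h => h^-1 * _) = (fun h => h^-1 *:
  (((fun z => F z.1 z.2) \o shift x) (h *: v) - F x.1 x.2)))//.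
apply/funext => h; rewrite /= vE /sh /GRing.scale /=.
by case: (i); rewrite /= /GRing.scale /= ?mulr0 ?mulr1 ?add0r (addrC h).
Qed.

Lemma biot_savartE (F : pl) (x : R * R) :
  biot_savart (fun z => F z.1 z.2) x = (U false F x.1 x.2, U true F x.1 x.2).
Proof. by rewrite !UE. Qed.

Lemma tpd_shift f g (s : R) : tpd f g -> tpd (fun t => f (t - s)) (fun t => g (t - s)).
Proof.
move=> fg T k; have [C HC] := fg (T + `|s|) k; exists C => u v uT vT.
have b (w : R) : `|w| <= T -> `|w - s| <= T + `|s|.
  by move=> wT; rewrite (le_trans (ler_normB _ _))// lerD2r.
have := HC (u - s) (v - s) (b _ uT) (b _ vT).
by rewrite (_ : v - s - (u - s) = v - u)//; ring.
Qed.

Lemma full_derive (p0 : pl * pl) (r0 : R) (s : R) t x y : 0 < r0 -> cls2 r0 p0 ->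
  derive1 (fun u => (full p0 (u - s)).1 x y) t =
    nl (full p0 (t - s)).1 (full p0 (t - s)).2 x y /\
  derive1 (fun u => (full p0 (u - s)).2 x y) t =
    - nl (full p0 (t - s)).2 (full p0 (t - s)).1 x y.
Proof.
move=> r00 cp0; split.
  have H : tpd (fun t => (full p0 t).1) (fun t => nl (full p0 t).1 (full p0 t).2).
    by move=> T k; have [C C0 H] := full_quad p0 r0 r00 cp0 T k; exists C => u v uT vT;
    have [] := H u v uT vT.
  by rewrite derive1E; have [_ ->] := tpd_pointwise _ _ t x y (tpd_shift _ _ s H).
have H : tpd (fun t => (full p0 t).2) (fun t x y => - nl (full p0 t).2 (full p0 t).1 x y).
  by move=> T k; have [C C0 H] := full_quad p0 r0 r00 cp0 T k; exists C => u v uT vT;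
  have [] := H u v uT vT.
by rewrite derive1E; have [_ ->] := tpd_pointwise _ _ t x y (tpd_shift _ _ s H).
Qed.

Lemma TS_shift n f (s : R) : TS n f -> TS n (fun t => f (t - s)).
Proof.
have sl h : slab h -> slab (fun t => h (t - s)).
  move=> sh T k; have [B HB] := sh (T + `|s|) k; exists B => t tT; apply: HB.
  by rewrite (le_trans (ler_normB _ _))// lerD2r.
elim: n f => [|n IH] f [sf Hf]; first by split => //; exact: sl.
split; first exact: sl.
have [g fg tg] := Hf; exists (fun t => g (t - s)); first exact: tpd_shift fg.
exact: IH.
Qed.

Lemma compact_tsupp f (s : R) : tsupp f ->
  compactly_supported_in_space (fun t (x : R * R) => f (t - s) x.1 x.2).
Proof.
move=> pf T T0; have [r r0 H] := pf (T + `|s|).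
pose K : set V3 := `[0, T]%classic `*` (`[- r, r]%classic `*` `[- r, r]%classic).
have cK : compact K.
  by apply: compact_setX; [|apply: compact_setX]; exact: segment_compact.
apply: (subclosed_compact _ cK); first exact: closed_closure.
have clK : closed K by apply: compact_closed => //; exact: norm_hausdorff.
have EK : closure K = K by apply/esym/closure_id.
rewrite -[X in _ `<=` X]EK; apply: closure_subset => z [/andP[z0 zT]] fz.
have zs : `|z.1 - s| <= T + `|s|.
  by rewrite (le_trans (ler_normB _ _))// lerD2r ger0_norm.
have [h1 h2] := H _ zs _ _ fz.
rewrite /K /=; split; first by rewrite in_itv/= z0 zT.
by split; rewrite in_itv/= -ler_norml.
Qed.

End spacetime.

(** * Initial data and crossing of the supports *)

Section bump.
Context {R : realType}.
Local Notation pl := (R -> R -> R).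
Implicit Types (s u x y : R) (n k : nat).

Definition powexp n u : R := u ^+ n * expR (- u).

Lemma powexp_derive n u :
  is_derive u (1 : R) (powexp n) (n%:R * powexp n.-1 u - powexp n u).
Proof.
elim: n => [|n IH].
  have -> : powexp 0 = expR \o (fun v : R => - v).
    by apply/funext => v; rewrite /powexp expr0 mul1r.
  have D : is_derive u (1 : R) (fun v : R => - v) (- 1) by exact: is_deriveN.
  have := is_derive1_comp (is_derive_expR (- u)) D.
  by move=> K; apply: (is_derive_eq K); rewrite /= mul0r sub0r mulrN mulr1.
have -> : powexp n.+1 = (fun v : R => v) * powexp n.
  by apply/funext => v; rewrite /powexp !fctE exprS mulrA.
apply: (is_derive_eq (is_deriveM (is_derive_id u 1) IH)).
rewrite /GRing.scale /= mulr1 mulrBr mulrCA -[(n.+1)%:R]natr1 mulrDl mul1r.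
have -> : n%:R * (u * powexp n.-1 u) = n%:R * powexp n u.
  by case: n {IH} => [|n]; [rewrite !mul0r | congr (_ * _); rewrite /powexp /= exprS mulrA].
by rewrite !fctE addrAC.
Qed.

Lemma powexp_bound n u : 0 <= u -> 0 <= powexp n u <= (n`!)%:R.
Proof.
move=> u0; rewrite mulr_ge0 ?exprn_ge0 ?expR_ge0//=.
have f0 : 0 < (n`!)%:R :> R by rewrite ltr0n fact_gt0.
rewrite /powexp expRN ler_pdivrMr ?expR_gt0// -ler_pdivrMl// mulrC.
case: n f0 => [|n] f0.
  by rewrite expr0 fact0 divr1 -expR0 ler_expR.
by apply: le_trans (expR_ge1Dxn n u0); rewrite lerDr.
Qed.

(** The functions [s^-n exp(-1/s)], extended by 0. As a family they are closed under differentiation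
    up to linear combinations, so all of them are proved smooth at once by induction on the
    order. *)
Definition flat n s : R := if 0 < s then powexp n s^-1 else 0.

Lemma flat_bound n s : `|flat n s| <= (n`!)%:R.
Proof.
rewrite /flat; case: ltP => [s0|_]; last by rewrite normr0.
have si : 0 <= s^-1 by rewrite invr_ge0 ltW.
by have /andP[a b] := powexp_bound n _ si; rewrite ger0_norm.
Qed.

Lemma flat_derive n s : is_derive s (1 : R) (flat n) (- n%:R * flat n.+1 s + flat n.+2 s).
Proof.
have [s0|s0|->] := ltgtP s 0.
- have F m : flat m s = 0 by rewrite /flat ltNge (ltW s0).
  rewrite !F mulr0 addr0.
  have D : is_derive s (1 : R) (cst (0 : R)) (0 : R) by exact: is_derive_cst.
  apply: near_eq_is_derive D.
  near=> t; rewrite /flat.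
  have t0 : t < 0 by near: t; exact: lt_nbhsl.
  by rewrite ltNge (ltW t0).
- have sn : s != 0 by rewrite gt_eqF.
  have D : is_derive s (1 : R) (fun t : R => t^-1) (- s ^- 2 *: (1 : R)).
    exact: is_deriveV.
  have E : is_derive s (1 : R) (powexp n \o (fun t : R => t^-1))
      (- n%:R * flat n.+1 s + flat n.+2 s).
  apply: (is_derive_eq (is_derive1_comp (powexp_derive n s^-1) D)).
  have F m : flat m s = powexp m s^-1 by rewrite /flat s0.
  rewrite /GRing.scale /= mulr1 !F -exprVn mulrN mulrBl opprB mulNr addrC.
  congr (_ + _).
    congr (- _); case: n => [|n]; first by rewrite !mul0r.
    rewrite -mulrA; apply: (congr1 (fun v => n.+1%:R * v)).
    by rewrite /powexp mulrAC -exprD addn2.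
  by rewrite /powexp mulrAC -exprD addn2.
  apply: near_eq_is_derive E.
  near=> t; rewrite /flat.
  have -> : 0 < t by near: t; exact: lt_nbhsr.
  by [].
- have F m : flat m 0 = 0 by rewrite /flat ltxx.
  rewrite !F mulr0 addr0.
  (* At 0 the identity [flat n h = h ^+ 2 * flat n.+2 h] for [h > 0] exhibits a quadratic remainder
     with derivative 0. *)
  apply: (@quad_is_derive R _ _ _ (n.+2`!)%:R) => h.
  rewrite add0r F subr0 mulr0 subr0.
  have [h0|h0] := ltP 0 h; last by rewrite /flat ltNge h0/= normr0 mulr_ge0// sqr_ge0.
  have -> : flat n h = h ^+ 2 * flat n.+2 h.
    rewrite /flat h0 /powexp mulrA; congr (_ * _).
    by rewrite -[n.+2]add2n exprD mulrA -exprMn mulfV ?gt_eqF// expr1n mul1r.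
  by rewrite normrM (ger0_norm (sqr_ge0 h)) mulrC ler_wpM2r ?sqr_ge0// flat_bound.
Unshelve. all: by end_near. Qed.

Lemma pd_of_derive (b b' b'' : R -> R) (M : R) :
  (forall s, is_derive s (1 : R) b (b' s)) -> (forall s, is_derive s (1 : R) b' (b'' s)) ->
  (forall s, `|b'' s| <= M) -> pd false (fun x _ => b x) (fun x _ => b' x).
Proof.
move=> H H' HM; exists M => u x y; rewrite /sh.
have [t /andP[t0 t1] ->] := @mvt_shift R b b' x u H.
have [r _ E] := @mvt_shift R b' b'' x (t * u) H'.
rewrite -mulrBr E !normrM (ger0_norm t0) mulrA.
rewrite -[u ^+ 2]real_normK ?num_real// expr2 [M * _]mulrC.
rewrite ler_pM ?mulr_ge0//.
by rewrite ler_wpM2l// ler_piMl.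
Qed.

Lemma pd_true_cst (b : R -> R) : pd true (fun x _ => b x) (fun _ _ => 0).
Proof. by exists 0 => u x y; rewrite /sh subrr mulr0 subr0 mul0r normr0. Qed.

Lemma sm_flat n : sm (fun x _ => flat n x).
Proof.
move=> k; elim: k n => [|k IH] n.
  by exists (n`!)%:R; split => // x y; exact: flat_bound.
have [M1 b1] := IH n.+1; have [M2 b2] := IH n.+2.
have bl := bd_lin _ _ _ _ _ (- n%:R) 1 b1 b2.
have M0 := bd_ge0 _ _ _ bl.
exists ((n`!)%:R + (`|- n%:R| * M1 + `|1| * M2)); apply: bdS => [x y|].
  by apply: le_trans (flat_bound n x) _; rewrite lerDl.
case.
  exists (fun _ _ => 0); first exact: pd_true_cst.
  by apply: bd_mono (bd_cst k 0) => //; rewrite normr0 addr_ge0.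
exists (fun x y => - n%:R * flat n.+1 x + 1 * flat n.+2 x); last first.
  by apply: bd_mono bl => //; rewrite lerDr.
pose b' x := - n%:R * flat n.+1 x + flat n.+2 x.
have -> : (fun x y : R => - n%:R * flat n.+1 x + 1 * flat n.+2 x) = (fun x _ => b' x).
  by apply/funext => x; apply/funext => y; rewrite mul1r.
pose b'' x := - n%:R * (- n.+1%:R * flat n.+2 x + flat n.+3 x) + (- n.+2%:R * flat n.+3 x + flat n.+4 x).
have D' x : is_derive x (1 : R) b' (b'' x).
  have -> : b' = (- n%:R \*: flat n.+1) + flat n.+2.
    by apply/funext => z; rewrite !fctE.
  by apply: is_deriveD; [apply: is_deriveZ; exact: flat_derive | exact: flat_derive].
suff [M HM] : exists M : R, forall s, `|b'' s| <= M.
  exact: (pd_of_derive (flat n) b' b'' M (flat_derive n) D' HM).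
have F2 s := flat_bound n.+2 s; have F3 s := flat_bound n.+3 s.
have F4 s := flat_bound n.+4 s.
rewrite /b''; move: (n.+2`!%:R) (n.+3`!%:R) (n.+4`!%:R) F2 F3 F4 => m2 m3 m4 F2 F3 F4.
exists (n%:R * (n.+1%:R * m2 + m3) + (n.+2%:R * m3 + m4)) => s.
apply: le_trans (ler_normD _ _) (lerD _ _).
  rewrite mulNr normrN normrM ger0_norm// ler_wpM2l//.
  apply: le_trans (ler_normD _ _) (lerD _ _) => //.
  by rewrite mulNr normrN normrM ger0_norm// ler_wpM2l.
apply: le_trans (ler_normD _ _) (lerD _ _) => //.
by rewrite mulNr normrN normrM ger0_norm// ler_wpM2l.
Qed.

Lemma sm_affine (b : R -> R) (p q c : R) : sm (fun x _ => b x) ->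
  sm (fun x y => b (p * x + q * y + c)).
Proof.
move=> sb k; elim: k b sb => [|k IH] b sb.
  have [M [bM _]] := sb 0%N; exists M; split => // x y; exact: (bM _ 0).
have [M [bM _]] := sb 0%N.
pose b' x := d false (fun x _ => b x) x 0.
have E : d false (fun x _ => b x) = (fun x _ => b' x).
  by apply/funext => x; apply/funext => y; rewrite /b' !dE.
have sb' : sm (fun x _ => b' x) by rewrite -E; exact: sm_d.
have [M' bM'] := IH b' sb'; have M'0 := bd_ge0 _ _ _ bM'.
have [C HC] := sm_pd _ false sb; rewrite E in HC.
have C0 := quad_ge0 _ _ HC.
have M0 : 0 <= M := le_trans (normr_ge0 _) (bM 0 0).
exists (M + (`|p| + `|q|) * M'); apply: bdS => [x y|i].
  by apply: le_trans (bM _ 0) _; rewrite lerDl mulr_ge0// addr_ge0.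
pose r := if i then q else p.
exists (fun x y => r * b' (p * x + q * y + c)).
  exists (C * r ^+ 2) => s x y.
  have := HC (r * s) (p * x + q * y + c) 0.
  rewrite {1}/sh (_ : sh i s _ x y = b (p * x + q * y + c + r * s)); last first.
    by rewrite /sh /r; case: (i); congr b; ring.
  by rewrite exprMn [C * (_ * _)]mulrA [r * s]mulrC -[s * r * b' _]mulrA.
apply: bd_mono (bd_scale _ _ _ r bM') => //.
rewrite ler_wpDl// ler_wpM2r// /r; case: (i); rewrite ?lerDr ?lerDl normr_ge0 //.
Qed.

Definition bump s : R := flat 0 s * flat 0 (1 - s).

Lemma bump_ge0 s : 0 <= bump s.
Proof.
rewrite /bump /flat; case: ltP => s0; last by rewrite mul0r.
case: ltP => s1; last by rewrite mulr0.
by rewrite mulr_ge0// /powexp mulr_ge0 ?expr0 ?expR_ge0.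
Qed.

Lemma bump_neq0 s : bump s != 0 -> 0 < s < 1.
Proof.
rewrite /bump /flat; case: ltP => s0; last by rewrite mul0r eqxx.
by case: ltP => s1; [rewrite subr_gt0 in s1; rewrite s1 | rewrite mulr0 eqxx].
Qed.

(** A bound uniform in [s] is required: the foot point of a characteristic is known only after the
    accuracy has been fixed, and that accuracy is taken from [c]. *)
Lemma bump_lower s0 : 0 < s0 -> exists2 c, 0 < c & forall s, s0 <= s -> s <= 1 / 2 -> c <= bump s.
Proof.
move=> s00; exists (expR (- s0^-1) * expR (- 2)); first by rewrite mulr_gt0 ?expR_gt0.
move=> s s1 s2; rewrite /bump /flat.
have sp : 0 < s := lt_le_trans s00 s1.
have s1' : 1 / 2 <= 1 - s by lra.
have sp' : 0 < 1 - s by apply: lt_le_trans s1'; rewrite divr_gt0.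
rewrite sp sp' /powexp !expr0 !mul1r ler_pM ?expR_ge0// ler_expR lerN2.
  by rewrite lef_pV2 ?posrE.
rewrite -[leRHS]invrK lef_pV2 ?posrE ?invr_gt0//; move: s1'; lra.
Qed.

Lemma sm_bump (p q : R) : sm (fun x y => bump (p * x + q * y)).
Proof.
have := sm_mul _ _ (sm_affine (flat 0) p q 0 (sm_flat 0)) (sm_affine (flat 0) (- p) (- q) 1 (sm_flat 0)).
congr sm; apply/funext => x; apply/funext => y; rewrite /bump addr0; congr (_ * flat _ _); ring.
Qed.

(* The supports lie in the cones [0 <= y <= x] and [0 <= - x <= y], which meet at
   the origin only. *)
Definition gp : pl := fun x y => bump (0 * x + 1 * y) * bump (1 * x + (-1) * y).
Definition gm : pl := fun x y => bump ((-1) * x + 0 * y) * bump (1 * x + 1 * y).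

Lemma gp_ge0 x y : 0 <= gp x y.
Proof. by rewrite mulr_ge0 ?bump_ge0. Qed.

Lemma gm_ge0 x y : 0 <= gm x y.
Proof. by rewrite mulr_ge0 ?bump_ge0. Qed.

Lemma gp_neq0 x y : gp x y != 0 -> [/\ 0 < y, y < 1, y < x & x < y + 1].
Proof.
rewrite /gp mulf_eq0 negb_or => /andP[/bump_neq0/andP[a b] /bump_neq0/andP[c e]].
by split; lra.
Qed.

Lemma gm_neq0 x y : gm x y != 0 -> [/\ x < 0, - x < 1, 0 < x + y & x + y < 1].
Proof.
rewrite /gm mulf_eq0 negb_or => /andP[/bump_neq0/andP[a b] /bump_neq0/andP[c e]].
by split; lra.
Qed.

Lemma cls_gp : cls 2 gp.
Proof.
split; first by apply: sm_mul; exact: sm_bump.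
move=> x y /gp_neq0[a b c e]; rewrite !ler_norml; split; apply/andP; split; lra.
Qed.

Lemma cls_gm : cls 2 gm.
Proof.
split; first by apply: sm_mul; exact: sm_bump.
move=> x y /gm_neq0[a b c e]; rewrite !ler_norml; split; apply/andP; split; lra.
Qed.

Lemma bump_pair_lower (s0 : R) : 0 < s0 -> exists2 c, 0 < c &
  (forall x y, s0 <= y -> y <= 1 / 2 -> s0 <= x - y -> x - y <= 1 / 2 -> c <= gp x y) /\
  (forall x y, s0 <= - x -> - x <= 1 / 2 -> s0 <= x + y -> x + y <= 1 / 2 -> c <= gm x y).
Proof.
move=> s00; have [c c0 H] := bump_lower s0 s00.
exists (c * c); first exact: mulr_gt0.
split => x y h1 h2 h3 h4; rewrite /gp /gm ler_pM ?(ltW c0)//; apply: H; lra.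
Qed.

End bump.

(** * Signs of the velocities at the origin *)

Section crossing.
Context {R : realType}.
Local Notation pl := (R -> R -> R).
Local Notation RR := (measurableTypeR R * measurableTypeR R)%type.
Local Notation mu2 := ((@lebesgue_measure R \x @lebesgue_measure R)%E).
Implicit Types (x y c e r t : R) (g : pl).

(** A pointwise comparison of integrands, integrated. The indicator of a box, of area [4 * r ^+ 2],
    makes the resulting inequality strict when [e] and [r] are positive. *)
Lemma U_lower g c e x0 y0 r s : sm g -> supped s g -> 0 <= r ->
  (forall x y, e * boxind x0 y0 r (x, y) + c * (kern true (0 - x) (0 - y) * g x y)
     <= kern false (0 - x) (0 - y) * g x y) ->
  e * (4 * r ^+ 2) + c * U true g 0 0 <= U false g 0 0.
Proof.
move=> sg pg r0 H; rewrite !UE.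
have I0 := integrable_integrand false g 0 0 s sg pg.
have I1 := integrable_integrand true g 0 0 s sg pg.
have Ib := dominated_integrable _ _ (dominated_box x0 y0 r r0).
have I1' : mu2.-integrable setT (EFin \o (fun z : RR => c * (kern true (0 - z.1) (0 - z.2) * g z.1 z.2))).
  by have := integrableZl measurableT c I1; apply: eq_integrable => // z _ /=; rewrite EFinM.
have Ib' : mu2.-integrable setT (EFin \o (fun z : RR => e * boxind x0 y0 r z)).
  by have := integrableZl measurableT e Ib; apply: eq_integrable => // z _ /=; rewrite EFinM.
have Is : mu2.-integrable setT (EFin \o (fun z : RR => e * boxind x0 y0 r z +
    c * (kern true (0 - z.1) (0 - z.2) * g z.1 z.2))).
  by have := integrableD measurableT Ib' I1'; apply: eq_integrable => // z _ /=; rewrite EFinD.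
have := le_Rintegral measurableT Is I0.
rewrite RintegralD// !RintegralZl// => K.
have -> : 4 * r ^+ 2 = Rintegral mu2 setT (boxind x0 y0 r).
  by rewrite /Rintegral integral_boxind.
by apply: K => -[x y] _; exact: (H x y).
Qed.

Lemma kern_gap x y c : kern false (0 - x) (0 - y) - c * kern true (0 - x) (0 - y) =
  (2 * pi)^-1 * ((y + c * x) / (x ^+ 2 + y ^+ 2)).
Proof.
rewrite /kern !sub0r !sqrrN opprK; move: (2 * pi)^-1 (_ + _)^-1 => p q; ring.
Qed.

Lemma pi2_gt0 : 0 < (2 * pi : R)^-1.
Proof. by rewrite invr_gt0 mulr_gt0// pi_gt0. Qed.

Lemma U_gap_ge0 g c s : cls s g -> (forall x y, 0 <= g x y) ->
  (forall x y, g x y != 0 -> 0 <= y + c * x) -> c * U true g 0 0 <= U false g 0 0.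
Proof.
move=> [sg pg] g0 H.
have := U_lower g c 0 0 0 0 s sg pg (lexx 0); rewrite mul0r add0r; apply => x y.
rewrite mul0r add0r -subr_ge0 mulrA -mulrBl kern_gap.
have [->|gn] := eqVneq (g x y) 0; first by rewrite mulr0.
apply: (mulr_ge0 _ (g0 x y)); apply: (mulr_ge0 (ltW pi2_gt0)).
by apply: divr_ge0; [exact: H | apply: addr_ge0; exact: sqr_ge0].
Qed.

Lemma U_gp_gap (c : R) : 0 <= c -> c * U true gp 0 0 < U false gp 0 0.
Proof.
move=> c0.
have q0 : 0 < 1 / 4 :> R by lra.
have [e e0 [He _]] := bump_pair_lower _ q0.
have [sg pg] := @cls_gp R.
(* On the test box [y + c * x] is at least [1 / 4], [x ^+ 2 + y ^+ 2] is at most 5, and [gp] is at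
   least [e]. *)
pose k := (2 * pi)^-1 * (1 / 4) / 5 * e : R.
have k0 : 0 < k.
  by rewrite /k; apply: mulr_gt0 e0; rewrite divr_gt0// mulr_gt0// pi2_gt0.
have r0 : 0 < 1 / 24 :> R by lra.
(* On this box both [y] and [x - y] stay between [1 / 4] and [1 / 2], where [bump_pair_lower]
   applies. *)
have := U_lower gp c k (3 / 4) (3 / 8) (1 / 24) 2 sg pg (ltW r0).
suff H : forall x y, k * boxind (3 / 4) (3 / 8) (1 / 24) (x, y) +
    c * (kern true (0 - x) (0 - y) * gp x y) <= kern false (0 - x) (0 - y) * gp x y.
  move=> /(_ H); apply: lt_le_trans; rewrite ltrDr.
  by rewrite mulr_gt0// mulr_gt0// exprn_gt0.
move=> x y; rewrite -lerBrDr mulrA -mulrBl kern_gap.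
have G0 := gp_ge0 x y.
rewrite boxindE /=; case: (boolP (_ && _)) => [/andP[]|_]; last first.
  have [->|gn] := eqVneq (gp x y) 0; first by rewrite !mulr0.
  have [y0 _ yx _] := gp_neq0 x y gn; rewrite mulr0.
  apply: (mulr_ge0 _ G0); apply: (mulr_ge0 (ltW pi2_gt0)).
  apply: divr_ge0; last by apply: addr_ge0; exact: sqr_ge0.
  by apply: addr_ge0 (ltW y0) _; apply: (mulr_ge0 c0); apply: le_trans (ltW yx); exact: ltW.
rewrite mulr1 !ler_distl => /andP[x1 x2] /andP[y1 y2].
have x0 : 0 <= c * x by apply: (mulr_ge0 c0); lra.
have ge : e <= gp x y by apply: He; lra.
rewrite /k; apply: (ler_pM _ (ltW e0) _ ge).
  apply: mulr_ge0; last by rewrite invr_ge0.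
  by apply: mulr_ge0; [exact: ltW pi2_gt0 | rewrite divr_ge0].
rewrite -mulrA; apply: (ler_wpM2l (ltW pi2_gt0)).
have sq : 0 < x ^+ 2 + y ^+ 2 <= 5.
  apply/andP; split; last by nra.
  by apply: ltr_pwDl; [apply: exprn_gt0; lra | exact: sqr_ge0].
have /andP[s0 s5] := sq.
apply: ler_pM; [lra | by rewrite invr_ge0 | lra |].
by rewrite lef_pV2 ?posrE.
Qed.

End crossing.

(** * Closed supports and traced points *)

Section crossing_supports.
Context {R : realType}.
Local Notation pl := (R -> R -> R).
Implicit Types (x y u v c e r s t : R) (f g : pl).

Lemma continuous_sm f : sm f -> continuous (fun z : R * R => f z.1 z.2).
Proof.
move=> sf z; have [M bM] := sf 1%N; have M0 := bd_ge0 _ _ _ bM.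
apply/cvgrPdist_le => e e0.
have Mp : 0 < 2 * M + 1 by rewrite ltr_wpDl ?mulr_ge0.
have eM : 0 < e / (2 * M + 1) by rewrite divr_gt0.
near=> w.
have zw : `|w - z| <= e / (2 * M + 1).
  by rewrite distrC; near: w; apply: cvgr_dist_le; [exact: cvg_id | exact: eM].
have := bd_lip _ _ _ z.1 z.2 (w.1 - z.1) (w.2 - z.2) bM.
rewrite !subrKC distrC => /le_trans; apply.
have : `|w.1 - z.1| <= `|w - z| /\ `|w.2 - z.2| <= `|w - z|.
  by rewrite prod_normE !le_max !lexx orbT.
move: zw (normr_ge0 (w - z)); rewrite ler_pdivlMr//.
move: `|w - z| `|w.1 - z.1| `|w.2 - z.2| => p q q' pe p0 [qp qp'].
apply: (@le_trans _ _ (M * (p + p))); first exact: ler_wpM2l (lerD qp qp').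
by move: pe p0; lra.
Unshelve. all: by end_near. Qed.

Lemma supp_ge0 (f F : R * R -> R) z : continuous F ->
  (forall w, f w != 0 -> 0 <= F w) -> supp f z -> 0 <= F z.
Proof.
move=> cF H; have cl : closed (F @^-1` [set x | 0 <= x]).
  by apply: closed_comp => [w _|]; [exact: cF | exact: closed_ge].
by rewrite /supp => /(closure_subset H); rewrite -(closure_id _).1.
Qed.

Lemma interior_supp (f : R * R -> R) z : continuous f -> f z != 0 -> interior (supp f) z.
Proof.
move=> cf fz; have op : open (f @^-1` [set x | x != 0]).
  by apply: open_comp => [w _|]; [exact: cf | exact: open_neq].
apply: (@interiorS _ _ (supp f)); first exact: subset_closure.
by rewrite /interior /=; exact: open_nbhs_nbhs.
Qed.

Lemma small_time (k1 e1 k2 e2 : R) : 0 <= k1 -> 0 < e1 -> 0 <= k2 -> 0 < e2 ->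
  exists t : R, [/\ 0 < t <= 1, k1 * t <= e1 & k2 * t <= e2].
Proof.
move=> k10 e10 k20 e20; pose q := k1 / e1 + k2 / e2 + 1.
have h1 : 0 <= k1 / e1 by rewrite divr_ge0// ltW.
have h2 : 0 <= k2 / e2 by rewrite divr_ge0// ltW.
have q0 : 0 < q by rewrite /q; lra.
exists q^-1; split.
- by rewrite invr_gt0 q0 invf_le1//; rewrite /q; lra.
- by rewrite ler_pdivrMr// mulrC -ler_pdivrMr// /q; lra.
- by rewrite ler_pdivrMr// mulrC -ler_pdivrMr// /q; lra.
Qed.

(** Running [sol_char] with accuracy below [t ^+ 2] absorbs the positional error into the
    second-order term, while the accuracy of the values remains free. *)
Lemma sol_trace (p0 : pl * pl) (r0 : R) : 0 < r0 -> cls2 r0 p0 -> exists2 C, 0 <= C &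
  forall t x y e, 0 < t <= 1 -> 0 < e ->
  (exists u v, [/\ `|p0.1 u v - (sol p0 t).1 x y| <= e,
     `|u - x - t * U false p0.2 x y| <= C * t ^+ 2 &
     `|v - y - t * U true p0.2 x y| <= C * t ^+ 2]) /\
  (exists u v, [/\ `|p0.2 u v - (sol p0 t).2 x y| <= e,
     `|u - x + t * U false p0.1 x y| <= C * t ^+ 2 &
     `|v - y + t * U true p0.1 x y| <= C * t ^+ 2]).
Proof.
move=> r00 cp; have [C C0 H] := sol_char p0 r0 r00 cp.
exists (C + 1); first exact: addr_ge0.
move=> t x y e /andP[t0 t1] e0.
have t20 : 0 < t ^+ 2 by exact: exprn_gt0.
have m0 : 0 < Num.min e (t ^+ 2) by rewrite lt_min e0.
have t01 : 0 <= t <= 1 by rewrite ltW.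
have m1 : Num.min e (t ^+ 2) <= e by rewrite ge_min lexx.
have m2 : C * t ^+ 2 + Num.min e (t ^+ 2) <= (C + 1) * t ^+ 2.
  by rewrite mulrDl mul1r lerD2l ge_min lexx orbT.
have [[u [v [h1 h2 h3]]] [u' [v' [k1 k2 k3]]]] := H t x y _ t01 m0.
split; [exists u, v | exists u', v'].
  by split; [exact: le_trans h1 m1 | exact: le_trans h2 m2 | exact: le_trans h3 m2].
by split; [exact: le_trans k1 m1 | exact: le_trans k2 m2 | exact: le_trans k3 m2].
Qed.

Lemma near_neq0 (a b : R) : a != 0 -> `|b - a| <= `|a| / 2 -> b != 0.
Proof.
move=> a0; apply: contraTneq => ->; rewrite sub0r normrN -ltNge.
by have : 0 < `|a| by [rewrite normr_gt0]; lra.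
Qed.

End crossing_supports.

(** * Separation before the contact and overlap after it *)

Section crossing_time.
Context {R : realType}.
Local Notation pl := (R -> R -> R).
Implicit Types (x y u v c e r s t : R) (f g : pl).
Local Notation p0 := ((@gp R, @gm R) : pl * pl).

(** In a common point the first coordinates give [t * (a' + b') <= 2 * C * t ^+ 2]. But [a'] and
    [b'] are velocities near the origin, within [O(t)] of [a > 0] and [b >= 0], which is impossible
    for small [t]. *)
Lemma backward_contradiction C L t x y a a' b b' b'' : 0 <= C -> 0 <= L -> 0 < t -> t <= 1 ->
  `|a'| <= L -> `|a' - a| <= L * (`|x| + `|y|) -> `|b'| <= L ->
  `|b' - b| <= L * (`|x| + `|y|) -> `|b''| <= L -> 0 < a -> 0 <= b ->
  (2 * C + 8 * (L * (L + C))) * t <= a / 2 ->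
  - (C * t ^+ 2) <= x - t * b' -> - (C * t ^+ 2) <= y - t * b'' ->
  y - t * b'' <= x - t * b' + 2 * (C * t ^+ 2) -> x + t * a' <= C * t ^+ 2 -> False.
Proof.
move=> C0 L0 t0 t1 a1 a2 b1 b2 c1 a0 b0 tk h1 h2 h3 h4.
have tl v : `|v| <= L -> - (t * L) <= t * v <= t * L.
  rewrite ler_norml => /andP[v1 v2]; rewrite -mulrN.
  by rewrite (ler_wpM2l (ltW t0) v1) (ler_wpM2l (ltW t0) v2).
have ct : C * t ^+ 2 <= C * t.
  by apply: (ler_wpM2l C0); rewrite expr2; apply: ler_piMl => //; exact: ltW.
have /andP[ta1 ta2] := tl _ a1; have /andP[tb1 tb2] := tl _ b1; have /andP[tc1 tc2] := tl _ c1.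
(* The cone conditions confine a common point to distance [O(t)] of the origin; there the velocities
   may be replaced by their values at 0. *)
have xy : `|x| + `|y| <= 4 * (t * (L + C)).
  have x1 : `|x| <= t * (L + C) by rewrite ler_norml; apply/andP; split; lra.
  have y1 : `|y| <= 3 * (t * (L + C)) by rewrite ler_norml; apply/andP; split; lra.
  lra.
have xyL := ler_wpM2l L0 xy.
move: (le_trans a2 xyL) (le_trans b2 xyL); rewrite !ler_norml => /andP[d1 _] /andP[d2 _].
have ab : t * (a' + b') <= t * (2 * (C * t)).
  by move: h1 h4; rewrite mulrDr; lra.
rewrite (ler_pM2l t0) in ab; lra.
Qed.

Let cp0 : cls2 2 p0.
Proof. by split; [exact: cls_gp | exact: cls_gm]. Qed.

Let two0 : 0 < 2 :> R. Proof. by []. Qed.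

(* Backward in time both supports have moved away from the origin in opposite
   directions; the relevant inequalities are closed conditions, so that they
   hold on the closed supports. *)
Lemma backward_conditions : exists2 C, 0 <= C & forall t, 0 < t <= 1 ->
  (forall z, supp (fun z => (full p0 (- t)).2 z.1 z.2) z ->
    z.1 + t * U false gp z.1 z.2 <= C * t ^+ 2) /\
  (forall z, supp (fun z => (full p0 (- t)).1 z.1 z.2) z ->
    [/\ - (C * t ^+ 2) <= z.1 - t * U false gm z.1 z.2,
        - (C * t ^+ 2) <= z.2 - t * U true gm z.1 z.2 &
        z.2 - t * U true gm z.1 z.2 <= z.1 - t * U false gm z.1 z.2 + 2 * (C * t ^+ 2)]).
Proof.
have [C C0 H] := sol_trace (sw p0) 2 two0 (cls2_sw _ _ cp0).
exists C => // t t01; have /andP[t0 t1] := t01.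
have -> : full p0 (- t) = sw (sol (sw p0) t).
  by rewrite full_le0 ?oppr_le0 ?(ltW t0)// opprK.
set w := sol (sw p0) t.
have cU i g : cls 2 g -> continuous (fun z : R * R => U i g z.1 z.2).
  by move=> [sg pg]; apply: continuous_sm; exact: sm_U sg pg.
have ca := cU false _ (@cls_gp R); have cb := cU false _ (@cls_gm R).
have cb2 := cU true _ (@cls_gm R).
have c1 : continuous (fun z : R * R => z.1) by move=> z; exact: cvg_fst.
have c2 : continuous (fun z : R * R => z.2) by move=> z; exact: cvg_snd.
have cB (F G : R * R -> R) k : continuous F -> continuous G -> continuous (fun z => F z + k * G z).
  by move=> cF cG z; apply: continuousD (cF z) _; apply: continuousM; [exact: cvg_cst | exact: cG].
have wm z : w.1 z.1 z.2 != 0 -> z.1 + t * U false gp z.1 z.2 <= C * t ^+ 2.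
  (* Accuracy half the value forces the initial datum to be nonzero at the foot point, which
     therefore lies in the cone. *)
  move=> n0; have [] := H t z.1 z.2 (`|w.1 z.1 z.2| / 2) t01.
    by rewrite divr_gt0 ?normr_gt0.
  move=> [u [v [h1 h2 _]]] _; have := near_neq0 _ _ n0 h1 => /= /gm_neq0[u0 _ _ _].
  by move: h2; rewrite ler_norml /= => /andP[+ _]; move: (t * _) (C * _) u0 => p q; lra.
have wp z : w.2 z.1 z.2 != 0 ->
    [/\ - (C * t ^+ 2) <= z.1 - t * U false gm z.1 z.2,
        - (C * t ^+ 2) <= z.2 - t * U true gm z.1 z.2 &
        z.2 - t * U true gm z.1 z.2 <= z.1 - t * U false gm z.1 z.2 + 2 * (C * t ^+ 2)].
  move=> n0; have [] := H t z.1 z.2 (`|w.2 z.1 z.2| / 2) t01.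
    by rewrite divr_gt0 ?normr_gt0.
  move=> _ [u [v [h1 h2 h3]]]; have := near_neq0 _ _ n0 h1 => /= /gp_neq0[v0 _ vu _].
  move: h2 h3; rewrite !ler_norml /= => /andP[+ +] /andP[].
  move: (t * U false _ _ _) (t * U true _ _ _) (C * _) v0 vu => p p' q v0 vu k1 k2 k3 k4.
  by split; lra.
have cc k : continuous (fun _ : R * R => k : R) by move=> ?; exact: cvg_cst.
have cm := cB _ _ 1 (cc (C * t ^+ 2)) (cB _ _ (- t) c1 cb).
have cm2 := cB _ _ 1 (cc (C * t ^+ 2)) (cB _ _ (- t) c2 cb2).
have cm3 := cB _ _ (-1) (cB _ _ 1 (cc (2 * (C * t ^+ 2))) (cB _ _ (- t) c1 cb)) (cB _ _ (- t) c2 cb2).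
have cp := cB _ _ (-1) (cc (C * t ^+ 2)) (cB _ _ t c1 ca).
(* The conditions are put in the form [0 <= F] with [F] continuous, as [supp_ge0] expects. *)
have n1 (q p r : R) : (0 <= q + 1 * (p + - t * r)) = (- q <= p - t * r) by rewrite mul1r mulNr -lerBlDl sub0r.
have n2 (q p r : R) : (0 <= q + -1 * (p + t * r)) = (p + t * r <= q) by rewrite mulN1r subr_ge0.
have n3 (q p r p' r' : R) : (0 <= q + 1 * (p + - t * r) + -1 * (p' + - t * r')) =
    (p' - t * r' <= p - t * r + q) by rewrite mul1r mulN1r !mulNr subr_ge0 [q + _]addrC.
split=> z zs; [|split].
- rewrite -n2; apply: (supp_ge0 _ _ z cp _ zs) => x h; rewrite n2; exact: wm.
- rewrite -n1; apply: (supp_ge0 _ _ z cm _ zs) => x h; rewrite n1; by have [] := wp x h.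
- rewrite -n1; apply: (supp_ge0 _ _ z cm2 _ zs) => x h; rewrite n1; by have [] := wp x h.
- rewrite -n3; apply: (supp_ge0 _ _ z cm3 _ zs) => x h; rewrite n3; by have [] := wp x h.
Qed.

Let U_const : exists2 L : R, 0 <= L & forall i (b : bool) x y,
  `|U i (if b then gp else gm) x y| <= L /\
  `|U i (if b then gp else gm) x y - U i (if b then gp else gm) 0 0| <= L * (`|x| + `|y|).
Proof.
have K (i b : bool) : exists2 L : R, 0 <= L & bd 1 L (U i (if b then gp else gm)).
  have [L bL] : exists L, bd 1 L (U i (if b then gp else gm) : pl).
    by case: b; [have [sg pg] := @cls_gp R | have [sg pg] := @cls_gm R]; exact: (sm_U _ _ _ sg pg).
  by exists L => //; exact: bd_ge0 bL.
have [l1 p1 b1] := K false false; have [l2 p2 b2] := K false true.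
have [l3 p3 b3] := K true false; have [l4 p4 b4] := K true true.
exists (l1 + l2 + l3 + l4); first by rewrite !addr_ge0.
move=> i b x y.
have [l [ll bl]] : exists l, l <= l1 + l2 + l3 + l4 /\ bd 1 l (U i (if b then gp else gm)).
  by case: i b => -[]; [exists l4|exists l3|exists l2|exists l1]; split => //; lra.
split; first by apply: le_trans ll; case: bl.
have := bd_lip _ _ _ 0 0 x y bl; rewrite !add0r => /le_trans; apply.
by apply: ler_wpM2r ll; exact: addr_ge0.
Qed.

Lemma backward_disjoint : exists2 t, 0 < t &
  supp (fun z => (full p0 (- t)).1 z.1 z.2) `&` supp (fun z => (full p0 (- t)).2 z.1 z.2) = set0.
Proof.
have [C C0 H] := backward_conditions; have [L L0 HL] := U_const.
have := U_gp_gap 0 (lexx (0 : R)); rewrite mul0r => a0.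
have : 0 * U true gm 0 0 <= U false gm 0 0 :> R.
  apply: (U_gap_ge0 _ 0 2) => [|x y|x y /gm_neq0[]]; [exact: cls_gm|exact: gm_ge0|lra].
rewrite mul0r => b0.
have k0 : 0 <= 2 * C + 8 * (L * (L + C)) by rewrite addr_ge0 ?mulr_ge0 ?addr_ge0.
have k1 : 0 < U false gp 0 0 / 2 :> R by rewrite divr_gt0.
have [t [t01 tk _]] := small_time _ _ 0 1 k0 k1 (lexx 0) ltr01.
have /andP[t0 t1] := t01.
exists t => //; rewrite -subset0 => z [zp zm].
have [Hm Hp] := H t t01.
have := Hm z zm; have [] := Hp z zp.
have [a1 a2] := HL false true z.1 z.2.
have [b1 b2] := HL false false z.1 z.2.
have [c1 _] := HL true false z.1 z.2.
move: a1 a2 b1 b2 c1 a0 b0 tk; rewrite /=.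
move: (U false gp _ _) (U false gp _ _) (U false gm _ _) (U false gm _ _) (U true gm _ _).
move: z.1 z.2 => x y {H HL Hm Hp zp zm k1} a a' b b' b'' a1 a2 b1 b2 c1 a0 b0 tk h1 h2 h3 h4.
exact: (backward_contradiction C L t x y a a' b b' b'').
Qed.

(** Replaces the velocity [b'] at a point at distance [O(t)] by its value [b] at the origin; the
    total error [O(t^2)] becomes a small multiple [e] of [t]. *)
Lemma drift_bound C L Q t e u p n b b' : 0 <= L -> 0 < t ->
  `|u - p - t * b'| <= C * t ^+ 2 -> `|b' - b| <= L * n ->
  n <= t * Q -> (C + L * Q) * t <= e -> `|u - p - t * b| <= t * e.
Proof.
move=> L0 t0 h1 h2 h3 h4.
have -> : u - p - t * b = (u - p - t * b') + t * (b' - b) by ring.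
apply: le_trans (ler_normD _ _) _; apply: le_trans (ler_wpM2l (ltW t0) h4).
have -> : t * ((C + L * Q) * t) = C * t ^+ 2 + t * (L * (t * Q)) by ring.
apply: (lerD h1); rewrite normrM (ger0_norm (ltW t0)); apply: (ler_wpM2l (ltW t0)).
exact: le_trans h2 (ler_wpM2l L0 h3).
Qed.

(* The witness is [t * ((- g / 8, A + g / 2) + U gp 0)], the constant [g] being the gap
   [w.1 - w.2 - A] for [w = U gp 0 + U gm 0] and [A] dominating the negative part of
   [w.2]: both flows trace it back into the interior of the initial supports. *)
Lemma forward_overlap : exists t z, [/\ 0 < t, (full p0 t).1 z.1 z.2 != 0 &
  (full p0 t).2 z.1 z.2 != 0].
Proof.
have [C C0 H] := sol_trace p0 2 two0 cp0; have [L L0 HL] := U_const.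
have := U_gp_gap 0 (lexx (0 : R)); rewrite mul0r.
have := U_gp_gap 1 (ler01 : 0 <= (1 : R)); rewrite mul1r.
have H0 : 0 * U true gm 0 0 <= U false gm 0 0 :> R.
  apply: (U_gap_ge0 _ 0 2) => [|x y|x y /gm_neq0[]]; [exact: cls_gm|exact: gm_ge0|lra].
have H1 : 1 * U true gm 0 0 <= U false gm 0 0 :> R.
  apply: (U_gap_ge0 _ 1 2) => [|x y|x y /gm_neq0[]]; [exact: cls_gm|exact: gm_ge0|lra].
move: H0 H1; rewrite mul0r mul1r.
have Da x y : `|U false gp x y - U false gp 0 0| <= L * (`|x| + `|y|) by have [] := HL false true x y.
have Da2 x y : `|U true gp x y - U true gp 0 0| <= L * (`|x| + `|y|) by have [] := HL true true x y.
have Db x y : `|U false gm x y - U false gm 0 0| <= L * (`|x| + `|y|) by have [] := HL false false x y.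
have Db2 x y : `|U true gm x y - U true gm 0 0| <= L * (`|x| + `|y|) by have [] := HL true false x y.
move: Da Da2 Db Db2.
move: (U false gp 0 0) (U true gp 0 0) (U false gm 0 0) (U true gm 0 0) => a a2 b b2 Da Da2 Db Db2.
move=> b0 bb a2a a0.
(* In both cases the gap equals [w.1] minus the larger of [w.2] and 0; its positivity is the content
   of the comparisons with [c = 1] and [c = 0]. *)
have [A [A0 Aw gp0]] : exists A : R, [/\ 0 <= A, 0 <= A + (a2 + b2) & 0 < a + b - (a2 + b2) - A].
  by case: (leP 0 (a2 + b2)) => w2; [exists 0 | exists (- (a2 + b2))]; split; lra.
have [g gE] : exists g : R, g = a + b - (a2 + b2) - A by eexists.
rewrite -gE in gp0.
have [X XE] : exists X : R, X = - (g / 8) + a by eexists.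
have [Y YE] : exists Y : R, Y = A + g / 2 + a2 by eexists.
have k10 : 0 <= C + L * (`|X| + `|Y|) by rewrite addr_ge0 ?mulr_ge0 ?addr_ge0.
have g32 : 0 < g / 32 by rewrite divr_gt0.
have B0 : 0 <= A + g + `|a2 + b2| by have := normr_ge0 (a2 + b2); lra.
have h0 : 0 < 1 / 2 :> R by rewrite divr_gt0.
have [t [t01 tk tB]] := small_time _ _ _ _ k10 g32 B0 h0.
have /andP[t0 t1] := t01.
have tg0 : 0 < t * (g / 16) by rewrite mulr_gt0// divr_gt0.
(* At first order all four cone coordinates of the foot points are at least [t * g / 8]. An error
   [t * g / 32] per coordinate leaves the margin [t * g / 16], and [tB] keeps them below [1 / 2]. *)
have [c c0 [Hp Hm]] := bump_pair_lower _ tg0.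
have xy : `|t * X| + `|t * Y| <= t * (`|X| + `|Y|).
  by rewrite !normrM (ger0_norm (ltW t0)) mulrDr.
exists t, (t * X, t * Y); rewrite full_ge0 ?(ltW t0)//=.
have c20 : 0 < c / 2 by rewrite divr_gt0.
have pos w w' : `|w - w'| <= c / 2 -> c <= w -> w' != 0.
  by rewrite ler_norml => /andP[p q] cw; rewrite gt_eqF//; lra.
have tg : 0 < t * g := mulr_gt0 t0 gp0.
have tA : 0 <= t * A := mulr_ge0 (ltW t0) A0.
have tw := ler_wpM2l (ltW t0) (ler_norm (a2 + b2)).
have tAw := mulr_ge0 (ltW t0) Aw.
have tn := mulr_ge0 (ltW t0) (normr_ge0 (a2 + b2)).
have tgE : t * g = t * (a + b - (a2 + b2) - A) by rewrite gE.
have tX : t * X = t * (- (g / 8) + a) by rewrite XE.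
have tY : t * Y = t * (A + g / 2 + a2) by rewrite YE.
have [] := H t (t * X) (t * Y) _ t01 c20.
move=> [u [v [/pos k1 k2 k3]]] [u' [v' [/pos l1 l2 l3]]]; split => //.
- apply: k1; move: {l1 l2 l3} k2 k3.
  move=> m2 m3.
  have := drift_bound _ _ _ _ _ _ _ _ _ _ L0 t0 m2 (Db _ _) xy tk.
  have := drift_bound _ _ _ _ _ _ _ _ _ _ L0 t0 m3 (Db2 _ _) xy tk; clear m2 m3.
  move: (t * X) (t * Y) tX tY {xy} => x y tX tY.
  rewrite !ler_norml => /andP[p1 p2] /andP[q1 q2].
  move: (`|a2 + b2|) tw tn tB B0 => n tw tn tB B0.
  by apply: Hp; clear -p1 p2 q1 q2 tX tY tgE tg tA tw tAw tn tB; lra.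
- apply: l1; move: {k1 k2 k3} l2 l3.
  have Da' x y : `|- U false gp x y - - a| <= L * (`|x| + `|y|) by rewrite -opprD normrN.
  have Da2' x y : `|- U true gp x y - - a2| <= L * (`|x| + `|y|) by rewrite -opprD normrN.
  have sg p q : p + t * q = p - t * - q by rewrite mulrN opprK.
  rewrite /= (sg _ (U false _ _ _)) (sg _ (U true _ _ _)).
  move=> m2 m3.
  have := drift_bound _ _ _ _ _ _ _ _ _ _ L0 t0 m2 (Da' _ _) xy tk.
  have := drift_bound _ _ _ _ _ _ _ _ _ _ L0 t0 m3 (Da2' _ _) xy tk; clear m2 m3.
  move: (t * X) (t * Y) tX tY {xy} => x y tX tY.
  rewrite !ler_norml => /andP[p1 p2] /andP[q1 q2].
  move: (`|a2 + b2|) tw tn tB B0 => n tw tn tB B0.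
  by apply: Hm; clear -p1 p2 q1 q2 tX tY tgE tg tA tw tAw tn tB; lra.
Qed.

End crossing_time.

Theorem theorem5 (R : realType) :
  exists sigmap sigmam : R -> R * R -> R,
    smooth_in_spacetime sigmap /\ smooth_in_spacetime sigmam /\
    compactly_supported_in_space sigmap /\
    compactly_supported_in_space sigmam /\
    solves_system sigmap sigmam /\
    supp (sigmap 0) `&` supp (sigmam 0) = set0 /\
    exists T : R, 0 < T /\
      interior (supp (sigmap T)) `&` interior (supp (sigmam T)) !=set0.
Proof.
have r0 : 0 < 2 :> R by [].
have cp : cls2 2 (@gp R, @gm R) by split; [exact: cls_gp | exact: cls_gm].
have [s s0 dis] := @backward_disjoint R.
have [t [z [t0 zp zm]]] := @forward_overlap R.
move: dis zp zm; set p0 := (gp, gm) => dis zp zm.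
have cf u : exists2 r, 0 < r & cls2 r (full p0 u).
  by have [r r1 H] := full_cls p0 2 r0 cp `|u|; exists r => //; exact: H.
(* The clock is shifted so that time 0 is the separated configuration at [- s]; the contact occurs
   at time [s], the overlap at [t + s]. *)
exists (fun u (x : R * R) => (full p0 (u - s)).1 x.1 x.2).
exists (fun u (x : R * R) => (full p0 (u - s)).2 x.1 x.2).
split; [|split; [|split; [|split; [|split; [|split]]]]].
- by apply: (smooth_stf (fun u => (full p0 (u - s)).1)) => n; have [H _] := TS_full p0 2 r0 cp n; apply: TS_shift H.
- by apply: (smooth_stf (fun u => (full p0 (u - s)).2)) => n; have [_ H] := TS_full p0 2 r0 cp n; apply: TS_shift H.
- apply: (compact_tsupp (fun u => (full p0 u).1)) => T.
  by have [r r1 H] := full_cls p0 2 r0 cp T; exists r => // u /H[[]].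
- apply: (compact_tsupp (fun u => (full p0 u).2)) => T.
  by have [r r1 H] := full_cls p0 2 r0 cp T; exists r => // u /H[_ []].
- move=> u x _.
  have [r r1 [[sp _] [sm' _]]] := cf (u - s).
  rewrite !biot_savartE /dot /grad /= !(derive_dir false _ (1, 0))// !(derive_dir true _ (0, 1))//.
  have [-> ->] := full_derive p0 2 s u x.1 x.2 r0 cp.
  by rewrite /nl subrr addNr.
- by rewrite sub0r.
- exists (t + s); split; first exact: addr_gt0.
  rewrite addrK; exists z; have [r r1 [[sp _] [sm' _]]] := cf t.
  by split; apply: interior_supp => //; exact: continuous_sm.
Qed.
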